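(* Let the setting described in the context hold, assume $C_{\mathrm{DRO}}>-\infty$, and let $(\varepsilon_{\mathrm{OT}}^{(t)})_{t\in\mathbb N}\subset(0,\infty)$, $(\varsigma^{(t)})_{t\in\mathbb N}\subset\mathbb R_+$, $(\vartheta^{(t)})_{t\in\mathbb N}\subset\mathbb R_+$, and $\varepsilon_{\mathrm{tol}}>\liminf_{t\to\infty}d\big(\varepsilon_{\mathrm{OT}}^{(t)}+(1+\vartheta^{(t)})\varsigma^{(t)}\big)$ be the tolerance inputs of Algorithm 2 (described in the context). (i) In each iteration $t$ of Algorithm 2, the global maximization problem $\mathrm{vio}(\hat{\boldsymbol x}^{(t)},\overline f_1^{(t)},\dots,\overline f_d^{(t)})$ in step (2c) is bounded from above, and a maximizer $\hat{\boldsymbol\lambda}^{(t)}$ can be attained in $\mathcal V_{\mathrm{extr}}$. In the following, assume in addition that $\hat{\boldsymbol\lambda}^{(t)}$ computed in step (2c) satisfies $\hat{\boldsymbol\lambda}^{(t)}\in\mathcal V_{\mathrm{extr}}$ in each iteration of Algorithm 2. Then: (ii) Algorithm 2 terminates after finitely many iterations. Moreover, if $\varepsilon_{\mathrm{OT}}^{(t)}=\varepsilon_{\mathrm{OT}}^{(1)}$, $\varsigma^{(t)}=\varsigma^{(1)}$, $\vartheta^{(t)}=\vartheta^{(1)}$ for all $t\in\mathbb N$, then Algorithm 2 terminates after at most $|\mathcal V_{\mathrm{extr}}|+1$ iterations. (iii) $\widehat C_{\mathrm{DRO}}^{\mathrm{LB}}\le C_{\mathrm{DRO}}\le\widehat C_{\mathrm{DRO}}^{\mathrm{UB}}$,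 $\hat\varepsilon_{\mathrm{sub}}=\widehat C_{\mathrm{DRO}}^{\mathrm{UB}}-\widehat C_{\mathrm{DRO}}^{\mathrm{LB}}\le\varepsilon_{\mathrm{tol}}$, and $\hat\varepsilon_{\mathrm{sub}}\le\hat\varepsilon_{\mathrm{prob}}\le\hat\varepsilon_{\mathrm{sub}}+d\hat\varsigma\le\varepsilon_{\mathrm{tol}}+d\sup_{t\in\mathbb N}\{\varsigma^{(t)}\}$. In particular, both $\hat\varepsilon_{\mathrm{sub}}$ and $\hat\varepsilon_{\mathrm{prob}}$ can be controlled to be arbitrarily close to $0$ by setting the inputs $\varepsilon_{\mathrm{tol}}$ and $(\varsigma^{(t)})_{t\in\mathbb N}$ sufficiently small. (iv) $(\hat\tau,\hat{\boldsymbol\xi}_{\mathrm{in}},\hat{\boldsymbol\xi}_{\mathrm{eq}})$ is an $\hat\varepsilon_{\mathrm{sub}}$-optimizer of (Dual) with objective $\widehat C_{\mathrm{DRO}}^{\mathrm{LB}}$. (v) $(\hat{\boldsymbol x},\tilde f_1,\dots,\tilde f_d)$ is an $\hat\varepsilon_{\mathrm{sub}}$-optimizer of (Primal) with objective $\widehat C_{\mathrm{DRO}}^{\mathrm{UB}}$. (vi) $\hat{\boldsymbol x}$ is an $\hat\varepsilon_{\mathrm{sub}}$-optimizer of (DRO), and $\hat\mu$ is an $\hat\varepsilon_{\mathrm{prob}}$-optimizer of the inner maximization problem $\sup_{\mu\in\Gamma(\mu_1,\dots,\mu_d)}\int_{\boldsymbol\Omega}C_2(\hat{\boldsymbol x},\boldsymbol\omega)\,\mu(\mathrm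 d\boldsymbol\omega)$ in (DRO) with respect to $\hat{\boldsymbol x}$.
   Context: Notation. $\mathbb N=\{1,2,\dots\}$, $\mathbb N_0=\mathbb N\cup\{0\}$, $\mathbb R_+=[0,\infty)$, $\mathbb R_-=(-\infty,0]$; vector inequalities are componentwise; $\langle\cdot,\cdot\rangle$ is the Euclidean inner product. For closed $\mathcal Y\subseteq\mathbb R^n$, $\mathcal P(\mathcal Y)$ is the set of Borel probability measures on $\mathcal Y$ and $\mathcal P_1(\mathcal Y)$ the subset of those with finite first moment; $\mathrm{supp}$ denotes the support, $\delta_{\boldsymbol y}$ the Dirac measure, $g\sharp\mu$ the pushforward. $\mathcal C_{\mathrm{cvx}}(\mathbb R)$ is the set of continuous convex functions $\mathbb R\to\mathbb R$, and $\partial f(z)$ is the convex subdifferential. For a polyhedral convex set $P$, $\mathrm{extr}(P)$ is its set of extreme points, $\mathrm{recc}(P)$ its recession cone, $\mathrm{line}(P)=\mathrm{recc}(P)\cap(-\mathrm{recc}(P))$ its lineality space. An $\varepsilon$-optimizer is a feasible point whose objective is within $\varepsilon$ of the optimal value. Setting. Let $d\ge 2$ be an integer, $\Omega_i=[\underline\omega_i,\overline\omega_i]$ with $-\infty<\underline\omega_i\le\overline\omega_i<\infty$, $\mu_i\in\mathcal P(\Omega_i)$ ($i=1,\dots,d$), and $\boldsymbol\Omega=\Omega_1\times\cdots\times\Omega_d$. $\Gamma(\mu_1,\dots,\mu_d)$ is the set of $\gamma\in\mathcal P(\boldsymbol\Omega)$ whose marginal on $\Omega_i$ is $\mu_i$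 for every $i$. Let $k_1\in\mathbb N$, $\mathbf c_1\in\mathbb R^{k_1}$, $n_{\mathrm{in}},n_{\mathrm{eq}}\in\mathbb N_0$, $\mathbf L_{\mathrm{in}}\in\mathbb R^{n_{\mathrm{in}}\times k_1}$, $\mathbf q_{\mathrm{in}}\in\mathbb R^{n_{\mathrm{in}}}$, $\mathbf L_{\mathrm{eq}}\in\mathbb R^{n_{\mathrm{eq}}\times k_1}$, $\mathbf q_{\mathrm{eq}}\in\mathbb R^{n_{\mathrm{eq}}}$, and assume that $\mathcal S_1:=\{\boldsymbol x\in\mathbb R_+^{k_1}:\mathbf L_{\mathrm{in}}\boldsymbol x\le\mathbf q_{\mathrm{in}},\ \mathbf L_{\mathrm{eq}}\boldsymbol x=\mathbf q_{\mathrm{eq}}\}$ is non-empty. Let $k_2^*\in\mathbb N$, $\mathbf Q\in\mathbb R^{k_2^*\times k_1}$, $\mathbf P\in\mathbb R^{k_2^*\times d}$ with $i$-th column $\mathbf p_i\in\mathbb R^{k_2^*}$, $\mathbf b\in\mathbb R^{k_2^*}$. Let $m_{\mathrm{in}},m_{\mathrm{eq}}\in\mathbb N_0$ with $m_{\mathrm{in}}+m_{\mathrm{eq}}=k_2^*$, $k_2\in\mathbb N$, $\mathbf A_{\mathrm{in}}\in\mathbb R^{m_{\mathrm{in}}\times k_2}$, $\mathbf A_{\mathrm{eq}}\in\mathbb R^{m_{\mathrm{eq}}\times k_2}$, $\mathbf c_2\in\mathbb R^{k_2}$, and assume that $\mathcal S_2^*:=\{(\boldsymbol\lambda_{\mathrm{in}}^{\mathsf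 T},\boldsymbol\lambda_{\mathrm{eq}}^{\mathsf T})^{\mathsf T}:\boldsymbol\lambda_{\mathrm{in}}\in\mathbb R_-^{m_{\mathrm{in}}},\ \boldsymbol\lambda_{\mathrm{eq}}\in\mathbb R^{m_{\mathrm{eq}}},\ \mathbf A_{\mathrm{in}}^{\mathsf T}\boldsymbol\lambda_{\mathrm{in}}+\mathbf A_{\mathrm{eq}}^{\mathsf T}\boldsymbol\lambda_{\mathrm{eq}}\le\mathbf c_2\}\subset\mathbb R^{k_2^*}$ is non-empty. The optimal second-stage cost is $C_2(\boldsymbol x,\boldsymbol\omega):=\max_{\boldsymbol\lambda\in\mathcal S_2^*}\langle\mathbf Q\boldsymbol x+\mathbf P\boldsymbol\omega+\mathbf b,\boldsymbol\lambda\rangle$ for $\boldsymbol x\in\mathcal S_1$, $\boldsymbol\omega\in\boldsymbol\Omega$, and it is assumed that $\sup_{\boldsymbol x\in\mathcal S_1,\boldsymbol\omega\in\boldsymbol\Omega}C_2(\boldsymbol x,\boldsymbol\omega)<\infty$. Let $\mathcal V_{\mathrm{extr}}:=\mathrm{extr}(\mathcal S_2^*\cap\mathrm{line}(\mathcal S_2^* )^\perp)$, a finite subset of $\mathcal S_2^*$. Problem (DRO): minimize over $\boldsymbol x\in\mathcal S_1$ the function $\langle\mathbf c_1,\boldsymbol x\rangle+\sup_{\mu\in\Gamma(\mu_1,\dots,\mu_d)}\int_{\boldsymbol\Omega}C_2(\boldsymbol x,\boldsymbol\omega)\,\mu(\mathrm d\boldsymbol\omega)$; its optimal value is $C_{\mathrm{DRO}}$.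 For $\nu\in\mathcal P_1(\mathbb R)$, $\mathrm{OT}_{\mu_i}(\nu):=\inf_{\gamma\in\Gamma(\mu_i,\nu)}\int_{\Omega_i\times\mathbb R}-z\omega\,\gamma(\mathrm d\omega,\mathrm dz)$, where $\Gamma(\mu_i,\nu)$ is the set of couplings of $\mu_i$ and $\nu$. $\langle\mathbf p_i,\cdot\rangle$ denotes $\boldsymbol\lambda\mapsto\langle\mathbf p_i,\boldsymbol\lambda\rangle$. Problem (Primal): minimize $\langle \mathbf c_1,\boldsymbol x\rangle+\sum_{i=1}^d\int_{\Omega_i}\sup_{z\in\mathbb R}\{z\omega-f_i(z)\}\,\mu_i(\mathrm d\omega)$ over $\boldsymbol x\in\mathbb R_+^{k_1}$, $f_1,\dots,f_d\in\mathcal C_{\mathrm{cvx}}(\mathbb R)$ subject to $\mathbf L_{\mathrm{in}}\boldsymbol x\le \mathbf q_{\mathrm{in}}$, $\mathbf L_{\mathrm{eq}}\boldsymbol x=\mathbf q_{\mathrm{eq}}$, and $\langle \mathbf Q\boldsymbol x+\mathbf b,\boldsymbol\lambda\rangle+\sum_{i=1}^d f_i(\langle\mathbf p_i,\boldsymbol\lambda\rangle)\le 0$ for all $\boldsymbol\lambda\in\mathcal S_2^*$. Problem (Dual): maximize $\int_{\mathcal S_2^*}\langle\mathbf b,\boldsymbol\lambda\rangle\,\tau(\mathrm d\boldsymbol\lambda)-\big(\sum_{i=1}^d \mathrm{OT}_{\mu_i}(\langle\mathbf p_i,\cdot\rangle\sharp\tau)\big)+\langle\mathbf q_{\mathrm{in}},\boldsymbol\xi_{\mathrm{in}}\rangle+\langle\mathbf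 q_{\mathrm{eq}},\boldsymbol\xi_{\mathrm{eq}}\rangle$ over $\tau\in\mathcal P_1(\mathcal S_2^* )$, $\boldsymbol\xi_{\mathrm{in}}\in\mathbb R_-^{n_{\mathrm{in}}}$, $\boldsymbol\xi_{\mathrm{eq}}\in\mathbb R^{n_{\mathrm{eq}}}$ subject to $\mathbf c_1+\int_{\mathcal S_2^*}\mathbf Q^{\mathsf T}\boldsymbol\lambda\,\tau(\mathrm d\boldsymbol\lambda)\ge \mathbf L_{\mathrm{in}}^{\mathsf T}\boldsymbol\xi_{\mathrm{in}}+\mathbf L_{\mathrm{eq}}^{\mathsf T}\boldsymbol\xi_{\mathrm{eq}}$. For $\boldsymbol x\in\mathcal S_1$, $f_1,\dots,f_d\in\mathcal C_{\mathrm{cvx}}(\mathbb R)$: $\mathrm{vio}(\boldsymbol x,f_1,\dots,f_d):=\sup_{\boldsymbol\lambda\in\mathcal S_2^*}\{\langle\mathbf Q\boldsymbol x+\mathbf b,\boldsymbol\lambda\rangle+\sum_{i=1}^d f_i(\langle\mathbf p_i,\boldsymbol\lambda\rangle)\}$ (viewed as a maximization problem over $\boldsymbol\lambda\in\mathcal S_2^*$). For $u\in[0,1]$: $G^-_{\mu_i}(u):=\inf\{t\in\Omega_i:\mu_i([\underline\omega_i,t])\ge u\}$. The functions $f^\star_{i,\tau}$. Given a non-empty finite $\mathcal V\subset\mathcal S_2^*$ and a probability measure $\tau$ with $\mathrm{supp}(\tau)\subseteq\mathcal V$, let $\kappa_{i,1}<\dots<\kappa_{i,m_i}$ enumerate $\{\langle\mathbf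 p_i,\boldsymbol\lambda\rangle:\boldsymbol\lambda\in\mathcal V\}$ and let $f^\star_{i,\tau}:\mathbb R\to\mathbb R$ be the continuous piecewise affine function with $f^\star_{i,\tau}(z)=\underline\omega_i(z-\kappa_{i,1})$ for $z\le\kappa_{i,1}$; $f^\star_{i,\tau}(z)=f^\star_{i,\tau}(\kappa_{i,j})+G^-_{\mu_i}\big((\langle\mathbf p_i,\cdot\rangle\sharp\tau)((-\infty,\kappa_{i,j}])\big)(z-\kappa_{i,j})$ for $z\in(\kappa_{i,j},\kappa_{i,j+1}]$, $1\le j\le m_i-1$; $f^\star_{i,\tau}(z)=f^\star_{i,\tau}(\kappa_{i,m_i})+\overline\omega_i(z-\kappa_{i,m_i})$ for $z>\kappa_{i,m_i}$. Linear programs. For a non-empty finite $\mathcal V\subset\mathcal S_2^*$ and $\widehat{\mathcal F}=(\widehat{\mathcal F}_1,\dots,\widehat{\mathcal F}_d)$ with each $\widehat{\mathcal F}_i\subset\mathcal C_{\mathrm{cvx}}(\mathbb R)$ non-empty and finite, LP$(\mathcal V,\widehat{\mathcal F})$ is: maximize $\sum_{\boldsymbol\lambda\in\mathcal V}\langle\mathbf b,\boldsymbol\lambda\rangle\nu_{\boldsymbol\lambda}-\sum_{i=1}^d\psi_i+\langle\mathbf q_{\mathrm{in}},\boldsymbol\xi_{\mathrm{in}}\rangle+\langle\mathbf q_{\mathrm{eq}},\boldsymbol\xi_{\mathrm{eq}}\rangle$ over $\nu_{\boldsymbol\lambda}\in\mathbb R_+$ ($\boldsymbol\lambda\in\mathcal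 V$), $\psi_i\in\mathbb R$, $\boldsymbol\xi_{\mathrm{in}}\in\mathbb R_-^{n_{\mathrm{in}}}$, $\boldsymbol\xi_{\mathrm{eq}}\in\mathbb R^{n_{\mathrm{eq}}}$ subject to $\psi_i\ge-\int_{\Omega_i}\sup_z\{z\omega-f_i(z)\}\mu_i(\mathrm d\omega)-\sum_{\boldsymbol\lambda\in\mathcal V}f_i(\langle\mathbf p_i,\boldsymbol\lambda\rangle)\nu_{\boldsymbol\lambda}$ for all $f_i\in\widehat{\mathcal F}_i$, $1\le i\le d$; $\mathbf c_1+\sum_{\boldsymbol\lambda\in\mathcal V}\mathbf Q^{\mathsf T}\boldsymbol\lambda\,\nu_{\boldsymbol\lambda}\ge\mathbf L_{\mathrm{in}}^{\mathsf T}\boldsymbol\xi_{\mathrm{in}}+\mathbf L_{\mathrm{eq}}^{\mathsf T}\boldsymbol\xi_{\mathrm{eq}}$; $\sum_{\boldsymbol\lambda\in\mathcal V}\nu_{\boldsymbol\lambda}=1$. Its dual LP$^*(\mathcal V,\widehat{\mathcal F})$ is: minimize $\langle\mathbf c_1,\boldsymbol x\rangle-h_0+\sum_{i=1}^d\sum_{f_i\in\widehat{\mathcal F}_i}y_{i,f_i}\int_{\Omega_i}\sup_z\{z\omega-f_i(z)\}\mu_i(\mathrm d\omega)$ over $\boldsymbol x\in\mathbb R_+^{k_1}$, $h_0\in\mathbb R$, $y_{i,f_i}\in\mathbb R_+$ subject to $\langle\mathbf Q\boldsymbol x+\mathbf b,\boldsymbol\lambda\rangle+h_0+\sum_{i=1}^d\sum_{f_i\in\widehat{\mathcal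 F}_i}y_{i,f_i}f_i(\langle\mathbf p_i,\boldsymbol\lambda\rangle)\le0$ for all $\boldsymbol\lambda\in\mathcal V$; $\mathbf L_{\mathrm{in}}\boldsymbol x\le\mathbf q_{\mathrm{in}}$; $\mathbf L_{\mathrm{eq}}\boldsymbol x=\mathbf q_{\mathrm{eq}}$; $\sum_{f_i\in\widehat{\mathcal F}_i}y_{i,f_i}=1$ for all $i$. Algorithm 1 (inputs: finite $\mathcal V\subset\mathcal S_2^*$ and $\varepsilon_{\mathrm{OT}}>0$, and the problem data). (1a) $\hat\tau^{(0)}:=\frac1{|\mathcal V|}\sum_{\boldsymbol\lambda\in\mathcal V}\delta_{\boldsymbol\lambda}$; $\widehat{\mathcal F}_i^{(1)}:=\{f^\star_{i,\hat\tau^{(0)}}\}$ for $i=1,\dots,d$. (1b) For $t=1,2,\dots$: with $\widehat{\mathcal F}^{(t)}=(\widehat{\mathcal F}^{(t)}_1,\dots,\widehat{\mathcal F}^{(t)}_d)$, compute an optimizer $((\hat\nu^{(t)}_{\boldsymbol\lambda}),(\hat\psi^{(t)}_i),\hat{\boldsymbol\xi}^{(t)}_{\mathrm{in}},\hat{\boldsymbol\xi}^{(t)}_{\mathrm{eq}})$ of LP$(\mathcal V,\widehat{\mathcal F}^{(t)})$ and an optimizer $(\hat{\boldsymbol x}^{(t)},\hat h^{(t)}_0,(\hat y^{(t)}_{i,f_i}))$ of LP$^*(\mathcal V,\widehat{\mathcal F}^{(t)})$, with common optimal value $\widehat C^{(t)}_{\mathrm{DRO}}$; set $\hat\tau^{(t)}:=\sum_{\boldsymbol\lambda\in\mathcal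 V}\hat\nu^{(t)}_{\boldsymbol\lambda}\delta_{\boldsymbol\lambda}$; for each $i$ set $\widehat{\mathcal F}^{(t+1)}_i:=\widehat{\mathcal F}^{(t)}_i\cup\{f^\star_{i,\hat\tau^{(t)}}\}$ and $\hat\varepsilon^{(t)}_{\mathrm{OT},i}:=-\int_{\Omega_i}\sup_z\{z\omega-f^\star_{i,\hat\tau^{(t)}}(z)\}\mu_i(\mathrm d\omega)-\int_{\mathbb R}f^\star_{i,\hat\tau^{(t)}}\,\mathrm d(\langle\mathbf p_i,\cdot\rangle\sharp\hat\tau^{(t)})-\hat\psi_i^{(t)}$; stop the loop if $\max_i\hat\varepsilon^{(t)}_{\mathrm{OT},i}\le\varepsilon_{\mathrm{OT}}$. (1c) With $t$ the last iteration, output $\hat\tau:=\hat\tau^{(t)}$, $\hat{\boldsymbol\xi}_{\mathrm{in}}:=\hat{\boldsymbol\xi}^{(t)}_{\mathrm{in}}$, $\hat{\boldsymbol\xi}_{\mathrm{eq}}:=\hat{\boldsymbol\xi}^{(t)}_{\mathrm{eq}}$, $\hat{\boldsymbol x}:=\hat{\boldsymbol x}^{(t)}$, $\hat f_i:=\mathbb 1_{\{i=1\}}\hat h^{(t)}_0+\sum_{f_i\in\widehat{\mathcal F}^{(t)}_i}\hat y^{(t)}_{i,f_i}f_i$, $\widehat C^{\mathrm{LB}}_{\mathrm{DRO}}:=\widehat C^{(t)}_{\mathrm{DRO}}-\sum_{i=1}^d\hat\varepsilon^{(t)}_{\mathrm{OT},i}$. Algorithm 2 (inputs: problem data and $(\varepsilon_{\mathrm{OT}}^{(t)})$,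 $(\varsigma^{(t)})$, $(\vartheta^{(t)})$, $\varepsilon_{\mathrm{tol}}$). (1) Find $\boldsymbol\lambda_0\in\mathcal S_2^*$, $\boldsymbol\xi_{\mathrm{in},0}\in\mathbb R_-^{n_{\mathrm{in}}}$, $\boldsymbol\xi_{\mathrm{eq},0}\in\mathbb R^{n_{\mathrm{eq}}}$ with $\mathbf c_1+\mathbf Q^{\mathsf T}\boldsymbol\lambda_0\ge\mathbf L_{\mathrm{in}}^{\mathsf T}\boldsymbol\xi_{\mathrm{in},0}+\mathbf L_{\mathrm{eq}}^{\mathsf T}\boldsymbol\xi_{\mathrm{eq},0}$; set $\mathcal V^{(1)}:=\{\boldsymbol\lambda_0\}$. (2) For $t=1,2,\dots$: (2a) Run Algorithm 1 with $\mathcal V^{(t)}$, $\varepsilon^{(t)}_{\mathrm{OT}}$; denote its outputs by $\hat\tau^{(t)},\hat{\boldsymbol\xi}_{\mathrm{in}}^{(t)},\hat{\boldsymbol\xi}_{\mathrm{eq}}^{(t)},\hat{\boldsymbol x}^{(t)},\hat f_1^{(t)},\dots,\hat f_d^{(t)},\widehat C^{\mathrm{LB}(t)}_{\mathrm{DRO}}$. (2b) For each $i$, let $\overline f_i^{(t)}\in\mathcal C_{\mathrm{cvx}}(\mathbb R)$ be a continuous piecewise affine function with $\partial\overline f_i^{(t)}(z)\subseteq\Omega_i$ and $0\le\overline f_i^{(t)}(z)-\hat f_i^{(t)}(z)\le\varsigma^{(t)}$ for all $z\in\mathbb R$; set $\hat\beta_i^{(t)}:=\int_{\Omega_i}\sup_z\{z\omega-\overline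 f_i^{(t)}(z)\}\mu_i(\mathrm d\omega)$. (2c) Approximately solve $\mathrm{vio}(\hat{\boldsymbol x}^{(t)},\overline f^{(t)}_1,\dots,\overline f_d^{(t)})$, obtaining $\hat{\boldsymbol\lambda}^{(t)}\in\mathcal S_2^*$ and $\overline\varepsilon^{(t)}_{\mathrm{vio}}\in\mathbb R$ with $\frac{\overline\varepsilon^{(t)}_{\mathrm{vio}}}{1+\vartheta^{(t)}}\le\langle\mathbf Q\hat{\boldsymbol x}^{(t)}+\mathbf b,\hat{\boldsymbol\lambda}^{(t)}\rangle+\sum_{i=1}^d\overline f_i^{(t)}(\langle\mathbf p_i,\hat{\boldsymbol\lambda}^{(t)}\rangle)\le\mathrm{vio}(\hat{\boldsymbol x}^{(t)},\overline f^{(t)}_1,\dots,\overline f_d^{(t)})\le\overline\varepsilon^{(t)}_{\mathrm{vio}}$. (2d) $\mathcal V^{(t+1)}:=\mathcal V^{(t)}\cup\widehat{\mathcal V}^{(t)}$, where $\widehat{\mathcal V}^{(t)}\subset\mathcal S_2^*$ is a finite set (of sub-optimal feasible points of the maximization problem in (2c)) with $\hat{\boldsymbol\lambda}^{(t)}\in\widehat{\mathcal V}^{(t)}$. (2e) $\hat\varepsilon^{(t)}_{\mathrm{sub}}:=\langle\mathbf c_1,\hat{\boldsymbol x}^{(t)}\rangle+\sum_{i=1}^d\hat\beta_i^{(t)}-\widehat C^{\mathrm{LB}(t)}_{\mathrm{DRO}}+\overline\varepsilon^{(t)}_{\mathrm{vio}}$; stop the loop if $\hat\varepsilon^{(t)}_{\mathrm{sub}}\le\varepsilon_{\mathrm{tol}}$.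 (3) With $t$ the last iteration: $\hat\varepsilon_{\mathrm{OT},i}:=\mathrm{OT}_{\mu_i}(\langle\mathbf p_i,\cdot\rangle\sharp\hat\tau^{(t)})+\int_{\Omega_i}\sup_z\{z\omega-\hat f_i^{(t)}(z)\}\mu_i(\mathrm d\omega)+\int_{\mathbb R}\hat f_i^{(t)}\,\mathrm d(\langle\mathbf p_i,\cdot\rangle\sharp\hat\tau^{(t)})$ for each $i$; $\hat\tau:=\hat\tau^{(t)}$, $\hat{\boldsymbol\xi}_{\mathrm{in}}:=\hat{\boldsymbol\xi}_{\mathrm{in}}^{(t)}$, $\hat{\boldsymbol\xi}_{\mathrm{eq}}:=\hat{\boldsymbol\xi}_{\mathrm{eq}}^{(t)}$, $\hat{\boldsymbol x}:=\hat{\boldsymbol x}^{(t)}$, $\tilde f_1:=\overline f_1^{(t)}-\overline\varepsilon^{(t)}_{\mathrm{vio}}$, $\tilde f_i:=\overline f_i^{(t)}$ for $i\ge2$; $\widehat C^{\mathrm{LB}}_{\mathrm{DRO}}:=\widehat C^{\mathrm{LB}(t)}_{\mathrm{DRO}}$, $\widehat C^{\mathrm{UB}}_{\mathrm{DRO}}:=\widehat C^{\mathrm{LB}(t)}_{\mathrm{DRO}}+\hat\varepsilon^{(t)}_{\mathrm{sub}}$, $\hat\varepsilon_{\mathrm{sub}}:=\hat\varepsilon^{(t)}_{\mathrm{sub}}$, $\hat\varepsilon_{\mathrm{prob}}:=\overline\varepsilon^{(t)}_{\mathrm{vio}}+\sum_{i=1}^d\hat\varepsilon_{\mathrm{OT},i}$,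 $\hat\varsigma:=\varsigma^{(t)}$. (4) Let $K:=|\mathcal V^{(t)}|$, enumerate $\mathcal V^{(t)}=\{\boldsymbol\lambda_1,\dots,\boldsymbol\lambda_K\}$, and let $\sigma_i$ be a permutation of $\{1,\dots,K\}$ with $\langle\mathbf p_i,\boldsymbol\lambda_{\sigma_i(1)}\rangle\le\dots\le\langle\mathbf p_i,\boldsymbol\lambda_{\sigma_i(K)}\rangle$. On a probability space let $J\in\{1,\dots,K\}$, $U_1,\dots,U_d\in[0,1]$ be jointly independent random variables with $\mathbb P[J=j]=\hat\tau(\{\boldsymbol\lambda_j\})$ and each $U_i$ uniform on $[0,1]$. Set $Y_i:=G^-_{\mu_i}\big(U_i\hat\tau(\{\boldsymbol\lambda_J\})+\sum_{j=1}^{\sigma_i^{-1}(J)-1}\hat\tau(\{\boldsymbol\lambda_{\sigma_i(j)}\})\big)$, and let $\hat\mu\in\mathcal P(\boldsymbol\Omega)$ be the law of $(Y_1,\dots,Y_d)^{\mathsf T}$. *)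

(* Defs.v *)
From HB Require Import structures.
From mathcomp Require Import all_boot all_order all_algebra finmap.
From mathcomp Require Import all_fingroup.
From mathcomp Require Import all_classical all_reals all_analysis.
Set Implicit Arguments.
Unset Strict Implicit.
Unset Printing Implicit Defensive.
Import Order.TTheory GRing.Theory Num.Theory numFieldNormedType.Exports.
Local Open Scope classical_set_scope.
Local Open Scope ring_scope.

(* R^n as column vectors, with the Borel sigma-algebra of its topology. *)
Notation borel_cV R n := (g_sigma_algebraType (@open 'cV[R]_n)).

Section Vectors.
Context {R : realType} {n : nat}.
Implicit Types (u v x y z : 'cV[R]_n) (X : set 'cV[R]_n).

Definition dot u v : R := \sum_(i < n) u i 0 * v i 0.

Definition vle u v : Prop := forall i, u i 0 <= v i 0.

Definition recc X : set 'cV[R]_n :=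
  [set y | forall x (s : R), X x -> 0 <= s -> X (x + s *: y)].

Definition lineality X : set 'cV[R]_n :=
  recc X `&` [set y | recc X (- y)].

Definition orth X : set 'cV[R]_n := [set x | forall y, X y -> dot x y = 0].

Definition extr X : set 'cV[R]_n :=
  [set x | X x /\ forall y z (t : R), X y -> X z -> 0 < t < 1 ->
                    x = t *: y + (1 - t) *: z -> y = z].

(* A probability measure on a closed set X is represented by a probability
   measure on the whole space that gives X mass one. *)
Definition probs_on X : set (probability (borel_cV R n) R) :=
  [set tau | tau X = 1%E].

Definition probs1_on X : set (probability (borel_cV R n) R) :=
  [set tau | probs_on X tau /\
     (\int[tau]_(x in X) (Num.sqrt (dot x x))%:E < +oo)%E].

(* tau = sum over l in V of nu l times the Dirac measure at l *)
Definition discrete_law (V : {fset 'cV[R]_n}) (nu : 'cV[R]_n -> R)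
    (tau : probability (borel_cV R n) R) : Prop :=
  forall A : set (borel_cV R n), measurable A ->
    tau A = (\sum_(l <- V) (nu l)%:E * \d_(l : borel_cV R n) A)%E.

End Vectors.

Section Functions.
Context {R : realType}.
Implicit Type f : R -> R.

Definition C_cvx : set (R -> R) :=
  [set f | continuous f /\ convex_function (E := R^o) [set: R^o] f].

Definition subdiff f (z : R) : set R :=
  [set g | forall y, f z + g * (y - z) <= f y].

(* f is affine on every closed interval without breakpoint in its interior. *)
Definition piecewise_affine f : Prop :=
  exists s : seq R, forall u v : R, u <= v ->
    (forall k, k \in s -> ~~ (u < k < v)) ->
    exists a c : R, forall z, u <= z <= v -> f z = a * z + c.

Definition conjugate f (w : R) : \bar R :=
  ereal_sup [set (z * w - f z)%:E | z in [set: R]].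

(* The graph to the right of k of the continuous function with value v at k,
   slope G k_j on ]k_j, k_(j+1)] for consecutive elements of k :: ks, and
   slope hi to the right of the last one. *)
Fixpoint pwa_right (G : R -> R) (hi v k : R) (ks : seq R) (z : R) : R :=
  match ks with
  | [::] => v + hi * (z - k)
  | k' :: ks' => if z <= k' then v + G k * (z - k)
                 else pwa_right G hi (v + G k * (k' - k)) k' ks' z
  end.

End Functions.

(* When eps < +oo, the bound forces the objective value at z and the optimal
   value to be finite, since +oo - +oo and -oo - -oo are -oo in \bar R. *)
Definition eps_minimizer (R : realType) (T : Type) (feas : set T)
    (obj : T -> \bar R) (eps : \bar R) (z : T) : Prop :=
  feas z /\ (`|obj z - ereal_inf [set obj y | y in feas]| <= eps)%E.

Definition eps_maximizer (R : realType) (T : Type) (feas : set T)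
    (obj : T -> \bar R) (eps : \bar R) (z : T) : Prop :=
  feas z /\ (`|obj z - ereal_sup [set obj y | y in feas]| <= eps)%E.

Record problem (R : realType) := Problem {
  ndim : nat;
  lo : 'I_ndim -> R;
  hi : 'I_ndim -> R;
  marg : 'I_ndim -> probability (measurableTypeR R) R;
  k1 : nat; n_in : nat; n_eq : nat;
  c1 : 'cV[R]_k1;
  L_in : 'M[R]_(n_in, k1); q_in : 'cV[R]_n_in;
  L_eq : 'M[R]_(n_eq, k1); q_eq : 'cV[R]_n_eq;
  m_in : nat; m_eq : nat;
  matQ : 'M[R]_(m_in + m_eq, k1);
  matP : 'M[R]_(m_in + m_eq, ndim);
  vecb : 'cV[R]_(m_in + m_eq);
  k2 : nat;
  A_in : 'M[R]_(m_in, k2);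
  A_eq : 'M[R]_(m_eq, k2);
  c2 : 'cV[R]_k2
}.

Section Problem.
Context {R : realType} (D : problem R).
Local Notation d := (ndim D).
Local Notation k2s := (m_in D + m_eq D)%N.
Local Notation vecl := 'cV[R]_k2s.
Local Notation law := (probability (borel_cV R k2s) R).
Local Notation law_omega := (probability (borel_cV R d) R).
Local Notation Rm := (measurableTypeR R).
Implicit Types (V : {fset vecl}) (tau : law) (l : vecl) (x : 'cV[R]_(k1 D)).
Implicit Types (f : R -> R) (i : 'I_d) (fs : 'I_d -> R -> R).
Implicit Types (xin : 'cV[R]_(n_in D)) (xeq : 'cV[R]_(n_eq D)).

Definition Omega1 i : set R := `[lo i, hi i]%classic.

Definition Omega : set 'cV[R]_d := [set w | forall i, Omega1 i (w i 0)].

Definition vecp i : vecl := col i (matP D).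

Definition S1 : set 'cV[R]_(k1 D) :=
  [set x | [/\ vle 0 x, vle (L_in D *m x) (q_in D) & L_eq D *m x = q_eq D]].

Definition S2 : set vecl :=
  [set l | vle (usubmx l) 0 /\
     vle ((A_in D)^T *m usubmx l + (A_eq D)^T *m dsubmx l) (c2 D)].

Definition C2 x (w : 'cV[R]_d) : \bar R :=
  ereal_sup [set (dot (matQ D *m x + matP D *m w + vecb D) l)%:E | l in S2].

Definition standing_assumptions : Prop :=
  [/\ [/\ (2 <= d)%N, (1 <= k1 D)%N, (1 <= k2s)%N & (1 <= k2 D)%N],
      (forall i, lo i <= hi i),
      (forall i, marg i (Omega1 i) = 1%E),
      S1 !=set0 /\ S2 !=set0 &
      (ereal_sup [set C2 xw.1 xw.2 | xw in S1 `*` Omega] < +oo)%E].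

Definition V_extr : set vecl := extr (S2 `&` orth (lineality S2)).

Definition Gamma : set law_omega :=
  [set mu | probs_on Omega mu /\
     forall i (B : set Rm), measurable B ->
       mu [set w : 'cV[R]_d | B (w i 0)] = marg i B].

Definition inner_obj x (mu : law_omega) : \bar R :=
  (\int[mu]_(w in Omega) C2 x w)%E.

Definition DRO_obj x : \bar R :=
  ((dot (c1 D) x)%:E + ereal_sup [set inner_obj x mu | mu in Gamma])%E.

Definition C_DRO : \bar R := ereal_inf [set DRO_obj x | x in S1].

Definition couplings (mu nu : set Rm -> \bar R) :
    set (probability (Rm * Rm)%type R) :=
  [set g | forall B : set Rm, measurable B ->
     g (fst @^-1` B) = mu B /\ g (snd @^-1` B) = nu B].

Definition OT i (nu : set Rm -> \bar R) : \bar R :=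
  ereal_inf [set (\int[g]_(wz in Omega1 i `*` [set: R])
                    (- ((wz.2 : R) * (wz.1 : R)))%:E)%E
            | g in couplings (marg i) nu].

Definition push tau i : set Rm -> \bar R :=
  pushforward tau (dot (vecp i) : borel_cV R k2s -> Rm).

Definition conj_int i f : \bar R :=
  (\int[marg i]_(w in Omega1 i) conjugate f w)%E.

Definition push_int tau i f : \bar R := (\int[push tau i]_z (f z)%:E)%E.

Definition slack x fs l : R :=
  dot (matQ D *m x + vecb D) l + \sum_(i < d) fs i (dot (vecp i) l).

Definition primal_feas : set ('cV[R]_(k1 D) * ('I_d -> R -> R)) :=
  [set p | [/\ S1 p.1, (forall i, C_cvx (p.2 i)) &
               forall l, S2 l -> slack p.1 p.2 l <= 0]].

Definition primal_obj (p : 'cV[R]_(k1 D) * ('I_d -> R -> R)) : \bar R :=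
  ((dot (c1 D) p.1)%:E + \sum_(i < d) conj_int i (p.2 i))%E.

Definition dual_feas : set (law * 'cV[R]_(n_in D) * 'cV[R]_(n_eq D)) :=
  [set p | let: (tau, xin, xeq) := p in
     [/\ probs1_on S2 tau, vle xin 0 &
         forall j : 'I_(k1 D),
           ((((L_in D)^T *m xin + (L_eq D)^T *m xeq) j 0)%:E <=
            (c1 D j 0)%:E + \int[tau]_(l in S2) (((matQ D)^T *m l) j 0)%:E)%E]].

Definition dual_obj (p : law * 'cV[R]_(n_in D) * 'cV[R]_(n_eq D)) : \bar R :=
  let: (tau, xin, xeq) := p in
  (\int[tau]_(l in S2) (dot (vecb D) l)%:E - \sum_(i < d) OT i (push tau i)
   + (dot (q_in D) xin)%:E + (dot (q_eq D) xeq)%:E)%E.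

Definition vio x fs : \bar R := ereal_sup [set (slack x fs l)%:E | l in S2].

Definition qtl i (u : R) : R :=
  inf [set t : R | Omega1 i t /\ (u%:E <= marg i `[lo i, t]%classic)%E].

Definition kappas V i : seq R :=
  sort <=%R (undup [seq dot (vecp i) l | l <- V]).

Definition fstar V tau i : R -> R := fun z =>
  match kappas V i with
  | [::] => 0
  | k :: ks =>
    if z <= k then lo i * (z - k)
    else pwa_right (fun t => qtl i (fine (push tau i `]-oo, t]%classic)))
                   (hi i) 0 k ks z
  end.

Record lp_point := LPPoint {
  lp_nu : vecl -> R;
  lp_psi : 'I_d -> R;
  lp_xin : 'cV[R]_(n_in D);
  lp_xeq : 'cV[R]_(n_eq D)
}.

Definition lp_feas V (F : 'I_d -> {fset (R -> R)}) : set lp_point :=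
  [set p | [/\ (forall l, l \in V -> 0 <= lp_nu p l),
     vle (lp_xin p) 0,
     (forall i f, f \in F i ->
        (- conj_int i f - (\sum_(l <- V) f (dot (vecp i) l) * lp_nu p l)%:E
           <= (lp_psi p i)%:E)%E),
     vle ((L_in D)^T *m lp_xin p + (L_eq D)^T *m lp_xeq p)
         (c1 D + \sum_(l <- V) lp_nu p l *: ((matQ D)^T *m l)) &
     \sum_(l <- V) lp_nu p l = 1]].

Definition lp_obj V (p : lp_point) : R :=
  \sum_(l <- V) dot (vecb D) l * lp_nu p l - \sum_(i < d) lp_psi p i
  + dot (q_in D) (lp_xin p) + dot (q_eq D) (lp_xeq p).

Definition lp_optimizer V F (p : lp_point) : Prop :=
  lp_feas V F p /\ forall p', lp_feas V F p' -> lp_obj V p' <= lp_obj V p.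

Record lpd_point := LPDPoint {
  lpd_x : 'cV[R]_(k1 D);
  lpd_h0 : R;
  lpd_y : 'I_d -> (R -> R) -> R
}.

Definition lpd_feas V (F : 'I_d -> {fset (R -> R)}) : set lpd_point :=
  [set p | [/\ S1 (lpd_x p),
     (forall i f, f \in F i -> 0 <= lpd_y p i f),
     (forall l, l \in V ->
        dot (matQ D *m lpd_x p + vecb D) l + lpd_h0 p
        + \sum_(i < d) \sum_(f <- F i) lpd_y p i f * f (dot (vecp i) l) <= 0) &
     (forall i, \sum_(f <- F i) lpd_y p i f = 1)]].

Definition lpd_obj (F : 'I_d -> {fset (R -> R)}) (p : lpd_point) : \bar R :=
  ((dot (c1 D) (lpd_x p))%:E - (lpd_h0 p)%:E
   + \sum_(i < d) \sum_(f <- F i) (lpd_y p i f)%:E * conj_int i f)%E.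

Definition lpd_optimizer V F (p : lpd_point) : Prop :=
  lpd_feas V F p /\ forall p', lpd_feas V F p' -> (lpd_obj F p <= lpd_obj F p')%E.

(* The inner algorithm (V fixed, cutting planes added to F). Iterations are
   counted from 1: a run is a sequence r whose values at t >= 1 matter. *)
Record iter1 := Iter1 {
  i1_F : 'I_d -> {fset (R -> R)};
  i1_lp : lp_point;
  i1_lpd : lpd_point;
  i1_tau : law
}.

Definition init1 V (F : 'I_d -> {fset (R -> R)}) : Prop :=
  exists tau0, discrete_law V (fun=> (#|` V|)%:R^-1) tau0 /\
    forall i, F i = [fset fstar V tau0 i]%fset.

Definition body1 V (it : iter1) : Prop :=
  [/\ lp_optimizer V (i1_F it) (i1_lp it),
      lpd_optimizer V (i1_F it) (i1_lpd it) &
      discrete_law V (lp_nu (i1_lp it)) (i1_tau it)].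

Definition eps1 V (it : iter1) i : \bar R :=
  (- conj_int i (fstar V (i1_tau it) i)
   - push_int (i1_tau it) i (fstar V (i1_tau it) i)
   - (lp_psi (i1_lp it) i)%:E)%E.

Definition stop1 V (eOT : R) (it : iter1) : Prop :=
  (\big[Order.max/-oo]_(i < d) eps1 V it i <= eOT%:E)%E.

(* Iterations 1, ..., t-1 have been carried out without stopping, and r t
   holds the family of functions with which iteration t starts. *)
Definition reaches1 V (eOT : R) (r : nat -> iter1) (t : nat) : Prop :=
  init1 V (i1_F (r 1%N)) /\
  forall u, (0 < u < t)%N ->
    [/\ body1 V (r u), ~ stop1 V eOT (r u) &
        forall i,
          i1_F (r u.+1) i =
            (i1_F (r u) i `|` [fset fstar V (i1_tau (r u)) i])%fset].

Record out1 := Out1 {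
  o_tau : law;
  o_xin : 'cV[R]_(n_in D);
  o_xeq : 'cV[R]_(n_eq D);
  o_x : 'cV[R]_(k1 D);
  o_f : 'I_d -> R -> R;
  o_LB : \bar R
}.

Definition result1 V (it : iter1) : out1 := {|
  o_tau := i1_tau it;
  o_xin := lp_xin (i1_lp it);
  o_xeq := lp_xeq (i1_lp it);
  o_x := lpd_x (i1_lpd it);
  o_f := fun i z => (if i == 0%N :> nat then lpd_h0 (i1_lpd it) else 0)
                    + \sum_(f <- i1_F it i) lpd_y (i1_lpd it) i f * f z;
  o_LB := ((lp_obj V (i1_lp it))%:E - \sum_(i < d) eps1 V it i)%E
|}.

Definition output1 V (eOT : R) (o : out1) : Prop :=
  exists (r : nat -> iter1) (t : nat),
    [/\ (0 < t)%N, reaches1 V eOT r t, body1 V (r t), stop1 V eOT (r t) &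
        o = result1 V (r t)].

(* The loop can be entered, no run gets stuck, and no run is infinite. *)
Definition terminates1 V (eOT : R) : Prop :=
  [/\ (exists F, init1 V F),
      (forall r t, (0 < t)%N -> reaches1 V eOT r t ->
         exists it, i1_F it = i1_F (r t) /\ body1 V it) &
      forall r, ~ (forall t, reaches1 V eOT r t)].

(* The outer algorithm (points added to V), with the same conventions. *)
Record inputs2 := Inputs2 {
  eOT : nat -> R;
  vs : nat -> R;
  vt : nat -> R;
  etol : R
}.

Definition admissible (inp : inputs2) : Prop :=
  (forall t, (0 < t)%N -> [/\ 0 < eOT inp t, 0 <= vs inp t & 0 <= vt inp t]) /\
  (limn_einf (fun t => (d%:R * (eOT inp t + (1 + vt inp t) * vs inp t))%:E)
     < (etol inp)%:E)%E.

Record iter2 := Iter2 {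
  i2_V : {fset vecl};
  i2_out : out1;
  i2_fbar : 'I_d -> R -> R;
  i2_lam : vecl;
  i2_evio : R;
  i2_Vhat : {fset vecl}
}.

Definition init2 V : Prop :=
  exists l0 xin xeq,
    [/\ S2 l0, vle xin 0,
        vle ((L_in D)^T *m xin + (L_eq D)^T *m xeq) (c1 D + (matQ D)^T *m l0) &
        V = [fset l0]%fset].

Definition step2b (vs : R) (o : out1) (fbar : 'I_d -> R -> R) : Prop :=
  forall i, [/\ C_cvx (fbar i), piecewise_affine (fbar i),
    (forall z, subdiff (fbar i) z `<=` Omega1 i) &
    forall z, 0 <= fbar i z - o_f o i z <= vs].

Definition step2c (vt : R) (o : out1) (fbar : 'I_d -> R -> R) l (evio : R) : Prop :=
  [/\ S2 l, evio / (1 + vt) <= slack (o_x o) fbar l,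
      ((slack (o_x o) fbar l)%:E <= vio (o_x o) fbar)%E &
      (vio (o_x o) fbar <= evio%:E)%E].

Definition step2d l (Vhat : {fset vecl}) : Prop :=
  (forall l', l' \in Vhat -> S2 l') /\ l \in Vhat.

Definition body2 (inp : inputs2) (t : nat) (it : iter2) : Prop :=
  [/\ output1 (i2_V it) (eOT inp t) (i2_out it),
      step2b (vs inp t) (i2_out it) (i2_fbar it),
      step2c (vt inp t) (i2_out it) (i2_fbar it) (i2_lam it) (i2_evio it) &
      step2d (i2_lam it) (i2_Vhat it)].

Definition LB (it : iter2) : \bar R := o_LB (i2_out it).

Definition eps_sub (it : iter2) : \bar R :=
  ((dot (c1 D) (o_x (i2_out it)))%:E + \sum_(i < d) conj_int i (i2_fbar it i)
   - LB it + (i2_evio it)%:E)%E.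

Definition UB (it : iter2) : \bar R := (LB it + eps_sub it)%E.

Definition eps_OT (it : iter2) i : \bar R :=
  (OT i (push (o_tau (i2_out it)) i) + conj_int i (o_f (i2_out it) i)
   + push_int (o_tau (i2_out it)) i (o_f (i2_out it) i))%E.

Definition eps_prob (it : iter2) : \bar R :=
  ((i2_evio it)%:E + \sum_(i < d) eps_OT it i)%E.

Definition ftilde (it : iter2) : 'I_d -> R -> R := fun i z =>
  if i == 0%N :> nat then i2_fbar it i z - i2_evio it else i2_fbar it i z.

Definition stop2 (inp : inputs2) (it : iter2) : Prop :=
  (eps_sub it <= (etol inp)%:E)%E.

Definition reaches2 (inp : inputs2) (s : nat -> iter2) (t : nat) : Prop :=
  init2 (i2_V (s 1%N)) /\
  forall u, (0 < u < t)%N ->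
    [/\ body2 inp u (s u), ~ stop2 inp (s u) &
        i2_V (s u.+1) = (i2_V (s u) `|` i2_Vhat (s u))%fset].

Definition ended2 (inp : inputs2) (s : nat -> iter2) (t : nat) : Prop :=
  [/\ (0 < t)%N, reaches2 inp s t, body2 inp t (s t) & stop2 inp (s t)].

(* The points computed in iterations 1, ..., t-1 belong to V_extr. *)
Definition lam_extr_before (s : nat -> iter2) (t : nat) : Prop :=
  forall u, (0 < u < t)%N -> V_extr (i2_lam (s u)).

(* No run of the algorithm, including its calls to the inner one, gets stuck or
   goes on forever, when all points i2_lam are taken in V_extr. *)
Definition terminates2 (inp : inputs2) : Prop :=
  [/\ (exists V, init2 V),
      (forall s t, (0 < t)%N -> reaches2 inp s t -> lam_extr_before s t ->
        [/\ terminates1 (i2_V (s t)) (eOT inp t),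
            (forall o, output1 (i2_V (s t)) (eOT inp t) o ->
               exists fbar, step2b (vs inp t) o fbar) &
            forall o fbar, output1 (i2_V (s t)) (eOT inp t) o ->
               step2b (vs inp t) o fbar ->
               exists l evio, V_extr l /\ step2c (vt inp t) o fbar l evio]) &
      forall s, ~ (forall t, reaches2 inp s t /\ lam_extr_before s t)].

(* muhat is the law of Y for some enumeration lam of V, some sorting
   permutations sigma and some random variables J, U; indices start at 0. *)
Definition reconstruction V tau (muhat : law_omega) : Prop :=
  let K := #|` V| in
  exists (dT : measure_display) (T : measurableType dT) (Pr : probability T R)
         (lam : 'I_K -> vecl) (sigma : 'I_d -> {perm 'I_K})
         (J : T -> 'I_K) (U : 'I_d -> T -> R),
  let w (j : 'I_K) : R := fine (tau [set lam j]) in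
  let Y (s : T) : 'cV[R]_d :=
    \col_i qtl i (U i s * w (J s)
      + \sum_(j < K | (j < ((sigma i)^-1)%g (J s))%N) w (sigma i j)) in
  [/\ injective lam /\ (forall l, l \in V <-> exists j, lam j = l),
      (forall i (j j' : 'I_K), (j <= j')%N ->
         dot (vecp i) (lam (sigma i j)) <= dot (vecp i) (lam (sigma i j'))),
      [/\ (forall j, measurable (J @^-1` [set j])),
          (forall i, measurable_fun [set: T] (U i : T -> Rm)) &
          forall (A : set 'I_K) (B : 'I_d -> set Rm),
            (forall i, measurable (B i)) ->
            Pr (J @^-1` A `&` [set s | forall i, B i (U i s)]) =
            (Pr (J @^-1` A) * \prod_(i < d) Pr (U i @^-1` B i))%E],
      (forall j, Pr (J @^-1` [set j]) = (w j)%:E) /\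
      (forall i s, 0 <= U i s <= 1) /\
      (forall i (B : set Rm), measurable B ->
         Pr (U i @^-1` B) = uniform_prob (@ltr01 R) B) &
      forall A : set (borel_cV R d), measurable A -> muhat A = Pr (Y @^-1` A)].

End Problem.

Arguments inputs2 : clear implicits.
Arguments S1 {R} D.
Arguments V_extr {R} D.
Arguments Gamma {R} D.
Arguments primal_feas {R} D.
Arguments dual_feas {R} D.
Arguments DRO_obj {R} D.
Arguments primal_obj {R} D.
Arguments dual_obj {R} D.

(* Main.v *)
From HB Require Import structures.
From mathcomp Require Import all_fingroup.
Require Import Defs.
From mathcomp Require Import all_boot all_order all_algebra finmap.
From mathcomp Require Import all_classical all_reals all_analysis.
From mathcomp Require Import measurable_realfun lra ring.
Set Implicit Arguments.
Unset Strict Implicit.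
Unset Printing Implicit Defensive.
Import Order.TTheory GRing.Theory Num.Theory numFieldNormedType.Exports.
Local Open Scope classical_set_scope.
Local Open Scope ring_scope.

(** The optimal value is squeezed between the values of a dual point with finite
    support and of a primal point, and all error bounds are differences of such
    values.

    Lower bounds. Let [tau] have finitely many atoms. For every coordinate, sort
    the atoms along [p_i], spread the drawn atom uniformly over the interval of
    the unit interval that its weight occupies, and apply the quantile function
    of [mu_i]. The resulting variable has law [mu_i] ([level_cdf], [qtl_law]) and
    is a subgradient of [fstar] at the value of [p_i] at the drawn atom
    ([fstar_subgradient]). Hence it attains the Kantorovich bound, so that [fstar]
    is an optimal transport potential ([OT_discrete]). The law of the vector of
    these variables is a feasible scenario, and its second-stage cost is at least
    the cost of the drawn atom ([coupling_inner_obj]). Every discrete dual point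
    therefore bounds the robust problem from below ([dual_le_DRO]), and the
    reconstructed measure is nearly optimal ([muhat_optimal]).

    Upper bounds. The constraint of the primal problem bounds the second-stage cost
    by a sum of conjugates ([DRO_le_primal]), and integrated against [tau] it gives
    weak duality with the dual problem ([weak_duality]).

    The inner algorithm. Both linear programs are feasible, hence have equal
    values, by Farkas' lemma, which comes from Fourier-Motzkin elimination
    ([farkas], [lp_duality], [lp_strong]). Complementary slackness makes the
    returned mixture of functions satisfy the primal constraint at the points of
    [V], with equality where [tau] has mass ([lp_complementary]). The function
    found in iteration [s] is a cut in iteration [t > s], which bounds the error in
    iteration [t] by the integral of a bounded function against the difference of
    the two measures ([eps1_gap]). As two measures of an infinite run would be
    arbitrarily close, there is no infinite run ([no_infinite_run1]).

    The outer algorithm. The violation of the constraint is convex, and it does not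
    increase along recession directions, since the slopes of the functions are
    values of a scenario and the second-stage cost is finite ([slack_recc]). It is
    therefore maximal at one of the finitely many extreme points
    ([extreme_dominates], [vio_attained]). Subtracting the violation from the first
    function gives a feasible primal point, whose value exceeds the lower bound by
    [eps_sub] ([C_DRO_between]). At a point of [V] the majorants violate the
    constraint by at most [d] times their distance from the mixtures, so an
    iteration that finds no new point ends the loop as soon as the tolerances are
    small ([eps_sub_stale]). Hence there are at most as many unstopped
    small-tolerance iterations as extreme points ([count_small_cost]). The algorithm can
    start because otherwise Farkas' lemma would give a direction along which the
    robust objective tends to minus infinity ([init2_exists]). *)

(** * Linear inequalities and linear programming duality *)

Section LinearProgramming.
Context {R : realFieldType}.

Lemma exists_between (I : finType) (P Q : pred I) (u l : I -> R) :
  (forall p q, P p -> Q q -> l q <= u p) ->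
  exists t, (forall p, P p -> t <= u p) /\ (forall q, Q q -> l q <= t).
Proof.
move=> lu; have [q0 Qq0|noQ] := pickP Q.
  case: (Order.TotalTheory.arg_maxP l Qq0) => q Qq qmax.
  exists (l q); split=> [p Pp|q' Qq']; [exact: lu | exact: qmax].
have [p0 Pp0|noP] := pickP P.
  case: (Order.TotalTheory.arg_minP u Pp0) => p Pp pmin.
  by exists (u p); split=> [p' Pp'|q']; [exact: pmin | rewrite noQ].
by exists 0; split=> [p|q]; rewrite ?noP ?noQ.
Qed.

(** Fourier-Motzkin elimination along the variables listed in [s]. The convex
    cone [K] stands for the inequalities derivable from the system, so that the
    induction does not have to compose multipliers. *)
Lemma fourier_motzkin (J : finType) (s : seq J) (I : finType)
    (K : (J -> R) -> R -> Prop) (a : I -> J -> R) (b : I -> R) :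
  (forall a b a' b', K a b -> K a' b' ->
     K (fun j => a j + a' j) (b + b')) ->
  (forall (r : R) a b, 0 <= r -> K a b -> K (fun j => r * a j) (r * b)) ->
  uniq s -> (forall i, K (a i) (b i)) ->
  (exists x : J -> R, forall i, \sum_(j <- s) a i j * x j <= b i) \/
  (exists a' b', [/\ K a' b', (forall j, j \in s -> a' j = 0) & b' < 0]).
Proof.
move=> Kadd Kscale.
elim: s I K Kadd Kscale a b => [|k s IH] I K Kadd Kscale a b /=.
  move=> _ Kab; have [i bi|bp] := pickP (fun i => b i < 0).
    by right; exists (a i), (b i).
  left; exists (fun=> 0) => i; rewrite big_nil.
  by have /negbT := bp i; rewrite -leNgt.
case/andP=> ks us Kab.
pose cp (p q : I) := (0 < a p k) && (a q k < 0).
pose a' (v : I + I * I) j := match v with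
  | inl i => (a i k == 0)%:R * a i j
  | inr pq => (if cp pq.1 pq.2 then - a pq.2 k else 0) * a pq.1 j
              + (if cp pq.1 pq.2 then a pq.1 k else 0) * a pq.2 j end.
pose b' (v : I + I * I) := match v with
  | inl i => (a i k == 0)%:R * b i
  | inr pq => (if cp pq.1 pq.2 then - a pq.2 k else 0) * b pq.1
              + (if cp pq.1 pq.2 then a pq.1 k else 0) * b pq.2 end.
have Kab' v : K (a' v) (b' v) /\ a' v k = 0.
  case: v => [i|[p q]] /=.
    by split; [apply: Kscale => //; case: eqP | case: eqP => [->|_]; rewrite ?mulr0 ?mul0r].
  split; last by case: ifP => _; ring.
  by apply: Kadd; apply: Kscale => //; rewrite /cp; case: ifP => // /andP[]; lra.
have [||[x xs]|[a0 [b0 [[Kab0 a0k] a00 b00]]]] :=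
  IH _ (fun a b => K a b /\ a k = 0) _ _ a' b' us Kab'.
- move=> a1 b1 a2 b2 [K1 z1] [K2 z2]; split; first exact: Kadd.
  by rewrite z1 z2 addr0.
- by move=> r a1 b1 r0 [K1 z1]; split; [exact: Kscale | rewrite z1 mulr0].
- pose S i := \sum_(j <- s) a i j * x j.
  have [p q pk qk|t [tu tl]] := @exists_between _ (fun p => 0 < a p k)
      (fun q => a q k < 0) (fun i => (b i - S i) / a i k)
      (fun i => (b i - S i) / a i k).
    have := xs (inr (p, q)); rewrite /= /cp pk qk /=.
    under eq_bigr do rewrite mulrDl -!mulrA.
    rewrite big_split /= -!mulr_sumr -/(S p) -/(S q) => h.
    by rewrite ler_pdivlMr // mulrAC ler_ndivrMr //; lra.
  left; exists (fun j => if j == k then t else x j) => i.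
  rewrite big_cons eqxx.
  under eq_big_seq => j js.
    have /negPf -> : j != k by apply: contraNneq ks => <-.
    over.
  rewrite -/(S i); case: (ltrgtP (a i k) 0) => aik.
  - by have := tl i aik; rewrite ler_ndivrMr // lerBrDr mulrC.
  - by have := tu i aik; rewrite ler_pdivlMr // lerBrDr mulrC.
  - have := xs (inl i); rewrite /= aik eqxx.
    by under eq_bigr do rewrite mul1r; rewrite -/(S i) mul1r mul0r add0r.
- right; exists a0, b0; split=> // j; rewrite in_cons => /predU1P[->//|].
  exact: a00.
Qed.

(** The cone of [fourier_motzkin] is instantiated with the nonnegative
    combinations of the rows. *)
Lemma farkas (I J : finType) (a : I -> J -> R) (b : I -> R) :
  (exists x : J -> R, forall i, \sum_j a i j * x j <= b i) \/
  (exists y : I -> R, [/\ forall i, 0 <= y i,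
     forall j, \sum_i y i * a i j = 0 & \sum_i y i * b i < 0]).
Proof.
pose K (a' : J -> R) b' := exists y : I -> R, [/\ forall i, 0 <= y i,
  forall j, \sum_i y i * a i j = a' j & \sum_i y i * b i = b'].
case: (@fourier_motzkin J (index_enum J) I K a b).
- move=> a1 b1 a2 b2 [y1 [p1 e1 f1]] [y2 [p2 e2 f2]].
  exists (fun i => y1 i + y2 i); split=> [i|j|]; first exact: addr_ge0.
    by under eq_bigr do rewrite mulrDl; rewrite big_split /= e1 e2.
  by under eq_bigr do rewrite mulrDl; rewrite big_split /= f1 f2.
- move=> r a1 b1 r0 [y1 [p1 e1 f1]].
  exists (fun i => r * y1 i); split=> [i|j|]; first exact: mulr_ge0.
    by under eq_bigr do rewrite -mulrA; rewrite -mulr_sumr e1.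
  by under eq_bigr do rewrite -mulrA; rewrite -mulr_sumr f1.
- exact: index_enum_uniq.
- move=> i; exists (fun i' => (i' == i)%:R); split=> [i'|j|]; first by case: eqP.
    rewrite (bigD1 i) //= eqxx mul1r big1 ?addr0 // => i' /negPf ->.
    by rewrite mul0r.
  rewrite (bigD1 i) //= eqxx mul1r big1 ?addr0 // => i' /negPf ->.
  by rewrite mul0r.
- by left.
- move=> [a' [b' [[y [p e f]] z bn]]]; right; exists y.
  by split=> // [j|]; [rewrite e z ?mem_index_enum | rewrite f].
Qed.

(** Infeasibility of the system 'primal feasible, dual feasible, primal value
    at least dual value' would give, through [farkas], an improving pair of
    directions, which the two feasible points rule out. *)
Lemma lp_duality_le (I J : finType) (a : I -> J -> R) (b : I -> R) (c : J -> R)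
    (x0 : J -> R) (y0 : I -> R) :
  (forall i, \sum_j a i j * x0 j <= b i) ->
  (forall i, 0 <= y0 i) -> (forall j, \sum_i y0 i * a i j = c j) ->
  exists x y, [/\ forall i, \sum_j a i j * x j <= b i,
    forall i, 0 <= y i, forall j, \sum_i y i * a i j = c j &
    \sum_i y i * b i = \sum_j c j * x j].
Proof.
move=> fx0 y00 fy0.
pose a' (v : I + (J + (J + (I + unit)))) (w : J + I) : R := match v, w with
  | inl i, inl j => a i j | inl i, inr _ => 0
  | inr (inl j), inl _ => 0 | inr (inl j), inr i => a i j
  | inr (inr (inl j)), inl _ => 0 | inr (inr (inl j)), inr i => - a i j
  | inr (inr (inr (inl i))), inl _ => 0
  | inr (inr (inr (inl i))), inr i' => - (i == i')%:R
  | inr (inr (inr (inr _))), inl j => - c j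
  | inr (inr (inr (inr _))), inr i => b i end.
pose b' (v : I + (J + (J + (I + unit)))) : R := match v with
  | inl i => b i | inr (inl j) => c j | inr (inr (inl j)) => - c j
  | inr (inr (inr _)) => 0 end.
have weak x y : (forall i, \sum_j a i j * x j <= b i) -> (forall i, 0 <= y i) ->
    (forall j, \sum_i y i * a i j = c j) -> \sum_j c j * x j <= \sum_i y i * b i.
  move=> fx y_ge0 fy; under eq_bigr do rewrite -fy mulr_suml.
  rewrite exchange_big /=; apply: ler_sum => i _.
  under eq_bigr do rewrite -mulrA; rewrite -mulr_sumr.
  exact: ler_wpM2l.
have [[z fz]|[u [u0 e f]]] := farkas a' b'.
  exists (fun j => z (inl j)), (fun i => z (inr i)).
  have fx i : \sum_j a i j * z (inl j) <= b i.
    have := fz (inl i); rewrite big_sumType /= [X in _ + X]big1 ?addr0 // => k _.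
    by rewrite mul0r.
  have y_ge0 i : 0 <= z (inr i).
    have := fz (inr (inr (inr (inl i)))); rewrite big_sumType /= big1; last first.
      by move=> k _; rewrite mul0r.
    rewrite add0r (bigD1 i) //= eqxx big1; first by rewrite addr0 mulN1r oppr_le0.
    by move=> k; rewrite eq_sym => /negPf ->; rewrite oppr0 mul0r.
  have fy j : \sum_i z (inr i) * a i j = c j.
    have := fz (inr (inl j)); have := fz (inr (inr (inl j))).
    have z0 : \sum_(k : J) 0 * z (inl k) = 0.
      by rewrite big1 // => k _; rewrite mul0r.
    rewrite !big_sumType /= !z0 !add0r; under eq_bigr do rewrite mulNr mulrC; rewrite sumrN.
    under [in X in _ -> X -> _]eq_bigr do rewrite mulrC.
    by move=> ? ?; lra.
  split=> //; apply/eqP; rewrite eq_le (weak (fun j => z (inl j))) // andbT.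
  have := fz (inr (inr (inr (inr tt)))); rewrite big_sumType /=.
  under eq_bigr do rewrite mulNr; rewrite sumrN.
  under [in X in _ + X <= _]eq_bigr do rewrite mulrC.
  by move=> ?; lra.
exfalso.
pose U i := u (inl i); pose r := u (inr (inr (inr (inr tt)))).
pose v j := u (inr (inr (inl j))) - u (inr (inl j)).
have r0 : 0 <= r by exact: u0.
have U0 i : 0 <= U i by exact: u0.
have eU j : \sum_i U i * a i j = r * c j.
  have := e (inl j); rewrite !big_sumType /=.
  do 3 (rewrite [X in _ + (X + _)]big1 ?add0r; last by move=> k _; rewrite mulr0).
  rewrite (bigD1 tt) //= [X in _ + (_ + X)]big1; last by case.
  by rewrite -/r -/(U _); under eq_bigr do rewrite -/(U _); move=> ?; lra.
have eV i : \sum_j a i j * v j <= r * b i.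
  have := e (inr i); rewrite !big_sumType /=.
  have -> : \sum_k u (inl k) * 0 = 0 by rewrite big1 // => k _; rewrite mulr0.
  rewrite add0r.
  have -> : \sum_k u (inr (inr (inr (inl k)))) * - (k == i)%:R =
      - u (inr (inr (inr (inl i)))).
    rewrite (bigD1 i) //= eqxx mulrN1 big1 ?addr0 // => k /negPf ->.
    by rewrite oppr0 mulr0.
  rewrite (bigD1 tt) //= [X in _ + (_ + (_ + (_ + X)))]big1; last by case.
  rewrite -/r.
  have w0 := u0 (inr (inr (inr (inl i)))).
  have -> : \sum_j a i j * v j = - \sum_j u (inr (inl j)) * a i j
      - \sum_j u (inr (inr (inl j))) * - a i j.
    rewrite -!sumrN -big_split /=; apply: eq_bigr => j _.
    by rewrite /v; ring.
  by move=> ?; lra.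
have UV : \sum_i U i * b i < \sum_j c j * v j.
  have := f; rewrite !big_sumType /=.
  rewrite [X in _ + (_ + (_ + (X + _)))]big1 ?add0r; last by move=> *; rewrite mulr0.
  rewrite [X in _ + (_ + (_ + X))]big1 ?addr0; last by move=> *; rewrite mulr0.
  have -> : \sum_j c j * v j = - \sum_j u (inr (inl j)) * c j
      - \sum_j u (inr (inr (inl j))) * - c j.
    rewrite -!sumrN -big_split /=; apply: eq_bigr => j _.
    by rewrite /v; ring.
  under eq_bigr do rewrite -/(U _).
  by move=> ?; lra.
have swap (w : I -> R) (z : J -> R) :
    \sum_i w i * \sum_j a i j * z j = \sum_j (\sum_i w i * a i j) * z j.
  under eq_bigr do rewrite mulr_sumr.
  rewrite exchange_big /=; apply: eq_bigr => j _; rewrite mulr_suml.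
  by apply: eq_bigr => i _; rewrite mulrA.
have [r_eq0|r_neq0] := eqVneq r 0.
  have : 0 <= \sum_i U i * b i.
    apply: (@le_trans _ _ (\sum_i U i * \sum_j a i j * x0 j)).
      rewrite swap big1 // => j _.
      by rewrite eU r_eq0 !mul0r.
    by apply: ler_sum => i _; exact: ler_wpM2l.
  have : \sum_j c j * v j <= 0.
    under eq_bigr do rewrite -fy0; rewrite -swap.
    apply: sumr_le0 => i _; apply: mulr_ge0_le0 => //.
    by have := eV i; rewrite r_eq0 mul0r.
  by move=> ? ?; lra.
have rp : 0 < r by rewrite lt_neqAle eq_sym r_neq0.
have : \sum_i U i * \sum_j a i j * v j <= \sum_i U i * (r * b i).
  by apply: ler_sum => i _; exact: ler_wpM2l.
rewrite swap; under eq_bigr do rewrite eU -mulrA.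
under [X in _ <= X]eq_bigr do rewrite mulrCA.
by rewrite -!mulr_sumr ler_pM2l // leNgt UV.
Qed.

(** The variables in [J1] are nonnegative and those in [J2] free; the
    constraints in [I1] are inequalities and those in [I2] equalities. *)
Definition lp_primal_feas (I1 I2 J1 J2 : finType) (a : I1 + I2 -> J1 + J2 -> R)
    (b : I1 + I2 -> R) (x : J1 + J2 -> R) : Prop :=
  [/\ forall j, 0 <= x (inl j), forall i, \sum_j a (inl i) j * x j <= b (inl i) &
      forall i, \sum_j a (inr i) j * x j = b (inr i)].

Definition lp_dual_feas (I1 I2 J1 J2 : finType) (a : I1 + I2 -> J1 + J2 -> R)
    (c : J1 + J2 -> R) (y : I1 + I2 -> R) : Prop :=
  [/\ forall i, 0 <= y (inl i), forall j, c (inl j) <= \sum_i y i * a i (inl j) &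
      forall j, \sum_i y i * a i (inr j) = c (inr j)].

Lemma lp_duality (I1 I2 J1 J2 : finType) (a : I1 + I2 -> J1 + J2 -> R)
    (b : I1 + I2 -> R) (c : J1 + J2 -> R) x0 y0 :
  lp_primal_feas a b x0 -> lp_dual_feas a c y0 ->
  exists x y, [/\ lp_primal_feas a b x, lp_dual_feas a c y &
    \sum_i y i * b i = \sum_j c j * x j].
Proof.
move=> [x00 fx0 ex0] [y00 fy0 ey0].
(* equalities are split into two inequalities, signs become inequalities *)
pose a' (v : I1 + (I2 + (I2 + J1))) (j : J1 + J2) : R := match v with
  | inl i => a (inl i) j | inr (inl i) => a (inr i) j
  | inr (inr (inl i)) => - a (inr i) j
  | inr (inr (inr k)) => - (j == inl k)%:R end.
pose b' (v : I1 + (I2 + (I2 + J1))) : R := match v with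
  | inl i => b (inl i) | inr (inl i) => b (inr i)
  | inr (inr (inl i)) => - b (inr i) | inr (inr (inr k)) => 0 end.
have sgn (x : J1 + J2 -> R) k : \sum_j - (j == inl k)%:R * x j = - x (inl k).
  rewrite (bigD1 (inl k)) //= eqxx mulN1r big1 ?addr0 // => j /negPf ->.
  by rewrite oppr0 mul0r.
have opp (x : J1 + J2 -> R) i :
    \sum_j - a (inr i) j * x j = - \sum_j a (inr i) j * x j.
  by rewrite -sumrN; apply: eq_bigr => j _; rewrite mulNr.
pose pos (r : R) := Num.max r 0; pose neg (r : R) := Num.max (- r) 0.
have posneg r : pos r - neg r = r 
  by rewrite /pos /neg; case: (leP r 0); case: (leP (- r) 0) => *; lra.
have col (y : I1 + (I2 + (I2 + J1)) -> R) j : \sum_v y v * a' v j =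
    \sum_i (match i with inl i => y (inl i)
      | inr i => y (inr (inl i)) - y (inr (inr (inl i))) end) * a i j
    - (match j with inl k => y (inr (inr (inr k))) | inr _ => 0 end).
  rewrite !big_sumType /=.
  have -> : \sum_i (y (inr (inl i)) - y (inr (inr (inl i)))) * a (inr i) j =
      \sum_i y (inr (inl i)) * a (inr i) j
      + \sum_i y (inr (inr (inl i))) * - a (inr i) j.
    by rewrite -big_split /=; apply: eq_bigr => i _; ring.
  have -> : \sum_k y (inr (inr (inr k))) * - (j == inl k)%:R =
      - match j with inl k => y (inr (inr (inr k))) | inr _ => 0 end.
    case: j => [k|k]; last by rewrite big1 ?oppr0 // => k' _; rewrite oppr0 mulr0.
    rewrite (bigD1 k) //= eqxx mulrN1 big1 ?addr0 // => k' /negPf k'k.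
    by rewrite -[inl k == inl k']/(k == k') eq_sym k'k oppr0 mulr0.
  by rewrite !addrA.
pose y0' (v : I1 + (I2 + (I2 + J1))) : R := match v with
  | inl i => y0 (inl i) | inr (inl i) => pos (y0 (inr i))
  | inr (inr (inl i)) => neg (y0 (inr i))
  | inr (inr (inr k)) => \sum_i y0 i * a i (inl k) - c (inl k) end.
have [| | |x [y [fx y_ge0 fy e]]] := @lp_duality_le _ _ a' b' c x0 y0'.
- case=> [i|[i|[i|k]]] /=; first exact: fx0.
  + by rewrite ex0.
  + by rewrite opp ex0.
  + by rewrite sgn oppr_le0.
- case=> [i|[i|[i|k]]] /=; first exact: y00.
  + by rewrite le_max lexx orbT.
  + by rewrite le_max lexx orbT.
  + by rewrite subr_ge0.
- move=> j; rewrite col.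
  rewrite (eq_bigr (fun i => y0 i * a i j)); last first.
    by case=> [i|i] _ //=; rewrite posneg.
  by case: j => [k|k] /=; [ring | rewrite ey0 subr0].
exists x, (fun i => match i with inl i => y (inl i)
      | inr i => y (inr (inl i)) - y (inr (inr (inl i))) end); split.
- split=> [k|i|i].
  + by have := fx (inr (inr (inr k))); rewrite sgn oppr_le0.
  + exact: (fx (inl i)).
  + have := fx (inr (inl i)); have := fx (inr (inr (inl i))).
    rewrite opp /= => ? ?; lra.
- split=> [i|k|k]; first exact: y_ge0.
  + by have := fy (inl k); rewrite col => <-; rewrite gerBl.
  + by have := fy (inr k); rewrite col subr0.
- rewrite -e !big_sumType /= [X in _ = _ + (_ + (_ + X))]big1 ?addr0; last first.
    by move=> k _; rewrite mulr0.
  congr (_ + _); rewrite -big_split /=; apply: eq_bigr => i _; ring.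
Qed.

End LinearProgramming.

(** * Polyhedra and their extreme points *)

Section DotProduct.
Context {R : realType} {n : nat}.
Implicit Types u v w : 'cV[R]_n.

Lemma dotC u v : dot u v = dot v u.
Proof. by apply: eq_bigr => i _; rewrite mulrC. Qed.

Lemma dotDr u v w : dot u (v + w) = dot u v + dot u w.
Proof. by rewrite -big_split; apply: eq_bigr => i _; rewrite mxE mulrDr. Qed.

Lemma dotZr (c : R) u v : dot u (c *: v) = c * dot u v.
Proof. by rewrite mulr_sumr; apply: eq_bigr => i _; rewrite mxE mulrCA. Qed.

Lemma dotNr u v : dot u (- v) = - dot u v.
Proof. by rewrite -scaleN1r dotZr mulN1r. Qed.

Lemma dotBr u v w : dot u (v - w) = dot u v - dot u w.
Proof. by rewrite dotDr dotNr. Qed.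

Lemma dot0r u : dot u 0 = 0.
Proof. by rewrite -(scale0r 0) dotZr mul0r. Qed.

Lemma dotDl u v w : dot (u + v) w = dot u w + dot v w.
Proof. by rewrite dotC dotDr !(dotC w). Qed.

Lemma dotZl (c : R) u v : dot (c *: u) v = c * dot u v.
Proof. by rewrite dotC dotZr dotC. Qed.

Lemma dotNl u v : dot (- u) v = - dot u v.
Proof. by rewrite dotC dotNr dotC. Qed.

Lemma dotBl u v w : dot (u - v) w = dot u w - dot v w.
Proof. by rewrite dotDl dotNl. Qed.

Lemma dot_sumr (I : Type) (r : seq I) (F : I -> 'cV[R]_n) u :
  dot u (\sum_(i <- r) F i) = \sum_(i <- r) dot u (F i).
Proof. by elim/big_rec2: _ => [|i y1 y2 _ <-]; rewrite ?dot0r ?dotDr. Qed.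

Lemma dot_eq0 u : dot u u = 0 -> u = 0.
Proof.
move=> /eqP; rewrite psumr_eq0 => [/allP uu|i _]; last by rewrite -expr2 sqr_ge0.
apply/matrixP => i j; rewrite ord1 mxE.
by have := uu i (mem_index_enum _); rewrite /= mulf_eq0 orbb => /eqP.
Qed.

End DotProduct.

Section DotMatrix.
Context {R : realType}.

Lemma dot_mulmxl m n (A : 'M[R]_(m, n)) (x : 'cV_n) (y : 'cV_m) :
  dot (A *m x) y = dot x (A^T *m y).
Proof.
rewrite /dot; under eq_bigr do rewrite mxE mulr_suml.
rewrite exchange_big /=; apply: eq_bigr => j _; rewrite mxE mulr_sumr.
by apply: eq_bigr => i _; rewrite mxE mulrCA mulrA.
Qed.

Lemma dot_col_mx m n (u1 v1 : 'cV[R]_m) (u2 v2 : 'cV[R]_n) :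
  dot (col_mx u1 u2) (col_mx v1 v2) = dot u1 v1 + dot u2 v2.
Proof.
rewrite /dot big_split_ord; congr (_ + _); apply: eq_bigr => i _;
by rewrite ?col_mxEu ?col_mxEd.
Qed.

End DotMatrix.

Section Polyhedron.
Context {R : realType} {n : nat} {K : finType}.
Variables (a : K -> 'cV[R]_n) (b : K -> R).

Definition polyhedron : set 'cV[R]_n := [set l | forall k, dot (a k) l <= b k].
Local Notation X := polyhedron.

Lemma recc_polyhedron y : X !=set0 -> recc X y <-> forall k, dot (a k) y <= 0.
Proof.
move=> [x Xx]; split=> [ry k|ay x' s Xx' s0 k]; last first.
  by rewrite dotDr dotZr ler_wnDr // mulr_ge0_le0.
rewrite leNgt; apply/negP => ay.
have /(_ ((b k - dot (a k) x + 1) / dot (a k) y)) := ry x _ Xx.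
have h : 0 <= (b k - dot (a k) x + 1) / dot (a k) y.
  by rewrite divr_ge0 ?(ltW ay) // addr_ge0 // subr_ge0 Xx.
move=> /(_ h k); rewrite dotDr dotZr divfK ?gt_eqF //; lra.
Qed.

Lemma lineality_polyhedron y :
  X !=set0 -> lineality X y <-> forall k, dot (a k) y = 0.
Proof.
move=> X0; split=> [[/(recc_polyhedron _ X0) r1 /(recc_polyhedron _ X0) r2] k|z].
  by apply/le_anti; rewrite r1 /=; have := r2 k; rewrite dotNr oppr_le0.
by split; apply/(recc_polyhedron _ X0) => k; rewrite ?dotNr z ?oppr0.
Qed.

(** The lineality space of a nonempty polyhedron is the null space of its rows,
    along which every vector has an orthogonal decomposition. *)
Lemma orth_decomp l : X !=set0 ->
  exists y, lineality X y /\ orth (lineality X) (l - y).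
Proof.
move=> X0.
pose A : 'M[R]_(#|K|, n) := \matrix_(i, j) a (enum_val i) j 0.
have aA k y : dot (a k) y = (A *m y) (enum_rank k) 0.
  by rewrite mxE; apply: eq_bigr => j _; rewrite mxE enum_rankK.
(* the rows of W span the lineality space *)
pose W := kermx A^T.
have linW y : lineality X y <-> (y^T <= W)%MS.
  split=> [/(lineality_polyhedron _ X0) ay|/sub_kermxP yA].
    apply/sub_kermxP/trmx_inj; rewrite trmx_mul !trmxK trmx0.
    apply/matrixP => i j; rewrite ord1 [RHS]mxE.
    by have := ay (enum_val i); rewrite aA enum_valK.
  apply/(lineality_polyhedron _ X0) => k; rewrite aA.
  by move/(congr1 trmx): yA; rewrite trmx_mul !trmxK trmx0 => ->; rewrite mxE.
clearbody W.
have kerWW : (kermx (W *m W^T) <= kermx W)%MS.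
  apply/rV_subP => v /sub_kermxP; rewrite mulmxA => vWW.
  apply/sub_kermxP/trmx_inj; rewrite trmx0; apply: dot_eq0.
  have := congr1 (mulmx^~ v^T) vWW; rewrite mul0mx -!mulmxA -trmx_mul mulmxA.
  move=> /matrixP/(_ 0 0); rewrite !mxE => <-.
  by apply: eq_bigr => j _; rewrite !mxE.
have WW : (W^T <= W *m W^T)%MS.
  rewrite -(mxrank_leqif_sup (submxMl W W^T)).2 eqn_leq mxrankS ?submxMl //=.
  rewrite mxrank_tr; have := mxrankS kerWW; rewrite !mxrank_ker.
  by rewrite leq_sub2lE // rank_leq_row.
have [c cW] : exists c : 'rV_n, l^T *m W^T = c *m (W *m W^T).
  by apply/submxP/(submx_trans _ WW)/submxMl.
exists (W^T *m c^T); split.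
  by apply/linW; rewrite trmx_mul !trmxK submxMl.
move=> y /linW /submxP[e ye].
rewrite -[y]trmxK ye trmx_mul dotC dot_mulmxl trmxK mulmxBr.
have -> : W *m l = W *m (W^T *m c^T).
  by apply: trmx_inj; rewrite !trmx_mul !trmxK cW mulmxA.
by rewrite subrr dot0r.
Qed.

(** Take the direction of a segment around [l]: a constraint that is active at [l]
    is constant on the segment, and a direction annihilated by all constraints
    would lie in the lineality space, to which it is orthogonal. *)
Lemma nonextreme_direction l : X !=set0 -> X l -> orth (lineality X) l ->
  ~ extr (X `&` orth (lineality X)) l ->
  exists u, [/\ orth (lineality X) u, forall k, dot (a k) l = b k -> dot (a k) u = 0
    & exists k, dot (a k) u != 0].
Proof.
move=> X0 Xl ol nextr.
have [y [z [t [[Xy oy] [Xz oz] t01 lE yz]]]] : exists y z t,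
    [/\ (X `&` orth (lineality X)) y, (X `&` orth (lineality X)) z, 0 < t < 1,
     l = t *: y + (1 - t) *: z & y <> z].
  apply: contrapT => H; apply: nextr; split=> // y z t py pz t01 lE.
  by apply: contrapT => yz; apply: H; exists y, z, t.
exists (y - z); split.
- by move=> w lw; rewrite dotBl oy // oz // subrr.
- move=> k; rewrite lE !dotDr !dotNr !dotZr => ak.
  have := Xy k; have := Xz k; case/andP: t01 => t0 t1 zk yk.
  apply/eqP; rewrite subr_eq0; apply/eqP; nra.
- apply: contrapT => H; apply: yz; apply/eqP; rewrite -subr_eq0; apply/eqP.
  apply: dot_eq0.
  have ly : lineality X (y - z).
    apply/(lineality_polyhedron _ X0) => k; apply: contrapT => /eqP ?.
    by apply: H; exists k.
  by rewrite [LHS]dotBl oy // oz // subrr.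
Qed.

Definition inactive l : {set K} := [set k | dot (a k) l != b k]%SET.

(** Moving along [u] until the first new constraint becomes active. *)
Lemma ratio_test l u : X l ->
  (forall k, dot (a k) l = b k -> dot (a k) u = 0) ->
  (exists k, 0 < dot (a k) u) ->
  exists2 s, 0 <= s & X (l + s *: u) /\ (#|inactive (l + s *: u)| < #|inactive l|)%N.
Proof.
move=> Xl act [k0 k0u].
case: (@Order.TotalTheory.arg_minP _ _ _ k0 (fun k => 0 < dot (a k) u)
  (fun k => (b k - dot (a k) l) / dot (a k) u) k0u).
move=> k ku kmin; pose s := (b k - dot (a k) l) / dot (a k) u.
have s0 : 0 <= s by rewrite divr_ge0 ?(ltW ku) // subr_ge0.
exists s => //; split.
  move=> i; rewrite dotDr dotZr.
  have [iu|iu] := leP (dot (a i) u) 0.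
    by rewrite ler_wnDr // mulr_ge0_le0.
  by have := kmin i iu; rewrite -/s ler_pdivlMr //; lra.
apply/proper_card/properP; split.
  apply/fintype.subsetP => i; rewrite !inE; apply: contraNN => /eqP il.
  by rewrite dotDr dotZr act // mulr0 addr0 il.
exists k; rewrite !inE.
  by apply: contraTN ku => /eqP /act ->; rewrite ltxx.
  by rewrite negbK dotDr dotZr /s divfK ?(gt_eqF ku) // addrC subrK.
Qed.

(** A function that is quasi-convex and does not increase along recession
    directions is bounded on [X] by its values at the extreme points of the
    pointed part: the lineality component can be dropped, and a non-extreme
    point can be pushed to the boundary without decreasing the function. *)
Lemma extreme_dominates (g : 'cV[R]_n -> R) :
  (forall y z t, 0 <= t <= 1 ->
     g (t *: y + (1 - t) *: z) <= Num.max (g y) (g z)) ->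
  (forall l u, X l -> recc X u -> g (l + u) <= g l) ->
  forall l, X l -> exists2 e, extr (X `&` orth (lineality X)) e & g l <= g e.
Proof.
move=> gcvx grec.
suff H m l : X l -> orth (lineality X) l -> (#|inactive l| <= m)%N ->
    exists2 e, extr (X `&` orth (lineality X)) e & g l <= g e.
  move=> l Xl; have X0 : X !=set0 by exists l.
  have [y [ly oly]] := orth_decomp l X0.
  have Xly : X (l - y).
    move=> k; rewrite dotBr.
    by move/(lineality_polyhedron _ X0): ly => ->; rewrite subr0.
  have [e ee le] := H _ _ Xly oly (leqnn _).
  exists e => //; apply: le_trans le; rewrite -{1}(subrK y l).
  by apply: grec => //; case: ly.
elim: m l => [|m IH] l Xl ol lm.
all: have X0 : X !=set0 by exists l.
all: have [|nextr] := pselect (extr (X `&` orth (lineality X)) l); first by exists l.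
all: have [u [ou act [k ku]]] := nonextreme_direction X0 Xl ol nextr.
  move: lm; rewrite leqn0 cards_eq0 => /eqP/setP/(_ k); rewrite !inE => /negbFE.
  by move=> /eqP/act/eqP; rewrite (negbTE ku).
have Nu : (forall i, dot (a i) l = b i -> dot (a i) (- u) = 0).
  by move=> i /act; rewrite dotNr => ->; rewrite oppr0.
have oD v s : orth (lineality X) v -> orth (lineality X) (l + s *: v).
  by move=> ov w lw; rewrite dotDl dotZl ol // ov // mulr0 addr0.
have oNu : orth (lineality X) (- u) by move=> w lw; rewrite dotNl ou // oppr0.
have step v s : orth (lineality X) v -> X (l + s *: v) ->
    (#|inactive (l + s *: v)| < #|inactive l|)%N -> g l <= g (l + s *: v) ->
    exists2 e, extr (X `&` orth (lineality X)) e & g l <= g e.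
  move=> ov Xs ls gs; have [||e ee ge] := IH (l + s *: v) Xs; first exact: oD.
    by rewrite -ltnS (leq_trans ls).
  by exists e => //; exact: le_trans ge.
have rec v : (~ exists i, 0 < dot (a i) v) -> recc X v.
  move=> nv; apply/(recc_polyhedron _ X0) => i; rewrite leNgt; apply/negP => iv.
  by apply: nv; exists i.
have back v s : X (l + s *: v) -> 0 <= s -> recc X (- v) -> g l <= g (l + s *: v).
  move=> Xs s0 rv; have -> : g l = g (l + s *: v + s *: - v).
    by rewrite scalerN addrK.
  apply: grec => // x r Xx r0; rewrite scalerA; apply: rv => //.
  exact: mulr_ge0.
have [pos|npos] := pselect (exists i, 0 < dot (a i) u);
  have [neg|nneg] := pselect (exists i, 0 < dot (a i) (- u)).
- have [s s0 [Xs ls]] := ratio_test Xl act pos.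
  have [r r0 [Xr lr]] := ratio_test Xl Nu neg.
  have [sr0|srp] := eqVneq (s + r) 0.
    have s00 : s = 0 by apply/eqP; rewrite eq_le s0 -sr0 lerDl r0.
    by move: ls; rewrite s00 scale0r addr0 ltnn.
  have srp' : 0 < s + r by rewrite lt_neqAle eq_sym srp addr_ge0.
  have : g l <= Num.max (g (l + s *: u)) (g (l + r *: - u)).
    have -> : g l = g ((r / (s + r)) *: (l + s *: u)
        + (1 - r / (s + r)) *: (l + r *: - u)).
      congr g; apply/matrixP => i j; rewrite !mxE; field.
      exact: lt0r_neq0.
    by apply: gcvx; rewrite divr_ge0 ?ler_pdivrMr ?mul1r ?lerDr ?(ltW srp').
  rewrite le_max => /orP[gl|gl]; first exact: (step u s).
  exact: (step (- u) r).
- have [s s0 [Xs ls]] := ratio_test Xl act pos.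
  by apply: (step u s) => //; apply: back => //; exact: rec.
- have [s s0 [Xs ls]] := ratio_test Xl Nu neg.
  by apply: (step (- u) s) => //; apply: back => //; rewrite opprK; exact: rec.
- exfalso; move: ku; rewrite neq_lt => /orP[ku|ku]; last by apply: npos; exists k.
  by apply: nneg; exists k; rewrite dotNr oppr_gt0.
Qed.

(** If two extreme points had the same active constraints, the segment through
    them could be prolonged inside the polyhedron beyond [e]. *)
Lemma extr_inactive_inj e e' : X !=set0 ->
  extr (X `&` orth (lineality X)) e -> extr (X `&` orth (lineality X)) e' ->
  inactive e = inactive e' -> e = e'.
Proof.
move=> X0 [[Xe oe] ee] [[Xe' oe'] _] ine.
have act k : dot (a k) e = b k -> dot (a k) (e - e') = 0.
  move=> ek; have : k \notin inactive e by rewrite inE ek eqxx.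
  by rewrite ine inE negbK dotBr ek => /eqP ->; rewrite subrr.
have [s s0 Xs] : exists2 s, 0 < s & X (e + s *: (e - e')).
  have [pos|npos] := pselect (exists k, 0 < dot (a k) (e - e')).
    have [s s0 [Xs ls]] := ratio_test Xe act pos.
    exists s => //; rewrite lt_neqAle s0 andbT eq_sym; apply/eqP => s00.
    by move: ls; rewrite s00 scale0r addr0 ltnn.
  exists 1 => // k; rewrite scale1r dotDr ler_wnDr // leNgt; apply/negP => ?.
  by apply: npos; exists k.
have s1 : 0 < 1 + s by rewrite addr_gt0.
have E : e + s *: (e - e') = e'.
  apply: (ee _ _ (1 + s)^-1) => //.
  - split=> // w lw; rewrite dotDl dotZl dotBl oe // oe' //; lra.
  - by rewrite invr_gt0 s1 invf_lt1 // ltrDl.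
  - apply/matrixP => i j; rewrite !mxE; field.
    exact: lt0r_neq0.
have : (1 + s) *: (e - e') = 0 by rewrite scalerDl scale1r addrAC E subrr.
by move/eqP; rewrite scaler_eq0 (gt_eqF s1) subr_eq0 => /eqP.
Qed.

Lemma finite_extr : X !=set0 -> finite_set (extr (X `&` orth (lineality X))).
Proof.
move=> X0; pose E := extr (X `&` orth (lineality X)).
pose g (A : {set K}) : 'cV[R]_n := xget 0 [set e | E e /\ inactive e = A].
apply: (@sub_finite_set _ _ [set g A | A in [set: {set K}]]); last first.
  exact: finite_image.
move=> e Ee; exists (inactive e) => //; rewrite /g.
case: xgetP => [e' _ [Ee' ie']|/(_ e)]; last by case.
exact: extr_inactive_inj.
Qed.

End Polyhedron.

(** * Borel measurability in finite dimension *)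

Section BorelVectors.
Context {R : realType}.

Lemma measurable_fun_rsum d (T : measurableType d) (I : Type) (s : seq I)
    (h : I -> T -> R) (E : set T) :
  (forall i, measurable_fun E (h i)) ->
  measurable_fun E (fun x => \sum_(i <- s) h i x).
Proof.
move=> mh; elim: s => [|i s IH].
  by under eq_fun do rewrite big_nil; exact: measurable_cst.
by under eq_fun do rewrite big_cons; exact: measurable_funD.
Qed.

Lemma open_borel n (A : set 'cV[R]_n) :
  open A -> measurable (A : set (borel_cV R n)).
Proof. exact: sub_sigma_algebra. Qed.

Lemma continuous_borel n (f : 'cV[R]_n -> R) :
  continuous f -> measurable_fun setT (f : borel_cV R n -> measurableTypeR R).
Proof.
move=> /continuousP cf; apply: (measurability _ (RGenOpens.measurableE R)).
move=> _ [_ [a [b ->] <-]]; rewrite setTI; apply: open_borel; apply: cf.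
exact: interval_open.
Qed.

Lemma measurable_coord n i :
  measurable_fun setT ((fun v => v i 0) : borel_cV R n -> measurableTypeR R).
Proof. exact: (continuous_borel (@coord_continuous R n 1 i 0)). Qed.

Lemma measurable_dot n (u : 'cV[R]_n) :
  measurable_fun setT (dot u : borel_cV R n -> measurableTypeR R).
Proof.
apply: measurable_fun_rsum => i; apply: measurable_funM; first exact: measurable_cst.
exact: measurable_coord.
Qed.

Lemma continuous_rsum (T : topologicalType) (I : Type) (s : seq I)
    (h : I -> T -> R) :
  (forall i, continuous (h i)) -> continuous (fun x => \sum_(i <- s) h i x).
Proof.
move=> ch; elim: s => [|i s IH] x.
  by under eq_fun do rewrite big_nil; apply: cst_continuous.
under eq_fun do rewrite big_cons; rewrite /continuous_at.
exact: cvgD (ch i x) (IH x).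
Qed.

Lemma continuous_scale (T : topologicalType) (c : R) (h : T -> R) :
  continuous h -> continuous (fun x => c * h x).
Proof. by move=> ch x; apply: cvgM; [exact: cvg_cst | exact: ch]. Qed.

Lemma continuous_addc (T : topologicalType) (c : R) (h : T -> R) :
  continuous h -> continuous (fun x => c + h x).
Proof. by move=> ch x; apply: cvgD; [exact: cvg_cst | exact: ch]. Qed.

Lemma continuous_dot n (u : 'cV[R]_n) : continuous (dot u).
Proof.
apply: continuous_rsum => i; apply: continuous_scale.
exact: (@coord_continuous R n 1 i 0).
Qed.

Lemma measurable_set1_borel n (l : 'cV[R]_n) :
  measurable ([set l] : set (borel_cV R n)).
Proof.
have -> : [set l] = \bigcap_(i in [set: 'I_n])
    ((fun v : borel_cV R n => v i 0) @^-1` [set l i 0]).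
  apply/seteqP; split=> [_ ->//|v h].
  by apply/matrixP => i j; rewrite ord1; exact: h.
apply: fin_bigcap_measurable => // i _.
by rewrite -[X in measurable X]setTI; apply: (@measurable_coord n i) => //.
Qed.

(** An open set is the union of the rational boxes that it contains, so that
    measurability can be tested on coordinates. *)
Lemma measurable_fun_cV d (T : measurableType d) n (f : T -> 'cV[R]_n) :
  (forall i, measurable_fun setT (fun t => f t i 0 : measurableTypeR R)) ->
  measurable_fun setT (f : T -> borel_cV R n).
Proof.
move=> mf.
pose box (qr : 'cV[rat]_n * rat) : set 'cV[R]_n :=
  [set y | forall i, `|y i 0 - ratr (qr.1 i 0)| < ratr qr.2].
have mbox qr : measurable (f @^-1` box qr).
  have -> : f @^-1` box qr =
      \bigcap_(i in [set: 'I_n]) ((fun t => f t i 0) @^-1`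
        ball (ratr (qr.1 i 0) : R) (ratr qr.2)).
    apply/seteqP; split=> t /= h i; last by have := h i I; rewrite /ball /= distrC.
    by move=> _; rewrite /ball /= distrC.
  apply: fin_bigcap_measurable => // i _.
  by rewrite -[X in measurable X]setTI; apply: mf => //; exact: measurable_ball.
apply: (@measurability _ _ T (borel_cV R n) _ _ (@open 'cV[R]_n)) => //.
move=> _ [U oU <-]; rewrite setTI.
have -> : f @^-1` U =
    \bigcup_qr (if `[< box qr `<=` U >] then f @^-1` box qr else set0).
  apply/seteqP; split=> [t Uft|t [qr _]]; last first.
    by case: asboolP => // qrU; exact: qrU.
  have /nbhs_ballP[e /= e0 eU] : nbhs (f t) U by exact: open_nbhs_nbhs.
  have [r] : exists r : rat, (ratr r : R) \in `]0, (e / 2)[.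
    have /rat_in_itvoo[r ?] : 0 < e / 2 by rewrite divr_gt0.
    by exists r.
  rewrite in_itv /= => /andP[r0 re].
  have /choice[q qP] : forall i, exists q : rat, `|f t i 0 - ratr q| < ratr r.
    move=> i; have /rat_in_itvoo[q] : f t i 0 - ratr r < f t i 0 + ratr r.
      by rewrite ltrD2l gtrN.
    rewrite in_itv /= => /andP[q1 q2]; exists q; rewrite ltr_norml.
    by apply/andP; split; lra.
  exists (\col_i q i, r) => //; case: asboolP => [_ i /=|[]].
    by rewrite mxE; exact: qP.
  move=> y yb; apply: eU; split=> // i j; rewrite (ord1 j) /ball /=.
  have := qP i; have := yb i; rewrite /= mxE !ltr_norml.
  by move=> /andP[? ?] /andP[? ?]; apply/andP; split; lra.
by apply: countable_bigcupT_measurable => // qr; case: asboolP.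
Qed.

(** A supremum of continuous functions is lower semicontinuous, whatever the
    index set. *)
Lemma measurable_ereal_sup_cV n (I : Type) (X : set I) (g : I -> 'cV[R]_n -> R) :
  (forall i, continuous (g i)) ->
  measurable_fun setT
    ((fun w => ereal_sup [set (g i w)%:E | i in X]) : borel_cV R n -> \bar R).
Proof.
move=> cg; apply: (measurability _ (ErealGenOInfty.measurableE R)).
move=> /= _ [_ [a ->]] <-; rewrite setTI preimage_itvoy.
have -> : [set w | (a%:E < ereal_sup [set (g i w)%:E | i in X])%E] =
    \bigcup_(i in X) (g i @^-1` `]a, +oo[%classic).
  apply/seteqP; split=> [w /= /ereal_sup_gt[_ [i Xi <-]]|w [i Xi]] /=.
    by rewrite lte_fin => ai; exists i => //=; rewrite in_itv /= ai.
  rewrite in_itv /= andbT => ai; apply: (@lt_le_trans _ _ (g i w)%:E).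
    by rewrite lte_fin.
  by apply: ereal_sup_ubound; exists i.
apply: open_borel; apply: bigcup_open => i _.
by move/continuousP: (cg i); apply; exact: interval_open.
Qed.

End BorelVectors.

(** * Convex piecewise affine functions *)

Section Hinge.
Context {R : realType}.
Implicit Types (f : R -> R) (lo hi : R) (s : seq R).

Lemma convex_functionP f : convex_function (E := R^o) [set: R^o] f <->
  forall x y t, 0 <= t <= 1 -> f (t * x + (1 - t) * y) <= t * f x + (1 - t) * f y.
Proof.
split=> [cf x y t /andP[t0 t1]|cf t x y _ _]; last first.
  by apply: (cf x y t%:num); apply/andP; split.
by have := cf (Itv01 t0 t1) x y (mem_setT _) (mem_setT _).
Qed.

Definition slopes_in lo hi f := forall y z, y <= z ->
  lo * (z - y) <= f z - f y <= hi * (z - y).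

Definition conj_bounded lo hi f := exists C : R,
  forall w, lo <= w <= hi -> forall z, w * z - f z <= C.

Definition pos (r : R) : R := Num.max r 0.

Lemma pos_ge0 r : 0 <= pos r. Proof. by rewrite /pos le_max lexx orbT. Qed.
Lemma le_pos r : r <= pos r. Proof. by rewrite /pos le_max lexx. Qed.
Lemma pos_id r : 0 <= r -> pos r = r. Proof. by move=> ?; rewrite /pos max_l. Qed.
Lemma pos_eq0 r : r <= 0 -> pos r = 0. Proof. by move=> ?; rewrite /pos max_r. Qed.
Lemma pos_slope y z : y <= z -> 0 <= pos z - pos y <= z - y.
Proof.
by move=> yz; rewrite /pos; case: (leP y 0); case: (leP z 0) => *; lra.
Qed.

(** Convex piecewise affine functions with breakpoints in [s] and extreme
    slopes [lo] and [hi], in the form that makes their slopes explicit. *)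
Definition hinge lo hi s f := exists a c, [/\ forall j, 0 <= c j,
  \sum_(j < size s) c j = hi - lo :> R &
  forall z, f z = a + lo * z + \sum_(j < size s) c j * pos (z - s`_j)].

Lemma hinge_lohi lo hi s f : hinge lo hi s f -> lo <= hi.
Proof.
by move=> [a [c [c0 cs _]]]; rewrite -subr_ge0 -cs sumr_ge0.
Qed.

Lemma hinge_slopes lo hi s f : hinge lo hi s f -> slopes_in lo hi f.
Proof.
move=> [a [c [c0 cs fE]]] y z yz; rewrite !fE.
set A := \sum_(j < _) _; set B := \sum_(j < _) _.
have -> : a + lo * z + A - (a + lo * y + B) = lo * (z - y) + (A - B) by ring.
have AB : 0 <= A - B <= (hi - lo) * (z - y).
  rewrite -cs mulr_suml /A /B -sumrB; apply/andP; split.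
    apply: sumr_ge0 => j _; rewrite -mulrBr mulr_ge0 //.
    have /andP[+ _] := pos_slope (lerB yz (lexx s`_j)).
    by [].
  apply: ler_sum => j _; rewrite -mulrBr ler_wpM2l //.
  have /andP[_ h] := pos_slope (lerB yz (lexx s`_j)).
  by apply: le_trans h _; lra.
by case/andP: AB => ? ?; apply/andP; split; lra.
Qed.

Lemma pos_convex (x y t : R) : 0 <= t <= 1 ->
  pos (t * x + (1 - t) * y) <= t * pos x + (1 - t) * pos y.
Proof.
move=> /andP[t0 t1]; have t1' : 0 <= 1 - t by rewrite subr_ge0.
rewrite {1}/pos ge_max; apply/andP; split.
  by apply: lerD; apply: ler_wpM2l => //; exact: le_pos.
by apply: addr_ge0; apply: mulr_ge0 => //; exact: pos_ge0.
Qed.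

Lemma continuous_pos : continuous pos.
Proof.
have -> : pos = fun r => (r + `|r|) / 2.
  by apply/funext => r; rewrite /pos; case: (leP r 0) => h;
    [rewrite ler0_norm // | rewrite gtr0_norm //]; lra.
move=> r; apply: cvgM; last exact: cvg_cst.
by apply: cvgD; [exact: cvg_id | exact: norm_continuous].
Qed.

Lemma hinge_C_cvx lo hi s f : hinge lo hi s f -> C_cvx f.
Proof.
move=> [a [c [c0 cs fE]]]; split.
  have -> : f = fun z => a + lo * z + \sum_(j < size s) c j * pos (z - s`_j).
    exact/funext.
  move=> z; apply: cvgD.
    by apply: cvgD; [exact: cvg_cst | apply: cvgM; [exact: cvg_cst | exact: cvg_id]].
  apply: (@continuous_rsum R R^o) => j; apply: continuous_scale => x.
  apply: (@continuous_comp R^o R^o R^o (fun y => y - s`_j) pos).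
    by apply: (@cvgB _ R^o); [exact: cvg_id | exact: cvg_cst].
  exact: continuous_pos.
apply/convex_functionP => x y t t01; rewrite !fE.
suff : \sum_(j < size s) c j * pos (t * x + (1 - t) * y - s`_j) <=
  t * (\sum_(j < size s) c j * pos (x - s`_j))
  + (1 - t) * \sum_(j < size s) c j * pos (y - s`_j) by move=> ?; lra.
rewrite !mulr_sumr -big_split /=; apply: ler_sum => j _.
rewrite !(mulrCA _ (c j)) -mulrDr ler_wpM2l //.
have -> : t * x + (1 - t) * y - s`_j = t * (x - s`_j) + (1 - t) * (y - s`_j) by ring.
exact: pos_convex.
Qed.

Lemma hinge_piecewise_affine lo hi s f : hinge lo hi s f -> piecewise_affine f.
Proof.
move=> [a [c [c0 cs fE]]]; exists s => u v uv br.
exists (lo + \sum_(j < size s) (if s`_j <= u then c j else 0)),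
  (a - \sum_(j < size s) (if s`_j <= u then c j * s`_j else 0)).
move=> z /andP[uz zv]; rewrite fE.
have -> : \sum_(j < size s) c j * pos (z - s`_j) =
    (\sum_(j < size s) (if s`_j <= u then c j else 0)) * z
    - \sum_(j < size s) (if s`_j <= u then c j * s`_j else 0).
  rewrite mulr_suml -sumrB; apply: eq_bigr => j _.
  have := br s`_j (mem_nth _ (ltn_ord j)); case: leP => [su|us] /=.
    by rewrite pos_id ?subr_ge0 ?(le_trans su) //; lra.
  by rewrite -leNgt => vs; rewrite pos_eq0 ?subr_le0 ?(le_trans zv) //; lra.
lra.
Qed.

(** With [w = (1 - q) lo + q hi], replacing each positive part by [q] times its
    argument bounds [f] below by an affine function of slope [w]. *)
Lemma hinge_conj_bounded lo hi s f : hinge lo hi s f -> conj_bounded lo hi f.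
Proof.
move=> hf; have lohi := hinge_lohi hf; case: hf => a [c [c0 cs fE]].
exists (- a + \sum_(j < size s) c j * `|s`_j|) => w /andP[low whi] z.
have [q [q0 q1 qw]] : exists q, [/\ 0 <= q, q <= 1 & w = lo + q * (hi - lo)].
  have [lh|lh] := eqVneq lo hi.
    by exists 0; split => //; apply/eqP; rewrite eq_le {1}lh; lra.
  have d0 : 0 < hi - lo by rewrite subr_gt0 lt_neqAle lh.
  exists ((w - lo) / (hi - lo)); split.
  - by rewrite divr_ge0 ?subr_ge0.
  - by rewrite ler_pdivrMr // mul1r lerB.
  - by rewrite divfK ?gt_eqF // addrC subrK.
rewrite fE.
have : q * (hi - lo) * z - \sum_(j < size s) c j * `|s`_j| <=
    \sum_(j < size s) c j * pos (z - s`_j).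
  rewrite -cs mulr_sumr mulr_suml -sumrB; apply: ler_sum => j _.
  have -> : q * c j * z - c j * `|s`_j| = c j * (q * z - `|s`_j|) by ring.
  apply: ler_wpM2l => //.
  have h1 : q * (z - s`_j) <= pos (z - s`_j).
    have [z0|z0] := leP 0 (z - s`_j).
      by rewrite pos_id // ler_piMl.
    by rewrite pos_eq0 ?(ltW z0) // mulr_ge0_le0 // ltW.
  have h2 : q * s`_j <= `|s`_j|.
    apply: le_trans (ler_norm _) _; rewrite normrM ger0_norm //.
    by rewrite ler_piMl.
  lra.
rewrite qw; move=> ?; lra.
Qed.

(** Mixtures keep the breakpoints and the extreme slopes, so that the functions
    returned by the inner algorithm have this form again. *)
Lemma hinge_sum lo hi s (I : Type) (r : seq I) (y : I -> R) (g : I -> R -> R) h :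
  \sum_(i <- r) y i = 1 -> (forall i, 0 <= y i) ->
  (forall i, hinge lo hi s (g i)) ->
  hinge lo hi s (fun z => h + \sum_(i <- r) y i * g i z).
Proof.
move=> y1 y0 /choice[a /choice[c hg]].
exists (h + \sum_(i <- r) y i * a i), (fun j => \sum_(i <- r) y i * c i j); split.
- by move=> j; apply: sumr_ge0 => i _; rewrite mulr_ge0 //; case: (hg i).
- rewrite exchange_big /=.
  under eq_bigr => i _ do rewrite -mulr_sumr; under eq_bigr => i _.
    case: (hg i) => _ -> _; over.
  by rewrite -mulr_suml y1 mul1r.
- move=> z; under eq_bigr => i _.
    case: (hg i) => _ _ ->; rewrite !mulrDr; over.
  rewrite !big_split /= -mulr_suml y1 mul1r !addrA; congr (_ + _).
  under eq_bigr do rewrite mulr_sumr; rewrite exchange_big /=.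
  apply: eq_bigr => j _; rewrite mulr_suml.
  by apply: eq_bigr => i _; rewrite mulrA.
Qed.

(** The slope of [fstar] to the right of its [j]-th breakpoint (counted from
    one), with the extreme slopes [g] and [hi] on both sides. *)
Definition pwa_slope (G : R -> R) (hi g : R) s (j : nat) : R :=
  if j is j'.+1 then if j'.+1 == size s then hi else G s`_j' else g.

Lemma pwa_rightE (G : R -> R) hi g v k ks z : path <=%R k ks -> k <= z ->
  pwa_right G hi v k ks z = v + g * (z - k) +
    \sum_(j < (size ks).+1) (pwa_slope G hi g (k :: ks) j.+1
      - pwa_slope G hi g (k :: ks) j) * pos (z - (k :: ks)`_j).
Proof.
elim: ks k v g => [|k' ks IH] k v g /= kks kz.
  by rewrite big_ord1 /= pos_id ?subr_ge0 //; ring.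
case/andP: kks => kk' k'ks; rewrite big_ord_recl /= pos_id ?subr_ge0 //.
have [zk'|k'z] := leP z k'.
  rewrite big1 ?addr0; first ring.
  move=> j _; rewrite pos_eq0 ?mulr0 //= subr_le0 (le_trans zk') //.
  have := order_path_min le_trans k'ks => /allP k'min.
  have /[!inE] : (k' :: ks)`_j \in k' :: ks by apply: mem_nth.
  by case/predU1P => [->//|/k'min].
rewrite (IH _ _ (G k)) ?(ltW k'z) //.
have -> : v + G k * (k' - k) + G k * (z - k') =
    v + g * (z - k) + (G k - g) * (z - k) by ring.
rewrite -addrA; congr (_ + (_ + _)); apply: eq_bigr => -[j jks] _ /=.
by case: j jks.
Qed.

Section PiecewiseAffine.
Variables (G : R -> R) (lo hi : R) (s : seq R).
Hypothesis s_sorted : sorted <=%R s.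
Hypothesis G_mono : {in s &, {homo G : x y / x <= y}}.
Hypothesis G_itv : {in s, forall x, lo <= G x <= hi}.
Hypothesis lohi : lo <= hi.
Local Notation slope := (pwa_slope G hi lo s).

Lemma pwa_slope_le j : (j < size s)%N -> slope j <= slope j.+1.
Proof.
case: j => [|j] js /=; first by case: eqP => // _; have /andP[] := G_itv (mem_nth 0 js).
rewrite (ltn_eqF js); have js' := ltnW js; case: eqP => _.
  by have /andP[] := G_itv (mem_nth 0 js').
apply: G_mono; try exact: mem_nth.
by apply: (sorted_leq_nth le_trans le_refl 0 s_sorted); rewrite ?inE.
Qed.

Lemma sum_pwa_slope n : \sum_(j < n) (slope j.+1 - slope j) = slope n - lo.
Proof. by rewrite -(big_mkord predT (fun j => slope j.+1 - slope j)) telescope_sumr. Qed.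

Definition pwa z : R :=
  - lo * s`_0 + lo * z + \sum_(j < size s) (slope j.+1 - slope j) * pos (z - s`_j).

Lemma pwa_hinge : (0 < size s)%N -> hinge lo hi s pwa.
Proof.
move=> s0; exists (- lo * s`_0),
  (fun j => if (j < size s)%N then slope j.+1 - slope j else 0); split.
- by move=> j; case: ifP => // js; rewrite subr_ge0 pwa_slope_le.
- under eq_bigr => j _ do rewrite ltn_ord.
  rewrite sum_pwa_slope; congr (_ - _).
  by rewrite -{1}(prednK s0) /= prednK // eqxx.
- by move=> z; congr (_ + _); apply: eq_bigr => j _; rewrite ltn_ord.
Qed.

(** Moving away from the breakpoint, the accumulated slopes exceed [slope j.+1] on
    its right and fall below [slope j] on its left. *)
Lemma pwa_subgradient j w : (j < size s)%N -> slope j <= w <= slope j.+1 ->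
  forall z, w * z - pwa z <= w * s`_j - pwa s`_j.
Proof.
move=> js /andP[jw wj] z; rewrite /pwa.
have c0 (l : 'I_(size s)) : 0 <= slope l.+1 - slope l.
  by rewrite subr_ge0 pwa_slope_le.
have sl (l m : nat) : (l <= m < size s)%N -> s`_l <= s`_m.
  case/andP=> lm ms; apply: (sorted_leq_nth le_trans le_refl 0 s_sorted) => //;
  by rewrite inE // (leq_ltn_trans lm).
(* the slopes accumulated up to index m are counted on both sides of s`_j *)
have cut m (x : R) : (m <= size s)%N -> (slope m - lo) * x =
    \sum_(l < size s) (if (l < m)%N then (slope l.+1 - slope l) * x else 0).
  move=> ms; rewrite -sum_pwa_slope mulr_suml (big_ord_widen _ (fun l => (slope l.+1 - slope l) * x) ms).
  by rewrite big_mkcond.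
have [jz|zj] := leP s`_j z.
  have : (slope j.+1 - lo) * (z - s`_j) <=
      \sum_(l < size s) (slope l.+1 - slope l) * pos (z - s`_l)
      - \sum_(l < size s) (slope l.+1 - slope l) * pos (s`_j - s`_l).
    rewrite cut // -sumrB; apply: ler_sum => l _; rewrite -mulrBr; case: ifP => lj.
      have lj' : s`_l <= s`_j by apply: sl; rewrite -ltnS lj.
      by rewrite !pos_id ?subr_ge0 ?(le_trans lj') // ler_wpM2l //; lra.
    apply: mulr_ge0 => //.
    by have /andP[] := pos_slope (lerB jz (lexx s`_l)).
  have : w * (z - s`_j) <= slope j.+1 * (z - s`_j).
    by apply: ler_wpM2r => //; rewrite subr_ge0.
  by move=> ? ?; lra.
have : \sum_(l < size s) (slope l.+1 - slope l) * pos (s`_j - s`_l)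
    - \sum_(l < size s) (slope l.+1 - slope l) * pos (z - s`_l)
    <= (slope j - lo) * (s`_j - z).
  rewrite cut ?(ltnW js) // -sumrB; apply: ler_sum => l _; rewrite -mulrBr.
  case: ifP => lj.
    apply: ler_wpM2l => //.
    have /andP[_ h] := pos_slope (lerB (ltW zj) (lexx s`_l)).
    by apply: le_trans h _; lra.
  have lj' : s`_j <= s`_l by apply: sl; rewrite ltn_ord leqNgt lj.
  by rewrite !pos_eq0 ?subr_le0 ?subrr ?mulr0 // (le_trans (ltW zj)).
have : slope j * (s`_j - z) <= w * (s`_j - z).
  by apply: ler_wpM2r => //; rewrite subr_ge0 ltW.
by move=> ? ?; lra.
Qed.

End PiecewiseAffine.
End Hinge.

(** * Transfer of integrals and discrete laws *)

Section Transfer.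
Context {R : realType} d1 d2 (X : measurableType d1) (Y : measurableType d2).
Variables (phi : X -> Y) (mphi : measurable_fun [set: X] phi).
Variables (mu : {measure set X -> \bar R}) (nu : {measure set Y -> \bar R}).
Hypothesis nuE : forall B, measurable B -> nu B = mu (phi @^-1` B).
Variables (D : set Y) (f : Y -> \bar R).
Hypotheses (mD : measurable D) (mf : measurable_fun [set: Y] f).

Lemma integrable_transfer :
  nu.-integrable D f <-> mu.-integrable (phi @^-1` D) (f \o phi).
Proof.
have E : (\int[nu]_(y in D) `|f y| = \int[mu]_(x in phi @^-1` D) `|(f \o phi) x|)%E.
  transitivity (\int[pushforward mu phi]_(y in D) `|f y|)%E.
    by apply: eq_measure_integral => A mA _; exact: nuE.
  rewrite ge0_integral_pushforward //.
  by apply: measurableT_comp => //; exact: measurable_funTS.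
have mDphi : measurable (phi @^-1` D) by rewrite -[X in measurable X]setTI; exact: mphi.
split=> /integrableP[m fin]; apply/integrableP; split.
- by apply: (measurable_comp measurableT) => //; exact: measurable_funTS.
- by rewrite -E.
- exact: measurable_funTS.
- by rewrite E.
Qed.

Lemma integral_transfer : mu.-integrable (phi @^-1` D) (f \o phi) ->
  (\int[nu]_(y in D) f y = \int[mu]_(x in phi @^-1` D) (f \o phi) x)%E.
Proof.
move=> intf; rewrite -(integral_pushforward mphi mf intf mD).
by apply: eq_measure_integral => A mA _; exact: nuE.
Qed.

End Transfer.

Section Probability.
Context {R : realType} d (T : measurableType d) (P : probability T R).
Local Open Scope ereal_scope.

Lemma prob_compl0 (D : set T) : measurable D -> P D = 1 -> P (~` D) = 0.
Proof. by move=> mD D1; rewrite probability_setC // D1 subee. Qed.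

Lemma integrable_full (D : set T) (f : T -> \bar R) :
  measurable D -> P D = 1 -> measurable_fun setT f ->
  P.-integrable setT f <-> P.-integrable D f.
Proof.
move=> mD D1 mf.
rewrite (negligible_integrable (measurableC mD) _ mf (prob_compl0 mD D1)) //.
by rewrite setTD setCK.
Qed.

Lemma integral_full (D : set T) (f : T -> \bar R) :
  measurable D -> P D = 1 -> P.-integrable setT f ->
  \int[P]_(x in D) f x = \int[P]_x f x.
Proof.
move=> mD D1 intf.
rewrite [RHS](negligible_integral (measurableC mD) _ intf (prob_compl0 mD D1)) //.
by rewrite setTD setCK.
Qed.

Lemma integrable_bounded (D : set T) (f : T -> R) (M : R) :
  measurable D -> measurable_fun D f -> (forall x, D x -> `|f x| <= M)%R ->
  P.-integrable D (EFin \o f).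
Proof.
move=> mD mf fM; apply: measurable_bounded_integrable => //.
  by rewrite (le_lt_trans (probability_le1 _ mD)) // ltry.
exists M; split; first exact: num_real.
by move=> x Mx t Dt /=; apply: le_trans (fM t Dt) (ltW Mx).
Qed.

Lemma integral_cst1 (D : set T) (c : R) : measurable D -> P D = 1 ->
  \int[P]_(x in D) c%:E = c%:E.
Proof.
move=> mD D1; transitivity (c%:E * P D); last by rewrite D1 mule1.
exact: integral_cst.
Qed.

End Probability.

Section Discrete.
Context {R : realType} {n : nat}.
Implicit Types (V : {fset 'cV[R]_n}) (nu : 'cV[R]_n -> R).
Local Notation T := (borel_cV R n).
Local Open Scope ereal_scope.

(** Each atom of [V] is indexed by its position, because countable sums of
    measures are indexed by natural numbers. *)
Definition atoms V nu (nu0 : forall l, (0 <= nu l)%R) (k : nat) :=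
  mscale (NngNum (nu0 (nth 0%R V k))) (dirac (nth 0%R V k : T)).

Lemma exists_discrete_law V nu :
  (forall l, l \in V -> 0 <= nu l)%R -> (\sum_(l <- V) nu l = 1)%R ->
  exists tau : probability T R, discrete_law V nu tau.
Proof.
move=> nu0 nu1; pose nu' l := Num.max (nu l) 0%R.
have nu'0 l : (0 <= nu' l)%R by rewrite le_max lexx orbT.
pose m := msum (atoms V nu'0) (size V).
have mE (A : set T) : measurable A -> m A = \sum_(l <- V) (nu l)%:E * \d_(l : T) A.
  move=> mA; rewrite /m /msum (big_nth 0%R) big_mkord; apply: eq_bigr => k _.
  have E : nu' V`_k = nu V`_k by rewrite /nu' max_l // nu0 // mem_nth.
  exact: (congr1 (fun r => r%:E * \d_(V`_k : T) A) E).
have m1 : m setT = 1.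
  rewrite mE //; under eq_bigr do rewrite diracT mule1.
  by rewrite sumEFin nu1.
pose m' : {measure set T -> \bar R} := m.
exists (mnormalize m' (dirac (0%R : T))) => A mA.
have m1' : m' setT = 1 by exact: m1.
rewrite /= /mnormalize m1'.
by rewrite onee_eq0 /= invr1 mule1; exact: mE.
Qed.

Lemma ge0_integral_discrete V nu (tau : probability T R) (f : T -> \bar R) :
  (forall l, l \in V -> 0 <= nu l)%R -> discrete_law V nu tau ->
  measurable_fun setT f -> (forall l, 0 <= f l) ->
  \int[tau]_l f l = \sum_(l <- V) (nu l)%:E * f l.
Proof.
move=> nu0 dtau mf f0; pose nu' l := Num.max (nu l) 0%R.
have nu'0 l : (0 <= nu' l)%R by rewrite le_max lexx orbT.
rewrite (eq_measure_integral (msum (atoms V nu'0) (size V))); last first.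
  move=> A mA _; rewrite [LHS]dtau // /msum (big_nth 0%R) big_mkord.
  apply: eq_bigr => k _.
  have E : nu V`_k = nu' V`_k by rewrite /nu' max_l // nu0 // mem_nth.
  exact: (congr1 (fun r => r%:E * \d_(V`_k : T) A) E).
rewrite ge0_integral_measure_sum // (big_nth 0%R) big_mkord; apply: eq_bigr => k _.
rewrite ge0_integral_mscale // integral_dirac // diracT mul1e /=.
have E : nu' V`_k = nu V`_k by rewrite /nu' max_l // nu0 // mem_nth.
exact: (congr1 (fun r => r%:E * f (V`_k)) E).
Qed.

Lemma integrable_discrete V nu (tau : probability T R) (f : T -> R) :
  (forall l, l \in V -> 0 <= nu l)%R -> discrete_law V nu tau ->
  measurable_fun setT f -> tau.-integrable setT (EFin \o f).
Proof.
move=> nu0 dtau mf; apply/integrableP; split; first exact/measurable_EFinP.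
rewrite (@ge0_integral_discrete V nu) //; last first.
  by apply: measurableT_comp => //; exact/measurable_EFinP.
under eq_bigr do rewrite /= -EFinM; by rewrite sumEFin ltry.
Qed.

Lemma integral_discrete V nu (tau : probability T R) (f : T -> R) :
  (forall l, l \in V -> 0 <= nu l)%R -> discrete_law V nu tau ->
  measurable_fun setT f ->
  \int[tau]_l (f l)%:E = (\sum_(l <- V) nu l * f l)%:E.
Proof.
move=> nu0 dtau mf.
have mfE : measurable_fun setT (EFin \o f) by exact/measurable_EFinP.
rewrite integralE !(@ge0_integral_discrete V nu) //; first last.
- exact: measurable_funepos.
- exact: measurable_funeneg.
have -> : \sum_(l <- V) (nu l)%:E * (EFin \o f)^\+ l =
    (\sum_(l <- V) nu l * Num.max (f l) 0)%:E.
  by rewrite -sumEFin; apply: eq_bigr => l _; rewrite EFinM EFin_max funeposE.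
have -> : \sum_(l <- V) (nu l)%:E * (EFin \o f)^\- l =
    (\sum_(l <- V) nu l * Num.max (- f l) 0)%:E.
  by rewrite -sumEFin; apply: eq_bigr => l _; rewrite EFinM EFin_max funenegE.
rewrite -EFinB -sumrB; congr EFin; apply: eq_bigr => l _; rewrite -mulrBr.
by congr (_ * _)%R; case: (leP (f l) 0%R); case: (leP (- f l)%R 0%R) => *; lra.
Qed.

Lemma discrete_law_supp V nu (tau : probability T R) (A : set T) :
  discrete_law V nu tau -> measurable A -> (forall l, l \in V -> A l) ->
  (\sum_(l <- V) nu l = 1)%R -> tau A = 1.
Proof.
move=> dtau mA VA nu1; rewrite dtau //.
rewrite (eq_big_seq (fun l => (nu l)%:E)) ?sumEFin ?nu1 // => l lV.
by rewrite diracE mem_set ?mule1 //; exact: VA.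
Qed.

End Discrete.

(** * Integrals of conjugates and weak transport duality *)

Section Conjugate.
Context {R : realType}.
Implicit Types f g : R -> R.

Lemma conjugate_lb f (z w : R) : ((z * w - f z)%:E <= conjugate f w)%E.
Proof. by apply: ereal_sup_ubound; exists z. Qed.

Lemma measurable_conjugate f :
  measurable_fun setT (conjugate f : measurableTypeR R -> \bar R).
Proof.
apply: lower_semicontinuous_measurable; apply/lower_semicontinuousP => a.
have -> : [set w | (a%:E < conjugate f w)%E] =
    \bigcup_z ((fun w => z * w - f z) @^-1` `]a, +oo[%classic).
  apply/seteqP; split=> [w /= /ereal_sup_gt[_ [z _ <-]]|w [z _]] /=.
    by rewrite lte_fin => az; exists z => //=; rewrite in_itv /= az.
  rewrite in_itv /= andbT => az; apply: lt_le_trans (conjugate_lb f z w).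
  by rewrite lte_fin.
apply: bigcup_open => z _.
have : continuous (fun w : R => z * w - f z).
  by move=> w; apply: cvgB; [apply: cvgM; [exact: cvg_cst | exact: cvg_id] | exact: cvg_cst].
by move/continuousP; apply; exact: interval_open.
Qed.

Lemma conjugate_le f (w C : R) : (forall z, z * w - f z <= C) ->
  (conjugate f w <= C%:E)%E.
Proof. by move=> fC; apply: ge_ereal_sup => _ [z _ <-]; rewrite lee_fin. Qed.

End Conjugate.

Section MarginalIntegrals.
Context {R : realType} (D : problem R).
Hypothesis lohi : forall i : 'I_(ndim D), lo i <= hi i.
Hypothesis marg1 : forall i : 'I_(ndim D), marg i (Omega1 i) = 1%E.
Local Notation Rm := (measurableTypeR R).
Implicit Types (i : 'I_(ndim D)) (f g : R -> R).

Lemma measurable_Omega1 i : measurable (Omega1 i : set Rm).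
Proof. exact: measurable_itv. Qed.

Definition conj_ok i f := conj_bounded (lo i) (hi i) f.

Lemma conjugate_fin i f (w : R) : conj_ok i f -> Omega1 i w ->
  conjugate f w \is a fin_num.
Proof.
move=> [C fC]; rewrite /Omega1 /= in_itv /= => wi.
rewrite fin_numElt (lt_le_trans (ltNyr _) (conjugate_lb f 0 w)) /=.
apply: le_lt_trans (ltry C); apply: conjugate_le => z.
by rewrite mulrC fC.
Qed.

Lemma conj_integrable i f : conj_ok i f ->
  (marg i).-integrable (Omega1 i) (conjugate f).
Proof.
move=> fok; have [C fC] := fok; have mO := measurable_Omega1 i.
have E : {in Omega1 i, (EFin \o (fine \o conjugate f)) =1 conjugate f}.
  by move=> w /set_mem wi; rewrite /= fineK //; exact: conjugate_fin fok wi.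
apply: (eq_integrable mO _ _ E).
apply: (@integrable_bounded _ _ _ _ _ _ (`|f 0| + `|C|)) => //.
  apply: measurableT_comp; first exact: fine_measurable.
  exact: measurable_funTS (measurable_conjugate f).
move=> w wi /=; have := conjugate_fin fok wi; have h1 := conjugate_lb f 0 w.
have h2 : (conjugate f w <= C%:E)%E.
  by apply: conjugate_le => z; rewrite mulrC fC //; move: wi; rewrite /Omega1 /= in_itv.
move: h1 h2; case: (conjugate f w) => // r; rewrite !lee_fin /= mul0r sub0r => h1 h2 _.
have := ler_norm C; have := ler_norm (- f 0); rewrite normrN => ? ?.
rewrite ler_norml; apply/andP; split; have := normr_ge0 C; have := normr_ge0 (f 0); have := ler_norm (f 0) => *; lra.
Qed.

Lemma conj_int_fin i f : conj_ok i f -> conj_int i f \is a fin_num.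
Proof.
by move=> fok; apply: integrable_fin_num; [exact: measurable_Omega1 | exact: conj_integrable].
Qed.

Lemma conj_int_le i f g (c : R) : conj_ok i f -> conj_ok i g ->
  (forall z, g z <= f z + c) -> (conj_int i f <= conj_int i g + c%:E)%E.
Proof.
move=> fok gok gf; have mO := measurable_Omega1 i.
have ic : (marg i).-integrable (Omega1 i) (EFin \o cst c).
  by apply: (@integrable_bounded _ _ _ _ _ _ `|c|) => //; exact: measurable_cst.
rewrite /conj_int -(integral_cst1 c mO (marg1 i)) -integralD //; last exact: conj_integrable.
apply: le_integral => //.
- exact: conj_integrable.
- by apply: integrableD => //; exact: conj_integrable.
- move=> w /set_mem wi; apply: ge_ereal_sup => _ [z _ <-].
  apply: le_trans (leeD (conjugate_lb g z w) (le_refl c%:E)).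
  by rewrite -EFinD lee_fin; have := gf z => ?; lra.
Qed.

(** A bound below by a constant is automatic, so only an infinite value can
    prevent integrability. *)
Lemma conj_int_gtNy i f : (-oo < conj_int i f)%E /\
  ((conj_int i f < +oo)%E -> (marg i).-integrable (Omega1 i) (conjugate f)).
Proof.
have mO := measurable_Omega1 i.
have mc : measurable_fun (Omega1 i) (conjugate f : Rm -> \bar R).
  exact: measurable_funTS (measurable_conjugate f).
have negfin : (\int[marg i]_(w in Omega1 i) (conjugate f)^\- w <= `|f 0|%:E)%E.
  rewrite -(integral_cst1 `|f 0| mO (marg1 i)).
  apply: ge0_le_integral => //.
  - exact: measurable_funeneg.
  - move=> w wi; rewrite funenegE ge_max lee_fin normr_ge0 andbT leeNl.
    apply: le_trans (conjugate_lb f 0 w); rewrite lee_fin mul0r sub0r lerN2.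
    exact: ler_norm.
have posge : (0 <= \int[marg i]_(w in Omega1 i) (conjugate f)^\+ w)%E.
  by apply: integral_ge0 => w _; exact: funepos_ge0.
have negge : (0 <= \int[marg i]_(w in Omega1 i) (conjugate f)^\- w)%E.
  by apply: integral_ge0 => w _; exact: funeneg_ge0.
have cE : conj_int i f = (\int[marg i]_(w in Omega1 i) (conjugate f)^\+ w
   - \int[marg i]_(w in Omega1 i) (conjugate f)^\- w)%E by exact: integralE.
split.
  rewrite cE; move: negfin posge negge.
  by case: (\int[_]_(_ in _) _ _)%E => // r; case: (\int[_]_(_ in _) _ _)%E => // s;
     rewrite ?ltNyr ?ltNye.
move=> fin; apply/integrableP; split => //.
rewrite -/(abse \o conjugate f) fune_abse ge0_integralD //; first last.
- exact: measurable_funeneg.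
- exact: measurable_funepos.
move: fin; rewrite cE; move: negfin posge negge.
case: (\int[_]_(_ in _) _ _)%E => // r; case: (\int[_]_(_ in _) _ _)%E => // s *.
by rewrite -EFinD ltry.
Qed.


Local Notation law := (probability (borel_cV R (m_in D + m_eq D)) R).
Implicit Types tau : law.

Lemma measurable_dot_vecp i : measurable_fun [set: borel_cV R (m_in D + m_eq D)]
  (dot (vecp i) : borel_cV R (m_in D + m_eq D) -> Rm).
Proof. exact: measurable_dot. Qed.

HB.instance Definition _ i := isMeasurableFun.Build _ _ _ _
  (dot (vecp i) : borel_cV R (m_in D + m_eq D) -> Rm) (@measurable_dot_vecp i).

(** [push] is a bare set function; integration requires the bundled measure. *)
Definition push_law tau i : probability Rm R :=
  distribution tau (dot (vecp i) : borel_cV R (m_in D + m_eq D) -> Rm).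

Lemma push_lawE tau i : (push_law tau i : set Rm -> \bar R) = push tau i.
Proof. by []. Qed.

Lemma push_intE tau i f : measurable_fun setT (f : Rm -> Rm) ->
  tau.-integrable setT (EFin \o (f \o dot (vecp i))) ->
  push_int tau i f = (\int[tau]_l (f (dot (vecp i) l))%:E)%E.
Proof.
move=> mf intf; rewrite /push_int -push_lawE.
apply: (integral_transfer (@measurable_dot_vecp i) _ measurableT _ intf) => //.
exact/measurable_EFinP.
Qed.

(** Kantorovich weak duality: integrate w z <= f^*(w) + f z. *)
Lemma OT_weak i tau f : measurable_fun setT (f : Rm -> Rm) ->
  tau.-integrable setT (EFin \o dot (vecp i)) ->
  tau.-integrable setT (EFin \o (f \o dot (vecp i))) ->
  (- conj_int i f - push_int tau i f <= OT i (push tau i))%E.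
Proof.
move=> mf intid intf; have mO := measurable_Omega1 i.
have pfin : push_int tau i f \is a fin_num.
  by rewrite push_intE //; exact: integrable_fin_num.
have [cNy cint] := conj_int_gtNy i f.
have [coo|] := eqVneq (conj_int i f) +oo%E.
  by rewrite coo /= addNye leNye.
rewrite -ltey => cfin.
have {}cint := cint cfin.
have {}cfin : conj_int i f \is a fin_num by rewrite fin_numElt cNy.
apply: le_ereal_inf_tmp => _ [g gc <-].
have gfst B : measurable B -> marg i B = g (fst @^-1` B) by move=> mB; case: (gc B mB).
have gsnd B : measurable B -> push_law tau i B = g (snd @^-1` B) by move=> mB; case: (gc B mB).
set E := (Omega1 i `*` [set: R]).
have EE : E = (fst : Rm * Rm -> Rm) @^-1` Omega1 i.
  by apply/seteqP; split=> [[w z] []|[w z]].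
have mE : measurable (E : set (Rm * Rm)%type) by apply: measurableX.
have gE1 : g E = 1%E by rewrite EE -gfst.
have mc := measurable_conjugate f.
have ic : g.-integrable E (conjugate f \o fst).
  by rewrite EE; apply/(integrable_transfer measurable_fst gfst mO mc).
have icE : conj_int i f = (\int[g]_(x in E) (conjugate f x.1))%E.
  by rewrite EE; apply: (integral_transfer measurable_fst gfst mO mc); rewrite -EE.
have snd_int (h : R -> R) : measurable_fun setT (h : Rm -> Rm) ->
    tau.-integrable setT (EFin \o (h \o dot (vecp i))) ->
    g.-integrable setT (EFin \o h \o snd).
  move=> mh inth; have mhE : measurable_fun setT (EFin \o h : Rm -> \bar R) by exact/measurable_EFinP.
  have /(integrable_transfer measurable_snd gsnd measurableT mhE) : (push_law tau i).-integrable setT (EFin \o h).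
    by apply/(integrable_transfer (@measurable_dot_vecp i) _ measurableT mhE).
  by rewrite preimage_setT.
have iff := snd_int f mf intf.
have iffE : push_int tau i f = (\int[g]_(x in E) (f x.2)%:E)%E.
  rewrite (integral_full mE gE1 iff) /push_int -push_lawE.
  have mfE : measurable_fun setT (EFin \o f : Rm -> \bar R) by exact/measurable_EFinP.
  by rewrite (integral_transfer measurable_snd gsnd measurableT mfE) // preimage_setT.
have {}iff : g.-integrable E (EFin \o f \o snd) by apply: integrableS iff.
have iz : g.-integrable E (EFin \o snd).
  by apply: (@integrableS _ _ _ _ setT) => //; apply: (snd_int id) => //; exact: measurable_id.
have ip : g.-integrable E (fun x : Rm * Rm => (- ((x.2 : R) * (x.1 : R)))%:E).
  pose M := `|lo i| + `|hi i|.
  have iMz : g.-integrable E (EFin \o (fun x : Rm * Rm => M * (x.2 : R))).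
    by apply: (eq_integrable mE _ _ _ (integrableZl mE M iz)) => x _ /=; rewrite EFinM.
  apply: le_integrable iMz => //.
    apply/measurable_EFinP; apply: measurable_funN.
    by apply: measurable_funM; [exact: measurable_funTS measurable_snd | exact: measurable_funTS measurable_fst].
  move=> [w z] [/= wi _]; rewrite lee_fin normrN !normrM mulrC ler_wpM2r //.
  move: wi; rewrite /Omega1 /= in_itv /= => /andP[lw wh].
  rewrite (ger0_norm (_ : 0 <= M)) ?addr_ge0 // /M ler_norml.
  have := ler_norm (- lo i); have := ler_norm (hi i); rewrite normrN.
  have := normr_ge0 (lo i); have := normr_ge0 (hi i) => *.
  by apply/andP; split; lra.
set J := (\int[g]_(_ in _) _)%E.
have Jfin : J \is a fin_num by exact: integrable_fin_num.
have : (0 <= conj_int i f + push_int tau i f + J)%E.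
  rewrite icE iffE -integralD // -integralD //; last exact: integrableD.
  apply: integral_ge0 => -[w z] _ /=; rewrite -addeA -EFinD.
  have := conjugate_lb f z w; case: (conjugate f w) => [r| _|] //=.
    by rewrite lee_fin -EFinD lee_fin => ?; lra.
  by rewrite addye // leey.
move: cfin pfin Jfin; case: (conj_int _ _) => // a _; case: (push_int _ _ _) => // b _.
case: J => // r _; rewrite -!EFinN -!EFinD !lee_fin => ?; lra.
Qed.

End MarginalIntegrals.

(** * Quantile functions *)

Section Rays.
Context {R : realType}.
Local Notation Rm := (measurableTypeR R).

Lemma probability_rays (m1 m2 : probability Rm R) :
  (forall t : R, m1 `]-oo, t]%classic = m2 `]-oo, t]%classic) ->
  forall A : set Rm, measurable A -> m1 A = m2 A.
Proof.
move=> m12.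
pose g (n : nat) : set Rm := `](- (n%:R) : R), +oo[%classic.
move=> A mA; have Gm := @RGenOInfty.measurableE R.
apply: (@measure_unique _ R Rm (@RGenOInfty.G R) g Gm _ _ _ m1 m2) => //.
- move=> _ _ [s ->] [t ->]; exists (Num.max s t); apply/seteqP; split=> x /=;
    by rewrite !in_itv /= !andbT gt_max => /andP.
- by move=> n; exists (- n%:R).
- apply/seteqP; split=> // x _; exists (Num.truncn `|x|).+1 => //=.
  rewrite /g /= in_itv /= andbT ltrNl; apply: le_lt_trans (truncnS_gt _).
  by rewrite -normrN; exact: ler_norm.
- move=> _ [t ->].
  have -> : `]t, +oo[%classic = ~` `]-oo, t]%classic :> set Rm.
    by rewrite setCitvl.
  transitivity (1 - m1 `]-oo, t]%classic)%E; first exact: probability_setC.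
  by rewrite m12; apply/esym; exact: probability_setC.
- move=> n; apply: le_lt_trans (ltry 1); apply: probability_le1; exact: measurable_itv.
Qed.

Lemma uniform_ray (x : R) :
  uniform_prob (@ltr01 R) `]-oo, x]%classic = (Num.max 0 (Num.min x 1))%:E.
Proof.
rewrite /uniform_prob integral_uniform_pdf.
rewrite (eq_integral (fun=> 1%E)); last first.
  move=> y; rewrite inE => -[_]; rewrite /= in_itv /= /uniform_pdf => ->.
  by rewrite subr0 invr1.
rewrite integral_cst /= ?mul1e; last exact: measurableI.
have -> : `]-oo, x]%classic `&` `[0, 1]%classic = `[0, Num.min x 1]%classic :> set R.
  apply/seteqP; split=> y /=; rewrite !in_itv /= le_min.
    by move=> [-> /andP[-> ->]].
  by move=> /andP[-> /andP[-> ->]].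
rewrite lebesgue_measure_itv /= lte_fin.
by case: (ltP 0 (Num.min x 1)) => [?|?]; rewrite ?sube0.
Qed.

End Rays.

Section Quantile.
Context {R : realType} (D : problem R).
Hypothesis lohi : forall i : 'I_(ndim D), lo i <= hi i.
Hypothesis marg1 : forall i : 'I_(ndim D), marg i (Omega1 i) = 1%E.
Local Notation Rm := (measurableTypeR R).
Implicit Types (i : 'I_(ndim D)) (u v t : R).

Definition qtl_set i u : set R :=
  [set t : R | Omega1 i t /\ (u%:E <= marg i `[lo i, t]%classic)%E].

Lemma qtl_set_hi i u : u <= 1 -> qtl_set i u (hi i).
Proof.
by move=> u1; split; [rewrite /Omega1 /= in_itv /= lexx lohi | rewrite [marg _ _]marg1 lee_fin].
Qed.

Lemma qtl_set_lb i u : lbound (qtl_set i u) (lo i).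
Proof. by move=> t [+ _]; rewrite /Omega1 /= in_itv /= => /andP[]. Qed.

Lemma qtl_itv i u : u <= 1 -> lo i <= qtl i u <= hi i.
Proof.
move=> u1; apply/andP; split.
  by apply: lb_le_inf; [exists (hi i); exact: qtl_set_hi | exact: qtl_set_lb].
by apply: ge_inf; [exists (lo i); exact: qtl_set_lb | exact: qtl_set_hi].
Qed.

(** Galois connection of the quantile and the distribution function; it rests
    on the right continuity of the latter. *)
Lemma qtl_le i u t : u <= 1 -> Omega1 i t ->
  (qtl i u <= t) = (u%:E <= marg i `[lo i, t]%classic)%E.
Proof.
move=> u1 ti; apply/idP/idP => [qt|ut]; last first.
  by apply: ge_inf; [exists (lo i); exact: qtl_set_lb | split].
rewrite leNgt; apply/negP => tu.
pose S n : set Rm := `[lo i, t + n.+1%:R^-1]%classic.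
have SI : \bigcap_n S n = `[lo i, t]%classic.
  apply/seteqP; split=> x /=; last first.
    rewrite in_itv /= => /andP[lx xt] n _; rewrite /S /= in_itv /= lx /=.
    by rewrite (le_trans xt) // lerDl.
  move=> xS; rewrite in_itv /=; have := xS 0%N I; rewrite /S /= in_itv /= => /andP[-> _] /=.
  rewrite leNgt; apply/negP => tx.
  have xt0 : 0 < x - t by rewrite subr_gt0.
  have := xS (Num.truncn (x - t)^-1) I; rewrite /S /= in_itv /= => /andP[_].
  rewrite -lerBlDl leNgt => /negP; apply.
  rewrite invf_plt ?posrE //; exact: truncnS_gt.
have mS n : measurable (S n) by exact: measurable_itv.
have : (marg i \o S) n @[n --> \oo] --> marg i `[lo i, t]%classic.
  rewrite -SI; apply: nonincreasing_cvg_mu => //.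
  - by apply: le_lt_trans (ltry 1); apply: probability_le1.
  - by apply: bigcap_measurable.
  - move=> n m nm; apply/subsetPset => x; rewrite /S /= !in_itv /= => /andP[-> xm] /=.
    by apply: le_trans xm _; rewrite lerD2l lef_pV2 ?posrE // ler_nat.
move=> /(_ [set y | y < u%:E]%E) []; first exact: open_ereal_lt'.
move=> n _ /(_ n) /(_ (leqnn n)) /= Snu.
have : qtl i u < t + n.+1%:R^-1 by rewrite (le_lt_trans qt) // ltrDl.
case/inf_lt => [|s [si us] st]; first by exists (hi i); exact: qtl_set_hi.
move: Snu; rewrite ltNge => /negP; apply; apply: le_trans us _.
by apply: le_measure; rewrite ?inE //; move=> x /=; rewrite /S /= !in_itv /= => /andP[-> xs] /=; rewrite (le_trans xs) // ltW.
Qed.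

Lemma qtl_mono i u v : u <= v -> v <= 1 -> qtl i u <= qtl i v.
Proof.
move=> uv v1; have vi : Omega1 i (qtl i v) by rewrite /Omega1 /= in_itv /= qtl_itv.
rewrite qtl_le ?(le_trans uv) //; apply: (@le_trans _ _ v%:E); first by rewrite lee_fin.
by rewrite -qtl_le.
Qed.

(** Clamping the argument makes the quantile function monotone everywhere. *)
Lemma measurable_qtl i : measurable_fun setT (fun u : Rm => qtl i (Num.min u 1) : Rm).
Proof.
apply: nondecreasing_measurable => // u v uv; apply: qtl_mono; last by rewrite ge_min lexx orbT.
by rewrite le_min !ge_min uv lexx orbT.
Qed.

Lemma marg_ray i t : Omega1 i t -> marg i `]-oo, t]%classic = marg i `[lo i, t]%classic.
Proof.
move=> ti; have mO := @measurable_Omega1 R D i.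
have -> : marg i `]-oo, t]%classic =
    (marg i (`]-oo, t]%classic `\` Omega1 i) + marg i (`]-oo, t]%classic `&` Omega1 i))%E.
  by apply: measureDI => //; exact: measurable_itv.
have -> : marg i (`]-oo, t]%classic `\` Omega1 i) = 0%E.
  apply/eqP; rewrite -measure_le0 -(prob_compl0 mO (marg1 i)).
  apply: le_measure; rewrite ?inE; [exact: measurableD | exact: measurableC |].
  by move=> x [].
rewrite add0e; congr (marg i _); apply/seteqP; split=> x /=; move: ti; rewrite /Omega1 /= !in_itv /=.
  by move=> _ [-> /andP[->]].
by move=> /andP[_ th] /andP[-> xt]; split => //; rewrite (le_trans xt).
Qed.

(** By [qtl_le], the quantile of [Z] is at most [t] exactly when the uniform
    variable [Z] is at most the mass up to [t]. *)
Lemma qtl_law i d (T : measurableType d) (P : probability T R) (Z : T -> R) :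
  measurable_fun setT (Z : T -> Rm) -> (forall s, 0 <= Z s <= 1) ->
  (forall c, 0 <= c <= 1 -> P (Z @^-1` `]-oo, c]%classic) = c%:E) ->
  forall B : set Rm, measurable B -> P ((qtl i \o Z) @^-1` B) = marg i B.
Proof.
move=> mZ Z01 cdfZ B mB.
have mY : measurable_fun setT (qtl i \o Z : T -> Rm).
  have -> : qtl i \o Z = (fun u => qtl i (Num.min u 1)) \o Z.
    by apply/funext => s /=; rewrite min_l //; case/andP: (Z01 s).
  by apply: measurableT_comp => //; exact: measurable_qtl.
pose mixin := isMeasurableFun.Build _ _ _ _ (qtl i \o Z : T -> Rm) mY.
pose Y : {mfun T >-> Rm} := HB.pack (qtl i \o Z : T -> Rm) mixin.
apply: (@probability_rays R (distribution P Y) (marg i) _ B mB) => t.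
change (P ((qtl i \o Z) @^-1` `]-oo, t]%classic) = marg i `]-oo, t]%classic).
have Yi s : lo i <= qtl i (Z s) <= hi i by rewrite qtl_itv //; case/andP: (Z01 s).
have [tlo|lot] := ltP t (lo i).
  have -> : (qtl i \o Z) @^-1` `]-oo, t]%classic = set0.
    apply/seteqP; split=> // s /=; rewrite in_itv /= => st.
    by have /andP[+ _] := Yi s; rewrite leNgt (le_lt_trans st).
  rewrite measure0; apply/esym/eqP; rewrite -measure_le0.
  rewrite -(prob_compl0 (@measurable_Omega1 R D i) (marg1 i)).
  apply: le_measure; rewrite ?inE; [exact: measurable_itv | by apply: measurableC; exact: measurable_Omega1 |].
  move=> x /=; rewrite /Omega1 /= !in_itv /= => xt /andP[lx _].
  by move: (le_lt_trans (le_trans lx xt) tlo); rewrite ltxx.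
have [hit|thi] := leP (hi i) t.
  have -> : (qtl i \o Z) @^-1` `]-oo, t]%classic = setT.
    apply/seteqP; split=> // s _ /=; rewrite in_itv /=.
    by have /andP[_ h] := Yi s; rewrite (le_trans h).
  rewrite probability_setT; apply/esym/eqP; rewrite eq_le probability_le1 //= -(marg1 i).
  apply: le_measure; rewrite ?inE; [exact: measurable_Omega1 | exact: measurable_itv |].
  by move=> x /=; rewrite /Omega1 /= !in_itv /= => /andP[_ xh]; rewrite (le_trans xh).
have ti : Omega1 i t by rewrite /Omega1 /= in_itv /= lot ltW.
rewrite marg_ray // -[RHS]fineK ?fin_num_measure //.
rewrite -cdfZ; last by rewrite fine_ge0 // -lee_fin fineK ?fin_num_measure // probability_le1.
congr (P _); apply/seteqP; split=> s /=; rewrite !in_itv /= qtl_le //; try by case/andP: (Z01 s).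
  by rewrite -lee_fin fineK // fin_num_measure.
by rewrite -lee_fin fineK // fin_num_measure.
Qed.

End Quantile.

(** * The functions attached to a discrete law *)

Section Fstar.
Context {R : realType} (D : problem R).
Hypothesis lohi : forall i : 'I_(ndim D), lo i <= hi i.
Hypothesis marg1 : forall i : 'I_(ndim D), marg i (Omega1 i) = 1%E.
Local Notation vecl := 'cV[R]_(m_in D + m_eq D).
Local Notation law := (probability (borel_cV R (m_in D + m_eq D)) R).
Local Notation Rm := (measurableTypeR R).
Implicit Types (i : 'I_(ndim D)) (V : {fset vecl}) (tau : law).

Definition mass tau i (t : R) : R := fine (push tau i `]-oo, t]%classic).

Lemma mass01 tau i t : 0 <= mass tau i t <= 1.
Proof.
rewrite /mass -push_lawE fine_ge0 //= -lee_fin fineK ?fin_num_measure //.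
exact: probability_le1.
Qed.

Lemma mass_mono tau i s t : s <= t -> mass tau i s <= mass tau i t.
Proof.
move=> st; rewrite /mass -!push_lawE fine_le ?fin_num_measure //.
by apply: le_measure; rewrite ?inE // => x /=; rewrite !in_itv /= => /le_trans; apply.
Qed.

Lemma kappas_sorted V i : sorted <=%R (kappas V i).
Proof. exact: sort_le_sorted. Qed.

Lemma kappas_uniq V i : uniq (kappas V i).
Proof. by rewrite sort_uniq undup_uniq. Qed.

Lemma mem_kappas V i l : l \in V -> dot (vecp i) l \in kappas V i.
Proof. by move=> lV; rewrite mem_sort mem_undup; apply/mapP; exists l. Qed.

Lemma kappas_gt0 V i l : l \in V -> (0 < size (kappas V i))%N.
Proof. by move/(mem_kappas i); case: (kappas V i). Qed.

Definition fstar_slope tau i t : R := qtl i (mass tau i t).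

Lemma fstar_slope_mono tau i (s : seq R) :
  {in s &, {homo fstar_slope tau i : x y / x <= y}}.
Proof.
move=> x y _ _ xy; apply: qtl_mono => //; first exact: mass_mono.
by case/andP: (mass01 tau i y).
Qed.

Lemma fstar_slope_itv tau i (s : seq R) :
  {in s, forall x, lo i <= fstar_slope tau i x <= hi i}.
Proof. by move=> x _; apply: qtl_itv => //; case/andP: (mass01 tau i x). Qed.

(** The recursive definition is matched with the sum of hinges, whose slope
    increments are visibly nonnegative. *)
Lemma fstarE V tau i l z : l \in V ->
  fstar V tau i z = pwa (fstar_slope tau i) (lo i) (hi i) (kappas V i) z.
Proof.
move=> /(kappas_gt0 i); rewrite /fstar /pwa; have := kappas_sorted V i.
case: (kappas V i) => // k ks /= kks _; case: leP => [zk|kz].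
  rewrite big1 ?addr0; first by ring.
  move=> j _; rewrite pos_eq0 ?mulr0 // subr_le0 (le_trans zk) //.
  have /allP kmin := order_path_min le_trans kks.
  have /[!inE] : (k :: ks)`_j \in k :: ks by apply: mem_nth.
  by case/predU1P => [->//|/kmin].
rewrite (@pwa_rightE _ _ _ (lo i)) ?(ltW kz) // add0r.
by congr (_ + _); ring.
Qed.

Lemma fstar_hinge V tau i l : l \in V ->
  hinge (lo i) (hi i) (kappas V i) (fstar V tau i).
Proof.
move=> lV.
have -> : fstar V tau i = pwa (fstar_slope tau i) (lo i) (hi i) (kappas V i).
  by apply/funext => z; exact: fstarE lV.
apply: pwa_hinge => //; [exact: kappas_sorted | exact: fstar_slope_mono |
  exact: fstar_slope_itv | exact: kappas_gt0 lV].
Qed.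

(** The optimality condition of the transport problem: the slopes of [fstar]
    on both sides of a breakpoint are the quantiles of the mass strictly below
    it and of the mass up to it. *)
Lemma fstar_subgradient V tau i l (w u : R) : l \in V -> w = qtl i u -> u <= 1 ->
  (forall l', l' \in V -> dot (vecp i) l' < dot (vecp i) l ->
     mass tau i (dot (vecp i) l') <= u) ->
  u <= mass tau i (dot (vecp i) l) ->
  forall z, w * z - fstar V tau i z <=
    w * dot (vecp i) l - fstar V tau i (dot (vecp i) l).
Proof.
move=> lV -> u1 below above z.
have kl := mem_kappas i lV; rewrite !(fstarE _ _ _ lV).
set s := kappas V i; pose a := index (dot (vecp i) l) s.
have as_ : (a < size s)%N by rewrite index_mem.
have sa : s`_a = dot (vecp i) l by rewrite nth_index.
have /andP[qlo qhi] := qtl_itv lohi marg1 i u1.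
rewrite -sa; apply: pwa_subgradient => //; [exact: kappas_sorted |
  exact: fstar_slope_mono | exact: fstar_slope_itv |].
have m1 t : mass tau i t <= 1 by case/andP: (mass01 tau i t).
rewrite /pwa_slope; apply/andP; split; last first.
  by case: eqP => // _; rewrite sa; apply: qtl_mono.
case: a as_ sa => [|b] bs sb //; rewrite (ltn_eqF bs); apply: qtl_mono => //.
have /mem_nth - /(_ 0) := ltnW bs; rewrite mem_sort mem_undup => /mapP[l' l'V E].
rewrite E; apply: below => //; rewrite -E -sb lt_neqAle.
rewrite nth_uniq ?kappas_uniq ?(ltnW bs) // ltn_eqF //=.
by apply: (sorted_leq_nth le_trans le_refl 0 (kappas_sorted V i)); rewrite ?inE // ltnW.
Qed.

End Fstar.

(** * The random vector built from quantiles *)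

Section Coupling.
Context {R : realType} (D : problem R).
Hypothesis lohi : forall i : 'I_(ndim D), lo i <= hi i.
Hypothesis marg1 : forall i : 'I_(ndim D), marg i (Omega1 i) = 1%E.
Local Notation d := (ndim D).
Local Notation vecl := 'cV[R]_(m_in D + m_eq D).
Local Notation law := (probability (borel_cV R (m_in D + m_eq D)) R).
Local Notation law_omega := (probability (borel_cV R d) R).
Local Notation Rm := (measurableTypeR R).

Lemma measurable_Omega : measurable (@Omega R D : set (borel_cV R d)).
Proof.
have -> : @Omega R D = \bigcap_(i in [set: 'I_d]) ((fun v => v i 0) @^-1` Omega1 i).
  by apply/seteqP; split=> v /= h i; [move=> _; exact: h | exact: h].
apply: fin_bigcap_measurable => // i _; rewrite -[X in measurable X]setTI.
by apply: measurable_coord => //; exact: measurable_Omega1.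
Qed.

Lemma dot_matP (v : 'cV[R]_d) (l : vecl) :
  dot (matP D *m v) l = \sum_i v i 0 * dot (vecp i) l.
Proof.
rewrite dot_mulmxl; apply: eq_bigr => i _; congr (_ * _).
by rewrite mxE; apply: eq_bigr => k _; rewrite !mxE.
Qed.

Lemma dot_cost x (v : 'cV[R]_d) (l : vecl) :
  dot (matQ D *m x + matP D *m v + vecb D) l =
  dot (matQ D *m x + vecb D) l + \sum_i v i 0 * dot (vecp i) l.
Proof. by rewrite addrAC dotDl dot_matP. Qed.

Lemma measurable_C2 x : measurable_fun setT (C2 x : borel_cV R d -> \bar R).
Proof.
have cg l : continuous (fun v : 'cV[R]_d => dot (matQ D *m x + matP D *m v + vecb D) l).
  have -> : (fun v => dot (matQ D *m x + matP D *m v + vecb D) l) =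
      (fun v => dot (matQ D *m x + vecb D) l + dot ((matP D)^T *m l) v).
    by apply/funext => v; rewrite addrAC dotDl dot_mulmxl [dot v _]dotC.
  by apply: continuous_addc; exact: continuous_dot.
exact: (measurable_ereal_sup_cV (S2 (D := D)) cg).
Qed.

(** The expected cost is a sum over coordinates, so that it depends on the laws of
    the pairs [(J, U i)] alone. Recording just these laws lets the same lemmas
    apply to a given sample and to one built with equal variables [U i]. *)
Record coupling (V : {fset vecl}) (w : vecl -> R) dT (T : measurableType dT)
    (Pr : probability T R) (lam : 'I_(#|` V|) -> vecl)
    (sigma : 'I_d -> {perm 'I_(#|` V|)}) (J : T -> 'I_(#|` V|))
    (U : 'I_d -> T -> R) : Prop := {
  cp_inj : injective lam;
  cp_mem : forall l, l \in V <-> exists j, lam j = l;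
  cp_sorted : forall i (j j' : 'I_(#|` V|)), (j <= j')%N ->
    dot (vecp i) (lam (sigma i j)) <= dot (vecp i) (lam (sigma i j'));
  cp_mJ : forall j, measurable (J @^-1` [set j]);
  cp_mU : forall i, measurable_fun setT (U i : T -> Rm);
  cp_mass : forall j, Pr (J @^-1` [set j]) = (w (lam j))%:E;
  cp_U01 : forall i s, 0 <= U i s <= 1;
  cp_law : forall i j (B : set Rm), measurable B ->
    Pr (J @^-1` [set j] `&` U i @^-1` B) = ((w (lam j))%:E * uniform_prob (@ltr01 R) B)%E
}.

Variables (V : {fset vecl}) (w : vecl -> R) (tau : law).
Hypothesis w0 : forall l, l \in V -> 0 <= w l.
Hypothesis w1 : \sum_(l <- V) w l = 1.
Hypothesis dtau : discrete_law V w tau.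
Variables (dT : measure_display) (T : measurableType dT) (Pr : probability T R).
Variables (lam : 'I_(#|` V|) -> vecl) (sigma : 'I_d -> {perm 'I_(#|` V|)}).
Variables (J : T -> 'I_(#|` V|)) (U : 'I_d -> T -> R).
Hypothesis cp : coupling w Pr lam sigma J U.
Local Notation K := (#|` V|).
Implicit Types (i : 'I_d) (j : 'I_K) (s : T).

Lemma lamV j : lam j \in V.
Proof. by apply/(cp_mem cp); exists j. Qed.

Lemma sum_lam (E : nmodType) (F : vecl -> E) : \sum_(l <- V) F l = \sum_j F (lam j).
Proof.
have -> : \sum_j F (lam j) = \sum_(l <- [seq lam j | j <- enum 'I_K]) F l.
  by rewrite big_map big_enum.
apply: perm_big; apply: uniq_perm; first exact: fset_uniq.
  by rewrite map_inj_uniq ?enum_uniq //; exact: cp_inj cp.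
move=> l; apply/idP/mapP => [/(cp_mem cp)[j <-]|[j _ ->]]; last exact: lamV.
by exists j => //; rewrite mem_enum.
Qed.

Let p i j := dot (vecp i) (lam j).
Let wj j := w (lam j).
Let wj0 j : 0 <= wj j. Proof. exact: w0 (lamV j). Qed.

Definition rankV i j : 'I_K := ((sigma i)^-1)%g j.
Definition cumul i j : R := \sum_(k < K | (k < rankV i j)%N) wj (sigma i k).
Definition level i s : R := U i s * wj (J s) + cumul i (J s).
Definition rvY s : 'cV[R]_d := \col_i qtl i (level i s).

Lemma sigma_rank i j : sigma i (rankV i j) = j.
Proof. by rewrite permKV. Qed.

Lemma mass_lam i t : mass tau i t = \sum_(j | p i j <= t) wj j.
Proof.
rewrite /mass /push /pushforward dtau; last first.
  by rewrite -[X in measurable X]setTI; apply: measurable_dot => //; exact: measurable_itv.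
rewrite sum_lam [RHS]big_mkcond /=.
rewrite (eq_bigr (fun j => (if p i j <= t then wj j else 0)%:E)) ?sumEFin //.
move=> j _; rewrite diracE; case: ifP => pj.
  by rewrite mem_set ?mule1 //= in_itv.
by rewrite memNset ?mule0 //= in_itv /= pj.
Qed.

Lemma sum_sigma i (P : pred 'I_K) (F : 'I_K -> R) :
  \sum_(j | P j) F j = \sum_(k | P (sigma i k)) F (sigma i k).
Proof. by rewrite (reindex_inj (@perm_inj _ (sigma i))). Qed.

(** With [mass_le_level], this places [level i s] between the masses strictly
    below and up to the value of [p i] at the drawn point, as the optimality
    condition [fstar_subgradient] demands. *)
Lemma level_le_mass i s : level i s <= mass tau i (p i (J s)).
Proof.
have /andP[U0 U1] := cp_U01 cp i s.
rewrite mass_lam (sum_sigma i) /=; set r := rankV i (J s).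
apply: (@le_trans _ _ (\sum_(k < K | (k <= r)%N) wj (sigma i k))).
  rewrite (bigD1 r) //= sigma_rank /level lerD //; first by rewrite ler_piMl.
  rewrite /cumul -/r le_eqVlt; apply/orP; left; apply/eqP.
  by apply: eq_bigl => k; rewrite ltn_neqAle andbC.
rewrite [leRHS](bigID (fun k : 'I_K => (k <= r)%N)) /=.
rewrite (eq_bigl (fun k : 'I_K => (p i (sigma i k) <= p i (J s)) && (k <= r)%N)).
  by rewrite lerDl sumr_ge0.
move=> k; case: leqP => kr; rewrite ?andbF // andbT.
by rewrite -[J s in RHS](sigma_rank i) (cp_sorted cp).
Qed.

Lemma mass_le_level i s t : t < p i (J s) -> mass tau i t <= level i s.
Proof.
move=> tp; have /andP[U0 U1] := cp_U01 cp i s.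
rewrite mass_lam (sum_sigma i) /= /level ler_wpDl ?mulr_ge0 //.
rewrite /cumul [leRHS](bigID (fun k => p i (sigma i k) <= t)) /=.
rewrite (eq_bigl (fun k : 'I_K => (k < rankV i (J s))%N && (p i (sigma i k) <= t))).
  by rewrite lerDl sumr_ge0.
move=> k; case: (ltnP k) => //= rk; apply/negbTE; rewrite -ltNge.
by apply: lt_le_trans tp _; rewrite -{1}[J s](sigma_rank i) (cp_sorted cp).
Qed.

Lemma level01 i s : 0 <= level i s <= 1.
Proof.
have /andP[U0 U1] := cp_U01 cp i s.
apply/andP; split; first by rewrite addr_ge0 ?mulr_ge0 // sumr_ge0.
apply: le_trans (level_le_mass i s) _.
by case/andP: (mass01 tau i (p i (J s))).
Qed.

Lemma measurable_level i : measurable_fun setT (level i : T -> Rm).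
Proof.
have -> : level i = fun s => \sum_j \1_(J @^-1` [set j]) s * (U i s * wj j + cumul i j).
  apply/funext => s; rewrite (bigD1 (J s)) //= indicE mem_set //= mul1r big1 ?addr0 // => j jJ.
  by rewrite indicE memNset ?mul0r //= => E; rewrite E eqxx in jJ.
apply: measurable_fun_rsum => j; apply: measurable_funM.
  exact/measurable_indic/(cp_mJ cp).
apply: measurable_funD; last exact: measurable_cst.
by apply: measurable_funM; [exact: cp_mU cp i | exact: measurable_cst].
Qed.

Lemma coupling_partition (A : set T) : measurable A ->
  Pr A = (\sum_j Pr (J @^-1` [set j] `&` A))%E.
Proof.
move=> mA; rewrite -measure_bigsetU_ord //=; first last.
- apply/trivIsetP => j j' _ _ jj'; apply/seteqP; split=> // s [[/= Ej _] [/= Ej' _]].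
  by move: jj'; rewrite -Ej -Ej' eqxx.
- by move=> j; apply: measurableI => //; exact: cp_mJ cp j.
congr (Pr _); rewrite -bigcup_seq; apply/seteqP; split=> [s As|s [j _ []//]].
by exists (J s) => //=; rewrite mem_index_enum.
Qed.

(** The variable [U w_J + cumul] sweeps the unit interval: its mass below [c]
    telescopes along the sorted atoms. *)
Lemma level_cdf i c : 0 <= c <= 1 -> Pr (level i @^-1` `]-oo, c]%classic) = c%:E.
Proof.
move=> /andP[c0 c1].
pose S k : R := \sum_(k' < K | (k' < k)%N) wj (sigma i k').
have SS (k : 'I_K) : S k.+1 = S k + wj (sigma i k).
  rewrite /S (bigD1 k) //= addrC; congr (_ + _); apply: eq_bigl => k'.
  by rewrite ltnS ltn_neqAle andbC.
have SK : S K = 1.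
  rewrite /S (eq_bigl predT); last by move=> k; rewrite ltn_ord.
  by rewrite -(sum_sigma i predT) -w1 sum_lam.
have S0 : S 0%N = 0 by rewrite /S big_pred0.
have mA : measurable (level i @^-1` `]-oo, c]%classic).
  by rewrite -[X in measurable X]setTI; apply: measurable_level => //; exact: measurable_itv.
rewrite coupling_partition //.
have piece (k : 'I_K) :
    Pr (J @^-1` [set sigma i k] `&` level i @^-1` `]-oo, c]%classic) =
    (Num.min c (S k.+1) - Num.min c (S k))%:E.
  have cE : cumul i (sigma i k) = S k by rewrite /cumul /rankV permK.
  rewrite SS; have wk := wj0 (sigma i k).
  have [wk0|wk1] := eqVneq (wj (sigma i k)) 0.
    rewrite wk0 addr0 subrr; apply/eqP; rewrite -measure_le0.
    have := cp_law cp i (sigma i k) measurableT; rewrite -/(wj _) wk0 mul0e => E0.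
    rewrite -E0 preimage_setT setIT; apply: le_measure; rewrite ?inE.
    - by apply: measurableI => //; exact: cp_mJ cp _.
    - exact: cp_mJ cp _.
    - by move=> s [].
  have {}wk1 : 0 < wj (sigma i k) by rewrite lt_neqAle eq_sym wk1.
  have -> : J @^-1` [set sigma i k] `&` level i @^-1` `]-oo, c]%classic =
      J @^-1` [set sigma i k] `&` U i @^-1` `]-oo, (c - S k) / wj (sigma i k)]%classic.
    apply/seteqP; split=> s [/= Js]; rewrite !in_itv /= /level Js cE => h; split => //.
      by rewrite ler_pdivlMr //; lra.
    by move: h; rewrite ler_pdivlMr // => ?; lra.
  rewrite (cp_law cp); last exact: measurable_itv.
  rewrite uniform_ray -EFinM -/(wj _); congr EFin.
  set y := (c - S k) / _; have yE : y * wj (sigma i k) = c - S k.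
    by rewrite divfK // gt_eqF.
  have -> : wj (sigma i k) * Num.max 0 (Num.min y 1) =
      Num.max 0 (Num.min (c - S k) (wj (sigma i k))).
    by rewrite mulrC maxr_pMl // minr_pMl // mul0r mul1r yE.
  case: (leP c (S k)); case: (leP c (S k + _)); case: (leP (c - S k) _);
    case: (leP 0 _) => *; lra.
rewrite (reindex_inj (@perm_inj _ (sigma i))) /=.
rewrite (eq_bigr (fun k : 'I_K => (Num.min c (S k.+1) - Num.min c (S k))%:E)); last first.
  by move=> k _; exact: piece.
rewrite sumEFin -(big_mkord predT (fun k => Num.min c (S k.+1) - Num.min c (S k))).
by rewrite telescope_sumr // SK S0 min_l // min_r // subr0.
Qed.


Lemma rvYE i s : rvY s i 0 = qtl i (level i s).
Proof. by rewrite mxE. Qed.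

Lemma rvY_Omega s : Omega (rvY s).
Proof.
move=> i; rewrite /Omega1 /= in_itv /= rvYE; apply: qtl_itv => //.
by case/andP: (level01 i s).
Qed.

Lemma measurable_rvY_coord i : measurable_fun setT (fun s => rvY s i 0 : Rm).
Proof.
have -> : (fun s => rvY s i 0) = (fun u => qtl i (Num.min u 1)) \o level i.
  apply/funext => s /=; rewrite rvYE min_l //.
  by case/andP: (level01 i s).
by apply: measurableT_comp; [exact: measurable_qtl | exact: measurable_level].
Qed.

Lemma measurable_rvY : measurable_fun setT (rvY : T -> borel_cV R d).
Proof. by apply: measurable_fun_cV => i; exact: measurable_rvY_coord. Qed.

Lemma rvY_law i (B : set Rm) : measurable B ->
  Pr ((fun s => rvY s i 0) @^-1` B) = marg i B.
Proof.
move=> mB; have -> : (fun s => rvY s i 0) = qtl i \o level i.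
  by apply/funext => s; rewrite rvYE.
apply: qtl_law => //; [exact: measurable_level | exact: level01 | exact: level_cdf].
Qed.

Lemma cp_PrJ j : Pr (J @^-1` [set j]) = (wj j)%:E.
Proof. exact: cp_mass cp j. Qed.

Definition rvL s : vecl := lam (J s).

Lemma measurable_rvL : measurable_fun setT (rvL : T -> borel_cV R _).
Proof.
move=> _ A mA; rewrite setTI.
have -> : rvL @^-1` A = \bigcup_(j in [set j | A (lam j)]) (J @^-1` [set j]).
  by apply/seteqP; split=> [s As|s [j Aj /= Js]]; [exists (J s) | rewrite /rvL Js].
by apply: fin_bigcup_measurable => // j _; exact: cp_mJ cp j.
Qed.

Lemma rvL_law (A : set (borel_cV R _)) : measurable A -> tau A = Pr (rvL @^-1` A).
Proof.
move=> mA; rewrite dtau // coupling_partition; last first.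
  by rewrite -[X in measurable X]setTI; exact: measurable_rvL.
rewrite sum_lam; apply: eq_bigr => j _; rewrite diracE.
have [Aj|Aj] := pselect (A (lam j)).
  rewrite mem_set // mule1 -cp_PrJ; congr (Pr _).
  by apply/seteqP; split=> [s /= Js|s []//]; split => //; rewrite /rvL /= Js.
rewrite memNset // mule0 (_ : _ `&` _ = set0) ?measure0 //.
by apply/seteqP; split=> // s [/= Js]; rewrite /rvL Js.
Qed.

Local Notation f i := (fstar V tau i).

Lemma fstar_V_hinge i : hinge (lo i) (hi i) (kappas V i) (f i).
Proof.
have [l lV] : exists l, l \in V.
  apply: contrapT => nV; have := w1; rewrite big_seq big1 => [/esym/eqP|l lV].
    by rewrite oner_eq0.
  by case: nV; exists l.
exact: fstar_hinge lV.
Qed.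

Lemma fstar_conj_ok i : conj_ok i (f i).
Proof. exact: hinge_conj_bounded (fstar_V_hinge i). Qed.

Lemma measurable_fstar i : measurable_fun setT (f i : Rm -> Rm).
Proof. by apply: continuous_measurable_fun; case: (hinge_C_cvx (fstar_V_hinge i)). Qed.

(** [rvY s] is a subgradient at the drawn point, which is the case of equality in
    the inequality between a function and its conjugate. *)
Lemma fstar_conj_rvY i s : conjugate (f i) (rvY s i 0) =
  (rvY s i 0 * p i (J s) - f i (p i (J s)))%:E.
Proof.
have sub z : rvY s i 0 * z - f i z <= rvY s i 0 * p i (J s) - f i (p i (J s)).
  apply: (@fstar_subgradient R D lohi marg1 V tau i (lam (J s)) _ (level i s)).
  - exact: lamV.
  - exact: rvYE.
  - by case/andP: (level01 i s).
  - by move=> l' _; exact: mass_le_level.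
  - exact: level_le_mass.
apply/eqP; rewrite eq_le; apply/andP; split.
  by apply: conjugate_le => z; rewrite mulrC.
by rewrite [rvY s i 0 * _]mulrC; exact: conjugate_lb.
Qed.

Lemma rv_bound i : exists M : R, forall s, `|rvY s i 0 * p i (J s)| <= M.
Proof.
exists ((`|lo i| + `|hi i|) * \sum_j `|p i j|) => s; rewrite normrM.
apply: ler_pM => //; last by rewrite (bigD1 (J s)) //= lerDl sumr_ge0.
have := rvY_Omega s i; rewrite /Omega1 /= in_itv /= => /andP[lw wh].
have := ler_norm (- lo i); have := ler_norm (hi i); rewrite normrN.
have := normr_ge0 (lo i); have := normr_ge0 (hi i) => *.
by rewrite ler_norml; apply/andP; split; lra.
Qed.

Lemma measurable_rvp i : measurable_fun setT (fun s => p i (J s) : Rm).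
Proof. by apply: (measurableT_comp (measurable_dot (vecp i)) measurable_rvL). Qed.

Lemma rv_integrable i : Pr.-integrable setT (fun s => (rvY s i 0 * p i (J s))%:E).
Proof.
have [M bM] := rv_bound i; apply: (@integrable_bounded _ _ _ _ _ _ M) => //.
by apply: measurable_funM; [exact: measurable_rvY_coord | exact: measurable_rvp].
Qed.

Lemma integral_rvL (h : vecl -> R) :
  measurable_fun setT (h : borel_cV R _ -> Rm) ->
  Pr.-integrable setT (fun s => (h (rvL s))%:E) /\
  (\int[Pr]_s (h (rvL s))%:E = (\sum_(l <- V) w l * h l)%:E)%E.
Proof.
move=> mh; have mhE : measurable_fun setT (EFin \o h : borel_cV R _ -> \bar R).
  exact/measurable_EFinP.
have inth := integrable_discrete w0 dtau mh.
have intr : Pr.-integrable setT (fun s => (h (rvL s))%:E).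
  by move/(integrable_transfer measurable_rvL rvL_law measurableT mhE): inth.
split => //; rewrite -(integral_discrete w0 dtau mh).
by rewrite (integral_transfer measurable_rvL rvL_law measurableT mhE) // preimage_setT.
Qed.

(** The equality of [fstar_conj_rvY], integrated. *)
Lemma coupling_value i : (\int[Pr]_s (rvY s i 0 * p i (J s))%:E =
  conj_int i (f i) + push_int tau i (f i))%E.
Proof.
have mY := measurable_rvY_coord i.
have mO := @measurable_Omega1 R D i.
have mc := measurable_conjugate (f i).
have YO : (fun s => rvY s i 0) @^-1` Omega1 i = setT.
  by apply/seteqP; split=> // s _; exact: rvY_Omega.
have law B : measurable B -> marg i B = Pr ((fun s => rvY s i 0) @^-1` B).
  by move=> mB; rewrite rvY_law.
have [ip pE] := integral_rvL (measurableT_comp (measurable_fstar i) (measurable_dot (vecp i))).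
have -> : push_int tau i (f i) = (\int[Pr]_s (f i (p i (J s)))%:E)%E.
  rewrite pE push_intE; [|exact: measurable_fstar|]; last first.
    apply: (integrable_discrete w0 dtau).
    exact: (measurableT_comp (measurable_fstar i) (measurable_dot (vecp i))).
  rewrite (integral_discrete w0 dtau) //.
  exact: (measurableT_comp (measurable_fstar i) (measurable_dot (vecp i))).
have ic : Pr.-integrable setT (conjugate (f i) \o (fun s => rvY s i 0)).
  by rewrite -YO; apply/(integrable_transfer mY law mO mc)/conj_integrable/fstar_conj_ok.
have -> : conj_int i (f i) = (\int[Pr]_s conjugate (f i) (rvY s i 0)%R)%E.
  by rewrite /conj_int (integral_transfer mY law mO mc) YO.
rewrite -integralD //; apply: eq_integral => s _.
by rewrite fstar_conj_rvY -EFinD subrK.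
Qed.

Lemma integrable_fstar i (h : R -> R) : measurable_fun setT (h : Rm -> Rm) ->
  tau.-integrable setT (EFin \o (h \o dot (vecp i))).
Proof.
move=> mh; apply: (integrable_discrete w0 dtau).
exact: (measurableT_comp mh (measurable_dot (vecp i))).
Qed.

Lemma push_fstar_fin i : push_int tau i (f i) \is a fin_num.
Proof.
have intf := integrable_fstar i (measurable_fstar i).
rewrite (push_intE (measurable_fstar i) intf).
exact: (integrable_fin_num _ intf).
Qed.

(** The joint law of [rvY] and the drawn point attains the bound of [OT_weak]. *)
Lemma OT_discrete i : OT i (push tau i) = (- conj_int i (f i) - push_int tau i (f i))%E.
Proof.
apply/eqP; rewrite eq_le; apply/andP; split; last first.
  apply: (OT_weak marg1 (measurable_fstar i)).
    exact: (@integrable_fstar i id (@measurable_id _ _ _)).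
  exact: (integrable_fstar i (measurable_fstar i)).
have cfin : conj_int i (f i) \is a fin_num by apply: conj_int_fin; exact: fstar_conj_ok.
have -> : (- conj_int i (f i) - push_int tau i (f i) =
    \int[Pr]_s (- (p i (J s) * rvY s i 0))%:E)%E.
  rewrite -fin_num_oppeD ?push_fstar_fin //.
  rewrite -coupling_value -integralN; last first.
    exact: (integrable_add_def measurableT (rv_integrable i)).
  by apply: eq_integral => s _; rewrite mulrC.
pose YZ s : Rm * Rm := (rvY s i 0, p i (J s)).
have mYZ : measurable_fun setT YZ.
  by apply: measurable_fun_pair; [exact: measurable_rvY_coord | exact: measurable_rvp].
pose mixin := isMeasurableFun.Build _ _ _ _ YZ mYZ.
pose X : {mfun T >-> (Rm * Rm)%type} := HB.pack YZ mixin.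
apply: ereal_inf_lbound; exists (distribution Pr X).
  move=> B mB; split; first exact: rvY_law.
  rewrite /push /pushforward rvL_law //.
  by rewrite -[X in measurable X]setTI; apply: measurable_dot.
have mE : measurable (Omega1 i `*` [set: R] : set (Rm * Rm)%type).
  by apply: measurableX => //; exact: measurable_Omega1.
have preE : X @^-1` (Omega1 i `*` [set: R]) = setT.
  by apply/seteqP; split=> // s _; split => //; exact: rvY_Omega.
have mprod : measurable_fun setT (fun x : Rm * Rm => (- ((x.2 : R) * (x.1 : R)))%:E).
  apply/measurable_EFinP; apply: measurable_funN.
  by apply: measurable_funM; [exact: measurable_snd | exact: measurable_fst].
have lawX B : measurable B -> distribution Pr X B = Pr (YZ @^-1` B) by [].
rewrite (integral_transfer mYZ lawX mE mprod); first by rewrite preE.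
rewrite preE; apply: (eq_integrable measurableT _ _ _ (integrableN (rv_integrable i))) => s _ /=.
by rewrite mulrC.
Qed.


Lemma coupling_Gamma (mu : law_omega) :
  (forall A : set (borel_cV R d), measurable A -> mu A = Pr (rvY @^-1` A)) ->
  Gamma D mu.
Proof.
move=> muE; split.
  rewrite /probs_on /= muE; last exact: measurable_Omega.
  rewrite (_ : _ @^-1` _ = setT) ?probability_setT //.
  by apply/seteqP; split=> // s _; exact: rvY_Omega.
move=> i B mB; rewrite muE; first exact: rvY_law.
by rewrite -[X in measurable X]setTI; apply: measurable_coord.
Qed.

(** The second-stage cost at [rvY] is at least the cost of the multiplier [rvL]
    drawn together with it, whose expectation is known from [coupling_value]. *)
Lemma coupling_inner_obj (mu : law_omega) x (M : R) :
  (forall A : set (borel_cV R d), measurable A -> mu A = Pr (rvY @^-1` A)) ->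
  (forall l, l \in V -> S2 l) ->
  (forall v, Omega v -> (C2 x v <= M%:E)%E) ->
  ((\sum_(l <- V) w l * dot (matQ D *m x + vecb D) l)%:E
     - \sum_i OT i (push tau i) <= inner_obj x mu)%E.
Proof.
move=> muE VS CM; have mOm := measurable_Omega; have mC := measurable_C2 x.
have YO : rvY @^-1` (@Omega R D) = setT.
  by apply/seteqP; split=> // s _; exact: rvY_Omega.
have [iL LE] := integral_rvL (measurable_dot (matQ D *m x + vecb D)).
pose h s := dot (matQ D *m x + vecb D) (rvL s) + \sum_i rvY s i 0 * p i (J s).
have hC s : ((h s)%:E <= C2 x (rvY s))%E.
  apply: ereal_sup_ubound; exists (rvL s); first exact/VS/lamV.
  by rewrite dot_cost.
have hE : (fun s => (h s)%:E) = (fun s => (dot (matQ D *m x + vecb D) (rvL s))%:E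
    + \sum_i (rvY s i 0 * p i (J s))%:E)%E.
  by apply/funext => s; rewrite sumEFin -EFinD.
have isum : Pr.-integrable setT (fun s => \sum_i (rvY s i 0 * p i (J s))%:E)%E.
  by apply: integrable_sum => // i _; exact: rv_integrable.
have ih : Pr.-integrable setT (fun s => (h s)%:E).
  by rewrite hE; exact: integrableD.
have mCY : measurable_fun setT (C2 x \o rvY).
  exact: (measurableT_comp mC measurable_rvY).
have iC : Pr.-integrable setT (C2 x \o rvY).
  have ig : Pr.-integrable setT (fun s => `|(h s)%:E| + `|M|%:E)%E.
    apply: integrableD => //; first exact: integrable_abse.
    by apply: (@integrable_bounded _ _ _ _ _ (cst `|M|) `|M|) => // s _; rewrite normr_id.
  apply: le_integrable ig => // s _ /=.
  have := hC s; have := CM _ (rvY_Omega s); case: (C2 x (rvY s)) => // r.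
  rewrite !lee_fin /= => rM hr.
  rewrite [leRHS]ger0_norm ?addr_ge0 // ler_norml.
  have := ler_norm M; have := ler_norm (- h s); rewrite normrN.
  have := normr_ge0 M; have := normr_ge0 (h s) => *.
  by apply/andP; split; lra.
have muE' A : measurable A -> mu A = Pr (rvY @^-1` A) by exact: muE.
rewrite /inner_obj (integral_transfer measurable_rvY muE' mOm mC) YO //.
apply: (@le_trans _ _ (\int[Pr]_s (h s)%:E)%E); last first.
  by apply: le_integral => // s _; exact: hC.
rewrite hE integralD // LE integral_sum //; last by move=> i; exact: rv_integrable.
rewrite le_eqVlt; apply/orP; left; apply/eqP; congr (_ + _)%E.
have vfin i : (\int[Pr]_s (rvY s i 0 * p i (J s))%:E)%E \is a fin_num.
  exact: (integrable_fin_num _ (rv_integrable i)).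
have -> : (\sum_i OT i (push tau i) =
    (- \sum_i fine (\int[Pr]_s (rvY s i 0%R * p i (J s))%:E))%:E)%E.
  rewrite -sumrN -sumEFin; apply: eq_bigr => i _; rewrite EFinN fineK //.
  by rewrite OT_discrete coupling_value (fin_num_oppeD _ (push_fstar_fin i)).
by rewrite EFinN oppeK -sumEFin; apply: eq_bigr => i _; rewrite fineK.
Qed.

End Coupling.

(** * Existence of the coupling *)

Section Couplings.
Context {R : realType} (D : problem R).
Local Notation d := (ndim D).
Local Notation vecl := 'cV[R]_(m_in D + m_eq D).
Local Notation law := (probability (borel_cV R (m_in D + m_eq D)) R).
Local Notation law_omega := (probability (borel_cV R d) R).
Local Notation Rm := (measurableTypeR R).
Variables (V : {fset vecl}) (w : vecl -> R) (tau : law).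
Hypothesis w0 : forall l, l \in V -> 0 <= w l.
Hypothesis w1 : \sum_(l <- V) w l = 1.
Hypothesis dtau : discrete_law V w tau.
Local Notation K := (#|` V|).

Lemma discrete_law_point (l : vecl) : l \in V -> fine (tau [set l]) = w l.
Proof.
move=> lV; rewrite dtau; last exact: measurable_set1_borel.
rewrite (big_fsetD1 l) //= diracE mem_set // mule1 big_seq big1 ?adde0 //.
by move=> l' /fsetD1P[l'l _]; rewrite diracE memNset ?mule0 //=; exact/eqP.
Qed.

Lemma reconstruction_coupling (mu : law_omega) : reconstruction V tau mu ->
  exists dT (T : measurableType dT) (Pr : probability T R)
    (lam : 'I_K -> vecl) (sigma : 'I_d -> {perm 'I_K}) (J : T -> 'I_K)
    (U : 'I_d -> T -> R), coupling w Pr lam sigma J U /\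
    forall A : set (borel_cV R d), measurable A ->
      mu A = Pr (rvY w lam sigma J U @^-1` A).
Proof.
move=> [dT [T [Pr [lam [sigma [J [U /=]]]]]]].
move=> [[injl meml] sorted [mJ mU indep] [PrJ [U01 PrU]] muE].
have wE j : fine (tau [set lam j]) = w (lam j).
  by apply: discrete_law_point; apply/meml; exists j.
exists dT, T, Pr, lam, sigma, J, U; split; last first.
  move=> A mA; rewrite muE //; congr (Pr (_ @^-1` A)).
  apply/funext => s; apply/matrixP => i k; rewrite !mxE /level /cumul wE.
  congr (qtl i (_ + _)); apply: eq_bigr => k' _; exact: wE.
split=> //.
- by move=> j; rewrite PrJ wE.
move=> i j B mB.
pose Bs k : set Rm := if k == i then B else setT.
have mBs k : measurable (Bs k) by rewrite /Bs; case: eqP.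
have := indep [set j] Bs mBs; rewrite PrJ wE (bigD1 i) //= big1; last first.
  move=> k /negPf ki; rewrite /Bs ki preimage_setT; exact: probability_setT.
rewrite mule1 {2}/Bs eqxx PrU // => <-; congr (Pr (_ `&` _)).
apply/seteqP; split=> s /= Bis; last by have := Bis i; rewrite /Bs eqxx.
by move=> k; rewrite /Bs; case: eqP => // ->.
Qed.

Lemma card_V_gt0 : (0 < K)%N.
Proof.
rewrite lt0n; apply/eqP => /cardfs0_eq V0; have := w1.
by rewrite V0 big_seq_fset0 => /esym/eqP; rewrite oner_eq0.
Qed.

Lemma exists_sorting (p : 'I_K -> R) : exists s : {perm 'I_K},
  forall j j' : 'I_K, (j <= j')%N -> p (s j) <= p (s j').
Proof.
pose r := fun j j' : 'I_K => p j <= p j'; pose e := sort r (enum 'I_K).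
have se : size e = K by rewrite size_sort size_enum_ord.
pose j0 : 'I_K := Ordinal card_V_gt0.
have inj : injective (fun j : 'I_K => nth j0 e j).
  move=> j j' /eqP; rewrite nth_uniq ?se //; last by rewrite sort_uniq enum_uniq.
  by move=> /eqP /val_inj.
exists (perm inj) => j j' jj'; rewrite !permE.
have tr : transitive r by move=> a b c; exact: le_trans.
have rr : reflexive r by move=> a; exact: lexx.
have so : sorted r e by apply: sort_sorted => a b; exact: le_total.
by apply: (sorted_leq_nth tr rr j0 so) => //; rewrite inE se.
Qed.

(** The uniform variables can be taken equal: the index and one uniform
    variable live on the product of [nat] and the line. *)
Lemma exists_coupling : exists dT (T : measurableType dT) (Pr : probability T R)
    (lam : 'I_K -> vecl) (sigma : 'I_d -> {perm 'I_K}) (J : T -> 'I_K)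
    (U : 'I_d -> T -> R), coupling w Pr lam sigma J U.
Proof.
pose lam (j : 'I_K) : vecl := nth 0 V j.
have lamV j : lam j \in V by rewrite mem_nth.
have lam_mem l : l \in V <-> exists j, lam j = l.
  split=> [lV|[j <-]//]; have jK : (index l V < K)%N by rewrite index_mem.
  by exists (Ordinal jK); rewrite /lam /= nth_index.
have lam_inj : injective lam.
  by move=> j j' /eqP; rewrite nth_uniq ?fset_uniq // => /eqP /val_inj.
pose w' (k : nat) : R := w (nth 0 V k).
have /choice[sigma sigmaP] : forall i : 'I_d, exists s : {perm 'I_K},
    forall j j' : 'I_K, (j <= j')%N ->
      dot (vecp i) (lam (s j)) <= dot (vecp i) (lam (s j')).
  by move=> i; exact: (exists_sorting (fun j => dot (vecp i) (lam j))).
pose j0 : 'I_K := Ordinal card_V_gt0.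
pose wn k := Num.max (w' k) 0.
have wn0 k : 0 <= wn k by rewrite le_max lexx orbT.
pose m : {measure set nat -> \bar R} :=
  msum (fun k => mscale (NngNum (wn0 k)) (dirac (k : nat))) K.
have wnE (j : 'I_K) : wn j = w (lam j) by rewrite /wn max_l //; exact: w0 (lamV j).
have mE (A : set nat) : m A = (\sum_(j < K) (wn j)%:E * \d_(nat_of_ord j) A)%E.
  rewrite /m /= /msum; by apply: eq_bigr.
have m1 : m setT = 1%E.
  rewrite mE (eq_bigr (fun j : 'I_K => (w (lam j))%:E)); last first.
    by move=> j _; rewrite diracT mule1 wnE.
  by rewrite sumEFin -w1 (big_nth 0) big_mkord.
pose P1 : probability nat R := mnormalize m (dirac 0%N).
have P1E (A : set nat) : P1 A = m A.
  by rewrite /P1 /= /mnormalize m1 onee_eq0 /= invr1 mule1.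
pose Jn (k : nat) : 'I_K := insubd j0 k.
have P1J j : P1 (Jn @^-1` [set j]) = (w (lam j))%:E.
  rewrite P1E mE (bigD1 j) //= diracE mem_set ?mule1; last by rewrite /Jn /= valKd.
  rewrite big1 ?adde0 ?wnE // => k kj; rewrite diracE memNset ?mule0 //.
  by rewrite /Jn /= valKd => /eqP; apply/negP.
pose unif : probability Rm R := uniform_prob (@ltr01 R).
pose clamp (u : R) : R := Num.max 0 (Num.min u 1).
have clamp01 u : 0 <= clamp u <= 1.
  by rewrite le_max lexx /= ge_max ler01 ge_min lexx orbT.
have mclamp : measurable_fun setT (clamp : Rm -> Rm).
  apply: nondecreasing_measurable => // u v uv.
  by rewrite /clamp ge_max le_max lexx /= le_max le_min !ge_min uv lexx !orbT.
have unif01 : unif `[0, 1]%classic = 1%E.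
  by rewrite /unif /= /uniform_prob integral_uniform_pdf1.
have unif_clamp (B : set Rm) : measurable B -> unif (clamp @^-1` B) = unif B.
  move=> mB; have mcB : measurable (clamp @^-1` B).
    by rewrite -[X in measurable X]setTI; exact: mclamp.
  have restr (A : set Rm) : measurable A -> unif A = unif (A `&` `[0, 1]%classic).
    by move=> mA; rewrite /unif /= /uniform_prob integral_uniform_pdf.
  rewrite restr // [RHS]restr //; congr (unif _); apply/seteqP; split=> u /=;
    rewrite in_itv /= => -[Bu u01]; split => //; move: Bu; case/andP: u01 => u0 u1;
    by rewrite /clamp min_l // max_r.
exists _, (nat * Rm)%type, (P1 \x unif)%E, lam, sigma, (fun x => Jn x.1),
  (fun _ x => clamp x.2).
have rect (A : set nat) (B : set Rm) : measurable B ->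
    (P1 \x unif)%E (A `*` B) = (P1 A * unif B)%E.
  by move=> mB; apply: product_measure1E.
have JE j : (fun x : nat * Rm => Jn x.1) @^-1` [set j] = (Jn @^-1` [set j]) `*` setT.
  by apply/seteqP; split=> x //= [].
split => //.
- by move=> j; rewrite JE; apply: measurableX.
- by move=> i; apply: (measurableT_comp mclamp measurable_snd).
- move=> j; rewrite JE; transitivity (P1 (Jn @^-1` [set j]) * unif setT)%E.
    exact: rect.
  by rewrite P1J probability_setT mule1.
- move=> i j B mB.
  have -> : (fun x : nat * Rm => Jn x.1) @^-1` [set j] `&` (fun x => clamp x.2) @^-1` B =
      (Jn @^-1` [set j]) `*` (clamp @^-1` B) by apply/seteqP; split=> x.
  rewrite -P1J -(unif_clamp B mB); apply: rect.
  by rewrite -[X in measurable X]setTI; exact: mclamp.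
Qed.

End Couplings.

(** * Weak duality for the robust problem *)

Lemma integral_full_sub {R : realType} d (T : measurableType d) (P : probability T R)
    (D E : set T) (f : T -> \bar R) :
  measurable D -> measurable E -> D `<=` E -> P D = 1%E -> P.-integrable E f ->
  (\int[P]_(x in D) f x = \int[P]_(x in E) f x)%E.
Proof.
move=> mD mE DE D1 intf.
rewrite [RHS](negligible_integral (measurableC mD) _ intf (prob_compl0 mD D1)) //.
by rewrite setDE setCK setIidr.
Qed.

Section Duality.
Context {R : realType} (D : problem R).
Hypothesis hD : standing_assumptions D.
Local Notation d := (ndim D).
Local Notation vecl := 'cV[R]_(m_in D + m_eq D).
Local Notation law := (probability (borel_cV R (m_in D + m_eq D)) R).
Local Notation law_omega := (probability (borel_cV R d) R).
Local Notation Rm := (measurableTypeR R).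
Implicit Types (i : 'I_d) (V : {fset vecl}) (tau : law) (l : vecl) (x : 'cV[R]_(k1 D)).

Lemma lohi i : lo i <= hi i. Proof. by case: hD. Qed.
Lemma marg1 i : marg i (Omega1 i) = 1%E. Proof. by case: hD. Qed.
Lemma S1_neq0 : S1 D !=set0. Proof. by case: hD => _ _ _ []. Qed.
Lemma S2_neq0 : S2 (D := D) !=set0. Proof. by case: hD => _ _ _ []. Qed.

Lemma C2_ub : exists M : R, forall x v, S1 D x -> Omega v -> (C2 x v <= M%:E)%E.
Proof.
case: hD => _ _ _ _; set s := ereal_sup _ => soo.
have ub x v : S1 D x -> Omega v -> (C2 x v <= s)%E.
  by move=> Sx Ov; apply: ereal_sup_ubound; exists (x, v).
move: soo ub; case: s => [r _ ub|//|_ ub]; first by exists r.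
by exists 0 => x v Sx Ov; apply: le_trans (ub x v Sx Ov) _; rewrite leNye.
Qed.

Lemma Omega_bound v : Omega v -> forall i, `|v i 0| <= `|lo i| + `|hi i|.
Proof.
move=> Ov i; have := Ov i; rewrite /Omega1 /= in_itv /= => /andP[lw wh].
have := ler_norm (- lo i); have := ler_norm (hi i); rewrite normrN.
have := normr_ge0 (lo i); have := normr_ge0 (hi i) => *.
by rewrite ler_norml; apply/andP; split; lra.
Qed.

Lemma C2_bounded x : S1 D x ->
  exists B : R, forall v, Omega v -> ((- B)%:E <= C2 x v <= B%:E)%E.
Proof.
move=> Sx; have [M CM] := C2_ub; have [l0 Sl0] := S2_neq0.
pose A := `|dot (matQ D *m x + vecb D) l0|
  + \sum_i (`|lo i| + `|hi i|) * `|dot (vecp i) l0|.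
have A0 : 0 <= A.
  by apply: addr_ge0 => //; apply: sumr_ge0 => i _; apply: mulr_ge0 => //; exact: addr_ge0.
exists (A + `|M|) => v Ov; apply/andP; split; last first.
  apply: le_trans (CM x v Sx Ov) _; rewrite lee_fin.
  by apply: le_trans (ler_norm M) _; rewrite lerDr.
apply: (@le_trans _ _ (dot (matQ D *m x + matP D *m v + vecb D) l0)%:E); last first.
  by apply: ereal_sup_ubound; exists l0.
rewrite lee_fin dot_cost.
have h1 : - `|dot (matQ D *m x + vecb D) l0| <= dot (matQ D *m x + vecb D) l0.
  by rewrite lerNl -normrN ler_norm.
have h2 : - \sum_i (`|lo i| + `|hi i|) * `|dot (vecp i) l0| <=
    \sum_i v i 0 * dot (vecp i) l0.
  rewrite -sumrN; apply: ler_sum => i _; rewrite lerNl.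
  apply: le_trans (ler_norm _) _; rewrite normrN normrM ler_wpM2r //.
  exact: Omega_bound.
by have := normr_ge0 M => ?; rewrite /A; lra.
Qed.

Lemma C2_integrable x (mu : law_omega) : S1 D x -> mu.-integrable (@Omega R D) (C2 x).
Proof.
move=> Sx; have [B CB] := C2_bounded Sx; have mOm := @measurable_Omega R D.
have mC := measurable_C2 x.
have E : {in @Omega R D, (EFin \o (fine \o C2 x)) =1 C2 x}.
  move=> v /set_mem Ov; have /andP[] := CB v Ov.
  by rewrite /=; case: (C2 x v) => // r.
apply: (eq_integrable mOm _ _ E).
apply: (@integrable_bounded _ _ _ _ _ _ B) => //.
  by apply: measurableT_comp; [exact: fine_measurable | exact: measurable_funTS mC].
move=> v Ov /=; have /andP[] := CB v Ov; case: (C2 x v) => // r; rewrite !lee_fin /=.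
by move=> *; rewrite ler_norml; apply/andP.
Qed.

(** The constraint bounds [<Q x + b, l>] by minus the sum of the [fs i] at
    [<p_i, l>], and a product is at most the sum of function and conjugate. *)
Lemma C2_le_conjugate x fs v : (forall l, S2 l -> slack x fs l <= 0) ->
  (forall i, conj_ok i (fs i)) -> Omega v ->
  (C2 x v <= \sum_i conjugate (fs i) (v i 0%R))%E.
Proof.
move=> sl fok Ov; apply: ge_ereal_sup => _ [l Sl <-].
have fin i := conjugate_fin (fok i) (Ov i).
rewrite (eq_bigr (fun i => (fine (conjugate (fs i) (v i 0%R)))%:E)); last first.
  by move=> i _; rewrite fineK.
rewrite sumEFin lee_fin dot_cost; have := sl l Sl; rewrite /slack => h.
have : \sum_i (v i 0 * dot (vecp i) l - fs i (dot (vecp i) l)) <=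
    \sum_i fine (conjugate (fs i) (v i 0)).
  apply: ler_sum => i _; rewrite -lee_fin fineK // mulrC; exact: conjugate_lb.
by rewrite sumrB => ?; lra.
Qed.

Lemma inner_le_conj x fs (mu : law_omega) : S1 D x ->
  (forall l, S2 l -> slack x fs l <= 0) -> (forall i, conj_ok i (fs i)) ->
  Gamma D mu -> (inner_obj x mu <= \sum_i conj_int i (fs i))%E.
Proof.
move=> Sx sl fok [mu1 muM]; have mOm := @measurable_Omega R D.
have mcoord i : measurable_fun setT ((fun v => v i 0) : borel_cV R d -> Rm).
  exact: measurable_coord.
have law i (B : set Rm) : measurable B ->
    marg i B = mu ((fun v : 'cV[R]_d => v i 0) @^-1` B).
  by move=> mB; rewrite -(muM i B mB).
have mc i := measurable_conjugate (fs i).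
have mO i := @measurable_Omega1 R D i.
have ic i := (integrable_transfer (mcoord i) (@law i) (mO i) (mc i)).1 (conj_integrable (fok i)).
have mE i : measurable ((fun v : borel_cV R d => v i 0) @^-1` Omega1 i).
  by rewrite -[X in measurable X]setTI; exact: mcoord.
have sub i : @Omega R D `<=` (fun v => v i 0) @^-1` Omega1 i by move=> v; exact.
have icO i : mu.-integrable (@Omega R D) (fun v => conjugate (fs i) (v i 0%R)).
  by apply: (integrableS (mE i)) (ic i) => //; exact: sub.
have eqc i : conj_int i (fs i) = (\int[mu]_(v in @Omega R D) conjugate (fs i) (v i 0%R))%E.
  rewrite (integral_full_sub mOm (mE i) (@sub i) mu1 (ic i)).
  exact: (integral_transfer (mcoord i) (@law i) (mO i) (mc i)).
rewrite (eq_bigr (fun i => \int[mu]_(v in @Omega R D) conjugate (fs i) (v i 0%R))%E) //.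
rewrite -integral_sum //; apply: le_integral => //; first exact: C2_integrable.
  exact: integrable_sum.
by move=> v /set_mem Ov; exact: C2_le_conjugate.
Qed.

Lemma DRO_le_primal x fs : primal_feas D (x, fs) -> (forall i, conj_ok i (fs i)) ->
  (DRO_obj D x <= primal_obj D (x, fs))%E.
Proof.
move=> [/= Sx _ sl] fok; apply: leeD => //; apply: ge_ereal_sup => _ [mu Gmu <-].
exact: inner_le_conj.
Qed.


Definition S2_row (k : 'I_(m_in D) + 'I_(k2 D)) : vecl := match k with
  | inl k => col_mx (delta_mx k 0) 0
  | inr j => col_mx (col j (A_in D)) (col j (A_eq D)) end.

Definition S2_rhs (k : 'I_(m_in D) + 'I_(k2 D)) : R :=
  match k with inl _ => 0 | inr j => c2 D j 0 end.

Lemma dot_col m n (A : 'M[R]_(m, n)) j (u : 'cV[R]_m) :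
  dot (col j A) u = (A^T *m u) j 0.
Proof. by rewrite mxE; apply: eq_bigr => k _; rewrite !mxE. Qed.

Lemma S2_polyhedron : S2 (D := D) = polyhedron S2_row S2_rhs.
Proof.
have rowE l k : dot (S2_row k) l = match k with inl k => usubmx l k 0
    | inr j => ((A_in D)^T *m usubmx l + (A_eq D)^T *m dsubmx l) j 0 end.
  rewrite -{1}(vsubmxK l); case: k => [k|j] /=; rewrite dot_col_mx.
    rewrite [X in _ + X]big1 ?addr0; last by move=> i _; rewrite mxE mul0r.
    rewrite /dot (bigD1 k) //= big1 ?addr0 => [|i /negPf ik]; rewrite mxE.
      by rewrite !eqxx mul1r.
    by rewrite ik mul0r.
  by rewrite !dot_col [RHS]mxE.
apply/seteqP; split=> l; rewrite /S2 /polyhedron /=.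
  move=> [h1 h2] [k|j]; rewrite rowE /=; first by have := h1 k; rewrite [leRHS]mxE.
  exact: h2.
by move=> h; split=> k; [have := h (inl k) | have := h (inr k)]; rewrite rowE ?mxE.
Qed.

Lemma measurable_S2 : measurable (S2 (D := D) : set (borel_cV R _)).
Proof.
rewrite S2_polyhedron.
have -> : polyhedron S2_row S2_rhs =
    \bigcap_(k in [set: 'I_(m_in D) + 'I_(k2 D)]) (dot (S2_row k) @^-1` `]-oo, S2_rhs k]%classic).
  apply/seteqP; split=> l h k; first by move=> _ /=; rewrite in_itv; exact: h.
  by have := h k I; rewrite /= in_itv.
apply: fin_bigcap_measurable => // k _; rewrite -[X in measurable X]setTI.
by apply: measurable_dot => //; exact: measurable_itv.
Qed.

Definition nrm l : R := Num.sqrt (dot l l).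

Lemma nrm_ge0 l : 0 <= nrm l. Proof. exact: sqrtr_ge0. Qed.

Lemma coord_le_nrm l k : `|l k 0| <= nrm l.
Proof.
rewrite -[leLHS]sqrtr_sqr ler_wsqrtr // /dot (bigD1 k) //= expr2 lerDl.
by apply: sumr_ge0 => j _; rewrite -expr2 sqr_ge0.
Qed.

Lemma dot_le_nrm u l : `|dot u l| <= (\sum_k `|u k 0|) * nrm l.
Proof.
rewrite mulr_suml; apply: le_trans (ler_norm_sum _ _ _) _; apply: ler_sum => k _.
by rewrite normrM ler_wpM2l // coord_le_nrm.
Qed.

Lemma measurable_nrm : measurable_fun setT (nrm : borel_cV R _ -> Rm).
Proof.
have m : measurable_fun setT ((fun l => dot l l) : borel_cV R _ -> Rm).
  by apply: measurable_fun_rsum => k; apply: measurable_funM; exact: measurable_coord.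
exact: (measurableT_comp (continuous_measurable_fun (@sqrt_continuous R)) m).
Qed.

Lemma probs1_integrable tau (h : vecl -> R) (A B : R) : probs1_on (S2 (D := D)) tau ->
  measurable_fun setT (h : borel_cV R _ -> Rm) ->
  (forall l, `|h l| <= A + B * nrm l) -> tau.-integrable setT (EFin \o h).
Proof.
move=> [t1 tfin] mh hb; have mS := measurable_S2.
apply/(integrable_full mS t1); first exact/measurable_EFinP.
have inrm : tau.-integrable (S2 (D := D)) (EFin \o nrm).
  apply/integrableP; split; first by apply/measurable_EFinP; exact: (measurable_funTS measurable_nrm).
  by under eq_integral do rewrite /= ger0_norm ?nrm_ge0 //.
have ig : tau.-integrable (S2 (D := D)) (fun l => (A + B * nrm l)%:E).
  have iA : tau.-integrable (S2 (D := D)) (EFin \o cst A).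
    by apply: (@integrable_bounded _ _ _ _ _ _ `|A|) => //; exact: measurable_cst.
  apply: (eq_integrable mS _ _ _ (integrableD mS iA (integrableZl mS B inrm))) => l _ /=.
  by rewrite -EFinD.
apply: le_integrable ig => //.
  by apply/measurable_EFinP; exact: measurable_funTS mh.
by move=> l _ /=; rewrite lee_fin; apply: le_trans (hb l) (ler_norm _).
Qed.

Definition growth (f : R -> R) := exists A B : R, forall z, `|f z| <= A + B * `|z|.

Lemma dot_integrable tau u : probs1_on (S2 (D := D)) tau ->
  tau.-integrable setT (EFin \o dot u).
Proof.
move=> ht; apply: (probs1_integrable (A := 0) ht (measurable_dot u)) => l.
by rewrite add0r; exact: dot_le_nrm.
Qed.

Lemma growth_integrable tau i f : probs1_on (S2 (D := D)) tau ->
  measurable_fun setT (f : Rm -> Rm) -> growth f ->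
  tau.-integrable setT (EFin \o (f \o dot (vecp i))).
Proof.
move=> ht mf [A [B fAB]].
apply: (probs1_integrable (A := A) (B := `|B| * \sum_k `|vecp i k 0|) ht).
  exact: (measurableT_comp mf (measurable_dot (vecp i))).
move=> l /=; apply: le_trans (fAB _) _; rewrite lerD2l.
apply: le_trans (ler_norm _) _; rewrite normrM normr_id -mulrA ler_wpM2l //.
exact: dot_le_nrm.
Qed.

Lemma discrete_probs1 V w tau : (forall l, l \in V -> 0 <= w l) ->
  \sum_(l <- V) w l = 1 -> discrete_law V w tau -> (forall l, l \in V -> S2 l) ->
  probs1_on (S2 (D := D)) tau.
Proof.
move=> w0 w1 dtau VS; have t1 : tau (S2 (D := D)) = 1%E.
  exact: discrete_law_supp dtau measurable_S2 VS w1.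
split=> //; have inrm := integrable_discrete w0 dtau measurable_nrm.
rewrite (integral_full measurable_S2 t1 inrm).
by rewrite (integral_discrete w0 dtau measurable_nrm) ltry.
Qed.

(** Weak duality in the first-stage variable, with an abstract vector [a] that
    will be the mean of [Q^T l] under various measures. *)
Lemma first_stage_weak x xin xeq (a : 'I_(k1 D) -> R) : S1 D x -> vle xin 0 ->
  (forall j, ((L_in D)^T *m xin + (L_eq D)^T *m xeq) j 0 <= c1 D j 0 + a j) ->
  dot (q_in D) xin + dot (q_eq D) xeq <= dot (c1 D) x + \sum_j x j 0 * a j.
Proof.
move=> [x0 xq xe] xi la.
have : dot x ((L_in D)^T *m xin + (L_eq D)^T *m xeq) <= dot (c1 D) x + \sum_j x j 0 * a j.
  rewrite [dot (c1 D) x]dotC /dot -big_split /=; apply: ler_sum => j _.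
  by rewrite -mulrDr ler_wpM2l //; have := x0 j; rewrite mxE.
apply: le_trans; rewrite dotDr -!dot_mulmxl xe lerD2r.
apply: ler_sum => k _; rewrite ler_wnM2r //.
by have := xi k; rewrite [X in _ <= X]mxE.
Qed.

(** Weak duality: Kantorovich duality in every coordinate turns the transport
    costs into integrals of the [fs i], which the constraint of the primal
    problem bounds. *)
Lemma weak_duality x fs tau xin xeq : primal_feas D (x, fs) ->
  dual_feas D (tau, xin, xeq) ->
  (forall i, tau.-integrable setT (EFin \o (fs i \o dot (vecp i)))) ->
  (dual_obj D (tau, xin, xeq) <= primal_obj D (x, fs))%E.
Proof.
move=> [/= Sx fcvx sl] [ht xi la] intf.
have mS := measurable_S2; have t1 : tau (S2 (D := D)) = 1%E by case: ht.
have mf i : measurable_fun setT (fs i : Rm -> Rm).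
  by apply: continuous_measurable_fun; case: (fcvx i).
have cNy i := (conj_int_gtNy marg1 i (fs i)).1.
rewrite /primal_obj /=.
have [[i coo]|call] := pselect (exists i, conj_int i (fs i) = +oo%E).
  have -> : (\sum_i conj_int i (fs i) = +oo)%E.
    apply/eqP; rewrite esum_eqy; last by move=> j _; rewrite gt_eqF.
    by apply/existsP; exists i; rewrite coo eqxx.
  by rewrite addey // leey.
have cfin i : conj_int i (fs i) \is a fin_num.
  by rewrite fin_numElt cNy ltey; apply/eqP => coo; apply: call; exists i.
have pfin i : push_int tau i (fs i) \is a fin_num.
  by rewrite (push_intE (mf i) (intf i)); exact: integrable_fin_num (intf i).
pose c i := fine (conj_int i (fs i)); pose q i := fine (push_int tau i (fs i)).
have OTge i : ((- c i - q i)%:E <= OT i (push tau i))%E.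
  have := OT_weak marg1 (mf i) (dot_integrable (vecp i) ht) (intf i).
  by rewrite -(fineK (cfin i)) -(fineK (pfin i)) -EFinN -EFinB.
have ib := dot_integrable (vecb D) ht.
have bE := integral_full mS t1 ib.
have bfin : (\int[tau]_l (dot (vecb D) l)%:E)%E \is a fin_num.
  exact: integrable_fin_num ib.
pose bb := fine (\int[tau]_l (dot (vecb D) l)%:E)%E.
have iq j := dot_integrable (col j (matQ D)) ht.
pose aj j := fine (\int[tau]_l (dot (col j (matQ D)) l)%:E)%E.
have aE j : (\int[tau]_(l in S2 (D := D)) (((matQ D)^T *m l) j 0%R)%:E = (aj j)%:E)%E.
  rewrite /aj fineK; last exact: integrable_fin_num (iq j).
  by rewrite -(integral_full mS t1 (iq j)); apply: eq_integral => l _; rewrite /= dot_col.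
have fs1 : dot (q_in D) xin + dot (q_eq D) xeq <= dot (c1 D) x + \sum_j x j 0 * aj j.
  apply: first_stage_weak => // j; have := la j.
  by rewrite aE -EFinD lee_fin.
(* integrate the constraint of the primal problem *)
have slint : bb + \sum_j x j 0 * aj j + \sum_i q i <= 0.
  pose g l := dot (vecb D) l + \sum_j x j 0 * dot (col j (matQ D)) l.
  have ig1 : tau.-integrable setT (fun l => \sum_j (x j 0%R * dot (col j (matQ D)) l)%:E)%E.
    apply: integrable_sum => // j _.
    by apply: (eq_integrable measurableT _ _ _ (integrableZl measurableT (x j 0) (iq j))).
  have ig2 : tau.-integrable setT (fun l => \sum_i (fs i (dot (vecp i) l))%:E)%E.
    by apply: integrable_sum => // i _; exact: intf.
  have : (\int[tau]_l ((dot (vecb D) l)%:E + \sum_j (x j 0%R * dot (col j (matQ D)) l)%:E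
      + \sum_i (fs i (dot (vecp i) l))%:E) <= 0)%E.
    rewrite -(integral_full mS t1); last by apply: integrableD => //; exact: integrableD.
    rewrite -oppe_ge0 -integralN; last first.
      apply: (integrable_add_def mS); apply: (integrableS _ _ _ _ (E := setT)) => //.
      by apply: integrableD => //; exact: integrableD.
    apply: integral_ge0 => l Sl; rewrite !sumEFin -!EFinD -EFinN lee_fin oppr_ge0.
    apply: le_trans (sl l Sl); rewrite /slack le_eqVlt; apply/orP; left; apply/eqP.
    congr (_ + _); rewrite dotDl addrC dot_mulmxl; congr (_ + _).
    by apply: eq_bigr => j _; rewrite dot_col.
  rewrite integralD //; last exact: integrableD.
  rewrite integralD // !integral_sum //; last first.
    move=> j; by apply: (eq_integrable measurableT _ _ _ (integrableZl measurableT (x j 0) (iq j))).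
  have -> : (\sum_j \int[tau]_l (x j 0%R * dot (col j (matQ D)) l)%:E =
      (\sum_j x j 0 * aj j)%:E)%E.
    rewrite -sumEFin; apply: eq_bigr => j _; rewrite EFinM /aj fineK; last first.
      exact: integrable_fin_num (iq j).
    by rewrite -(integralZl measurableT (iq j)); apply: eq_integral => l _; rewrite EFinM.
  have -> : (\sum_i \int[tau]_l (fs i (dot (vecp i) l))%:E = (\sum_i q i)%:E)%E.
    rewrite -sumEFin; apply: eq_bigr => i _; rewrite /q fineK //.
    by rewrite (push_intE (mf i) (intf i)).
  by rewrite -(fineK bfin) -!EFinD lee_fin.
rewrite /dual_obj bE -(fineK bfin) -/bb.
have -> : (\sum_i conj_int i (fs i) = (\sum_i c i)%:E)%E.
  by rewrite -sumEFin; apply: eq_bigr => i _; rewrite /c fineK.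
have OTs : ((- \sum_i c i - \sum_i q i)%:E <= \sum_i OT i (push tau i))%E.
  by rewrite -opprD -big_split /= -sumrN -sumEFin; apply: lee_sum => i _; rewrite opprD.
apply: (@le_trans _ _ (bb%:E - (- \sum_i c i - \sum_i q i)%:E
    + (dot (q_in D) xin)%:E + (dot (q_eq D) xeq)%:E)%E).
  by rewrite leeD2r // leeD2r // leeB.
by rewrite -EFinN -!EFinD lee_fin; lra.
Qed.

End Duality.

(** * Dual points with finite support *)

Section DiscreteDual.
Context {R : realType} (D : problem R).
Hypothesis hD : standing_assumptions D.
Local Notation d := (ndim D).
Local Notation vecl := 'cV[R]_(m_in D + m_eq D).
Local Notation law := (probability (borel_cV R (m_in D + m_eq D)) R).
Local Notation law_omega := (probability (borel_cV R d) R).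
Local Notation Rm := (measurableTypeR R).
Implicit Types (i : 'I_d) (l : vecl) (x : 'cV[R]_(k1 D)).

Variables (V : {fset vecl}) (w : vecl -> R) (tau : law).
Hypothesis w0 : forall l, l \in V -> 0 <= w l.
Hypothesis w1 : \sum_(l <- V) w l = 1.
Hypothesis dtau : discrete_law V w tau.
Hypothesis VS : forall l, l \in V -> S2 l.

Lemma OT_push_discrete i : OT i (push tau i) =
  (- conj_int i (fstar V tau i) - push_int tau i (fstar V tau i))%E.
Proof.
have [dT [T [Pr [lam [sigma [J [U cp]]]]]]] := exists_coupling w0 w1.
exact: (OT_discrete (lohi hD) (marg1 hD) w0 w1 dtau cp).
Qed.

Lemma push_int_discrete i (f : R -> R) : continuous f ->
  push_int tau i f = (\sum_(l <- V) w l * f (dot (vecp i) l))%:E.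
Proof.
move=> cf; have mf : measurable_fun setT (f : Rm -> Rm) by exact: continuous_measurable_fun.
have mfd := measurableT_comp mf (measurable_dot (vecp i)).
by rewrite (push_intE mf (integrable_discrete w0 dtau mfd)) (integral_discrete w0 dtau mfd).
Qed.

Lemma V_nonempty : exists l, l \in V.
Proof.
apply: contrapT => nV; have := w1; rewrite big_seq big1 => [/esym/eqP|l lV].
  by rewrite oner_eq0.
by case: nV; exists l.
Qed.

Lemma OT_push_fin i : OT i (push tau i) \is a fin_num.
Proof.
have [l lV] := V_nonempty; have h := fstar_hinge (lohi hD) (marg1 hD) tau i lV.
rewrite OT_push_discrete push_int_discrete; last by case: (hinge_C_cvx h).
rewrite fin_numB fin_numN /= andbT; apply: conj_int_fin.
exact: hinge_conj_bounded h.
Qed.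

Lemma dual_obj_discrete xin xeq : dual_obj D (tau, xin, xeq) =
  (\sum_(l <- V) w l * dot (vecb D) l - \sum_i fine (OT i (push tau i))
   + dot (q_in D) xin + dot (q_eq D) xeq)%:E.
Proof.
have mb := measurable_dot (vecb D).
have t1 := (discrete_probs1 w0 w1 dtau VS).1.
rewrite /dual_obj (integral_full (measurable_S2 (D := D)) t1 (integrable_discrete w0 dtau mb)).
rewrite (integral_discrete w0 dtau mb) !EFinD EFinN; congr (_ - _ + _ + _)%E.
by rewrite -sumEFin; apply: eq_bigr => i _; rewrite fineK // OT_push_fin.
Qed.

Lemma dual_feas_discrete xin xeq : vle xin 0 ->
  vle ((L_in D)^T *m xin + (L_eq D)^T *m xeq)
      (c1 D + \sum_(l <- V) w l *: ((matQ D)^T *m l)) ->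
  dual_feas D (tau, xin, xeq).
Proof.
move=> xi la; have ht := discrete_probs1 w0 w1 dtau VS; split => // j.
have mq := measurable_dot (col j (matQ D)).
rewrite (eq_integral (fun l : borel_cV R _ => (dot (col j (matQ D)) l)%:E)); last first.
  by move=> l _; rewrite dot_col.
rewrite (integral_full (measurable_S2 (D := D)) ht.1 (integrable_discrete w0 dtau mq)).
rewrite (integral_discrete w0 dtau mq) -EFinD lee_fin.
apply: le_trans (la j) _; rewrite mxE lerD2l summxE; apply: ler_sum => l _.
by rewrite mxE dot_col.
Qed.

(** The law of the random vector built from the dual point is a feasible scenario
    of the inner maximization, and its cost is at least the dual objective. *)
Lemma dual_le_DRO x xin xeq : S1 D x -> vle xin 0 ->
  vle ((L_in D)^T *m xin + (L_eq D)^T *m xeq)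
      (c1 D + \sum_(l <- V) w l *: ((matQ D)^T *m l)) ->
  (dual_obj D (tau, xin, xeq) <= DRO_obj D x)%E.
Proof.
move=> Sx xi la.
have [dT [T [Pr [lam [sigma [J [U cp]]]]]]] := exists_coupling w0 w1.
have mY := measurable_rvY (lohi hD) (marg1 hD) w0 dtau cp.
pose mixin := isMeasurableFun.Build _ _ _ _ (rvY w lam sigma J U : T -> borel_cV R d) mY.
pose Y : {mfun T >-> borel_cV R d} := HB.pack (rvY w lam sigma J U : T -> borel_cV R d) mixin.
have [M CM] := C2_ub hD.
pose mu : law_omega := distribution Pr Y.
have muE A : measurable A -> mu A = Pr (rvY w lam sigma J U @^-1` A) by [].
have Gmu := coupling_Gamma (lohi hD) (marg1 hD) w0 w1 dtau cp muE.
have := coupling_inner_obj (lohi hD) (marg1 hD) w0 w1 dtau cp muE VS (fun v => @CM x v Sx).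
rewrite dual_obj_discrete => H.
apply: le_trans (leeD2l _ (ereal_sup_ubound _)); last by exists mu => //; reflexivity.
apply: le_trans (leeD2l _ H).
have -> : (\sum_i OT i (push tau i) = (\sum_i fine (OT i (push tau i)))%:E)%E.
  by rewrite -sumEFin; apply: eq_bigr => i _; rewrite fineK // OT_push_fin.
rewrite -EFinN -!EFinD lee_fin.
have := first_stage_weak (a := fun j => \sum_(l <- V) w l * dot (col j (matQ D)) l) Sx xi.
have -> : \sum_j x j 0 * (\sum_(l <- V) w l * dot (col j (matQ D)) l) =
    \sum_(l <- V) w l * dot (matQ D *m x) l.
  under eq_bigr do rewrite mulr_sumr; rewrite exchange_big /=.
  apply: eq_bigr => l _; rewrite dot_mulmxl mulr_sumr; apply: eq_bigr => j _.
  by rewrite dot_col mulrCA.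
have -> : \sum_(l <- V) w l * dot (matQ D *m x + vecb D) l =
    \sum_(l <- V) w l * dot (matQ D *m x) l + \sum_(l <- V) w l * dot (vecb D) l.
  by rewrite -big_split /=; apply: eq_bigr => l _; rewrite dotDl mulrDr.
move=> h; have {}h : dot (q_in D) xin + dot (q_eq D) xeq <=
    dot (c1 D) x + \sum_(l <- V) w l * dot (matQ D *m x) l.
  apply: h => j; apply: le_trans (la j) _; rewrite mxE lerD2l summxE.
  by apply: ler_sum => l _; rewrite mxE dot_col.
lra.
Qed.

End DiscreteDual.

(** * The linear programs of the inner algorithm *)

Section LPInstance.
Context {R : realType} (D : problem R).
Hypothesis hD : standing_assumptions D.
Local Notation d := (ndim D).
Local Notation vecl := 'cV[R]_(m_in D + m_eq D).
Implicit Types (i : 'I_d) (l : vecl) (x : 'cV[R]_(k1 D)).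

(** What the inner algorithm needs from its finite set of multipliers: it
    consists of feasible points, one of which extends to a feasible point of
    the dual problem. *)
Definition good_V (V : {fset vecl}) : Prop :=
  (forall l, l \in V -> S2 l) /\
  exists l0 xin xeq, [/\ l0 \in V, vle xin 0 &
    vle ((L_in D)^T *m xin + (L_eq D)^T *m xeq) (c1 D + (matQ D)^T *m l0)].

(** What it needs from its families of functions. *)
Definition good_F (F : 'I_d -> {fset (R -> R)}) : Prop :=
  (forall i, exists f, f \in F i) /\ (forall i f, f \in F i -> conj_ok i f).

Variables (V : {fset vecl}) (F : 'I_d -> {fset (R -> R)}).
Hypotheses (gV : good_V V) (gF : good_F F).

Local Notation cf i f := (fine (conj_int i f)).

Lemma cfE i f : f \in F i -> conj_int i f = (cf i f)%:E.
Proof. by move=> /gF.2 fok; rewrite fineK //; exact: conj_int_fin. Qed.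

Let I1 := ({i : 'I_d & F i} + 'I_(k1 D))%type.
Let J1 := (V + 'I_(n_in D))%type.
Let J2 := ('I_d + 'I_(n_eq D))%type.

(** The linear program in the form of [lp_duality]: its rows are the cuts, the
    constraints attached to the first-stage coordinates and the total mass; its
    columns are the nonnegative [nu] and [- xin], and the free [psi] and [xeq].
    The dual variables of the rows are [y], [x] and [- h0]. *)
Definition lp_a (u : I1 + unit) (v : J1 + J2) : R := match u, v with
  | inl (inl t), inl (inl l) => - (val (tagged t) (dot (vecp (tag t)) (val l)))
  | inl (inl t), inr (inl i) => - (tag t == i)%:R
  | inl (inl _), _ => 0
  | inl (inr j), inl (inl l) => - (((matQ D)^T *m val l) j 0)
  | inl (inr j), inl (inr k) => - L_in D k j
  | inl (inr j), inr (inl _) => 0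
  | inl (inr j), inr (inr k) => L_eq D k j
  | inr _, inl (inl _) => 1
  | inr _, _ => 0 end.

Definition lp_b (u : I1 + unit) : R := match u with
  | inl (inl t) => cf (tag t) (val (tagged t)) | inl (inr j) => c1 D j 0
  | inr _ => 1 end.

Definition lp_c (v : J1 + J2) : R := match v with
  | inl (inl l) => dot (vecb D) (val l) | inl (inr k) => - q_in D k 0
  | inr (inl _) => -1 | inr (inr k) => q_eq D k 0 end.

Definition lp_of_point (p : lp_point D) (v : J1 + J2) : R := match v with
  | inl (inl l) => lp_nu p (val l) | inl (inr k) => - lp_xin p k 0
  | inr (inl i) => lp_psi p i | inr (inr k) => lp_xeq p k 0 end.

Definition point_of_lp (z : J1 + J2 -> R) : lp_point D := {|
  lp_nu := fun l => if insub l is Some u then z (inl (inl u)) else 0;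
  lp_psi := fun i => z (inr (inl i));
  lp_xin := \col_k - z (inl (inr k));
  lp_xeq := \col_k z (inr (inr k)) |}.

Definition lpd_of_point (p : lpd_point D) (u : I1 + unit) : R := match u with
  | inl (inl t) => lpd_y p (tag t) (val (tagged t)) | inl (inr j) => lpd_x p j 0
  | inr _ => - lpd_h0 p end.

Definition fun_tag i (u : F i) : {i : 'I_d & F i} := existT (fun i => F i : Type) i u.

Definition point_of_lpd (y : I1 + unit -> R) : lpd_point D := {|
  lpd_x := \col_j y (inl (inr j));
  lpd_h0 := - y (inr tt);
  lpd_y := fun i f => if (insub f : option (F i)) is Some u
    then y (inl (inl (fun_tag u))) else 0 |}.

Lemma lp_of_pointK z : lp_of_point (point_of_lp z) =1 z.
Proof. by case=> [[l|k]|[i|k]] /=; rewrite ?valK ?mxE ?opprK. Qed.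

Lemma lpd_of_pointK y : lpd_of_point (point_of_lpd y) =1 y.
Proof.
case=> [[[i f]|j]|[]] /=; rewrite ?mxE ?opprK //.
by rewrite valK.
Qed.

Lemma sum_tagged (G : 'I_d -> (R -> R) -> R) :
  \sum_(t : {i : 'I_d & F i}) G (tag t) (val (tagged t)) =
  \sum_i \sum_(f <- F i) G i f.
Proof.
rewrite -(sig_big_dep (fun=> true) (fun _ _ => true)
  (fun i (f : F i) => G i (val f))) /=.
by apply: eq_bigr => i _; rewrite [RHS]big_seq_fsetE.
Qed.

Lemma lp_row_fun (z : J1 + J2 -> R) (t : {i : 'I_d & F i}) :
  \sum_v lp_a (inl (inl t)) v * z v =
  - \sum_(l : V) val (tagged t) (dot (vecp (tag t)) (val l)) * z (inl (inl l))
  - z (inr (inl (tag t))).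
Proof.
rewrite !big_sumType /=.
rewrite [X in (_ + X) + _]big1 ?addr0; last by move=> k _; rewrite mul0r.
rewrite [X in _ + (_ + X)]big1 ?addr0; last by move=> k _; rewrite mul0r.
have -> : \sum_i - (tag t == i)%:R * z (inr (inl i)) = - z (inr (inl (tag t))).
  rewrite (bigD1 (tag t)) //= eqxx mulN1r big1 ?addr0 // => i.
  by rewrite eq_sym => /negPf ->; rewrite oppr0 mul0r.
by rewrite -sumrN; congr (_ - _); apply: eq_bigr => l _; rewrite mulNr.
Qed.

Lemma lp_row_x (z : J1 + J2 -> R) j : \sum_v lp_a (inl (inr j)) v * z v =
  - \sum_(l : V) ((matQ D)^T *m val l) j 0 * z (inl (inl l))
  - \sum_k L_in D k j * z (inl (inr k)) + \sum_k L_eq D k j * z (inr (inr k)).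
Proof.
rewrite !big_sumType /=.
rewrite [X in _ + (X + _)]big1 ?add0r; last by move=> k _; rewrite mul0r.
by rewrite -!sumrN; congr (_ + _ + _); apply: eq_bigr => l _; rewrite mulNr.
Qed.

Lemma lp_row_mass (z : J1 + J2 -> R) :
  \sum_v lp_a (inr tt) v * z v = \sum_(l : V) z (inl (inl l)).
Proof.
have z0 n (G : 'I_n -> R) : \sum_k 0 * G k = 0 by rewrite big1 // => k _; rewrite mul0r.
rewrite !big_sumType /= !z0 !addr0.
by apply: eq_bigr => l _; rewrite mul1r.
Qed.

Lemma lp_feas_primal p : lp_feas V F p <-> lp_primal_feas lp_a lp_b (lp_of_point p).
Proof.
have nuE (G : vecl -> R -> R) : \sum_(l <- V) G l (lp_nu p l) =
    \sum_(l : V) G (val l) (lp_of_point p (inl (inl l))).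
  by rewrite [LHS]big_seq_fsetE.
have mass : \sum_v lp_a (inr tt) v * lp_of_point p v = \sum_(l <- V) lp_nu p l.
  by rewrite lp_row_mass (nuE (fun _ r => r)).
have rowx j : \sum_v lp_a (inl (inr j)) v * lp_of_point p v =
    ((L_in D)^T *m lp_xin p + (L_eq D)^T *m lp_xeq p) j 0
    - (\sum_(l <- V) lp_nu p l *: ((matQ D)^T *m l)) j 0.
  rewrite lp_row_x summxE (eq_bigr (fun l => lp_nu p l * ((matQ D)^T *m l) j 0)); last first.
    by move=> l _; rewrite mxE.
  rewrite (nuE (fun l r => r * ((matQ D)^T *m l) j 0)) !mxE /=.
  have -> : \sum_k L_in D k j * - lp_xin p k 0 = - \sum_k (L_in D)^T j k * lp_xin p k 0.
    by rewrite -sumrN; apply: eq_bigr => k _; rewrite mulrN mxE.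
  have -> : \sum_k L_eq D k j * lp_xeq p k 0 = \sum_k (L_eq D)^T j k * lp_xeq p k 0.
    by apply: eq_bigr => k _; rewrite mxE.
  under eq_bigr do rewrite mulrC.
  lra.
have rowf i f (fF : f \in F i) :
    \sum_v lp_a (inl (inl (fun_tag [` fF]%fset))) v * lp_of_point p v =
    - \sum_(l <- V) f (dot (vecp i) l) * lp_nu p l - lp_psi p i.
  by rewrite lp_row_fun (nuE (fun l r => f (dot (vecp i) l) * r)).
split=> [[nu0 xi ps la m1]|[h0 hI hE]].
- split=> [[l|k]|[[i f]|j]|[]] /=.
  + exact/nu0/valP.
  + by rewrite oppr_ge0; have := xi k; rewrite [X in _ <= X]mxE.
  + have fF := valP f; have := ps i (val f) fF; rewrite (cfE fF) -EFinN -EFinB lee_fin.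
    have := rowf i (val f) fF.
    have -> : [` fF]%fset = f by apply: val_inj.
    by move=> -> ?; lra.
  + by rewrite rowx; have := la j; rewrite [X in _ <= X]mxE => ?; lra.
  + by rewrite mass.
- split.
  + by move=> l lV; exact: (h0 (inl [` lV]%fset)).
  + by move=> k; have := h0 (inr k); rewrite oppr_ge0 [X in _ -> _ <= X]mxE.
  + move=> i f fF; have := hI (inl (fun_tag [` fF]%fset)).
    by rewrite rowf /= (cfE fF) -EFinN -EFinB lee_fin => ?; lra.
  + by move=> j; have := hI (inr j); rewrite rowx /= [X in _ -> _ <= X]mxE => ?; lra.
  + by have := hE tt; rewrite mass.
Qed.

Lemma lp_objE p : lp_obj V p = \sum_v lp_c v * lp_of_point p v.
Proof.
rewrite !big_sumType /= /lp_obj [X in X - _ + _ + _]big_seq_fsetE /=.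
have -> : \sum_k - q_in D k 0 * - lp_xin p k 0 = dot (q_in D) (lp_xin p).
  by apply: eq_bigr => k _; rewrite mulrNN.
have -> : \sum_(i < d) -1 * lp_psi p i = - \sum_i lp_psi p i.
  by rewrite -sumrN; apply: eq_bigr => i _; rewrite mulN1r.
rewrite /dot; lra.
Qed.

Lemma lpd_feas_dual p : lpd_feas V F p <-> lp_dual_feas lp_a lp_c (lpd_of_point p).
Proof.
have sum_unit (G : unit -> R) : \sum_u G u = G tt.
  by rewrite (bigD1 tt) //= big1 ?addr0 //; case.
have colv (y : I1 + unit -> R) v : \sum_u y u * lp_a u v =
    \sum_t y (inl (inl t)) * lp_a (inl (inl t)) v
    + \sum_j y (inl (inr j)) * lp_a (inl (inr j)) v + y (inr tt) * lp_a (inr tt) v.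
  by rewrite !big_sumType /= sum_unit.
have tag_sum (G : 'I_d -> (R -> R) -> R) :
    \sum_t lpd_of_point p (inl (inl t)) * G (tag t) (val (tagged t)) =
    \sum_i \sum_(f <- F i) lpd_y p i f * G i f.
  exact: (sum_tagged (fun i f => lpd_y p i f * G i f)).
have coll (l : V) : \sum_u lpd_of_point p u * lp_a u (inl (inl l)) =
    - \sum_i \sum_(f <- F i) lpd_y p i f * f (dot (vecp i) (val l))
    - dot (matQ D *m lpd_x p) (val l) - lpd_h0 p.
  rewrite colv /= mulr1; congr (_ + _ - _).
    rewrite -(tag_sum (fun i f => f (dot (vecp i) (val l)))) -sumrN.
    by apply: eq_bigr => t _; rewrite mulrN.
  by rewrite dot_mulmxl /dot -sumrN; apply: eq_bigr => j _; rewrite mulrN.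
have colk k : \sum_u lpd_of_point p u * lp_a u (inl (inr k)) = - (L_in D *m lpd_x p) k 0.
  rewrite colv /= mulr0 addr0 big1 ?add0r; last by move=> t _; rewrite mulr0.
  by rewrite mxE -sumrN; apply: eq_bigr => j _; rewrite mulrN mulrC.
have colk' k : \sum_u lpd_of_point p u * lp_a u (inr (inr k)) = (L_eq D *m lpd_x p) k 0.
  rewrite colv /= mulr0 addr0 big1 ?add0r; last by move=> t _; rewrite mulr0.
  by rewrite mxE; apply: eq_bigr => j _; rewrite mulrC.
have coli i : \sum_u lpd_of_point p u * lp_a u (inr (inl i)) = - \sum_(f <- F i) lpd_y p i f.
  rewrite colv /= mulr0 addr0 [X in _ + X]big1 ?addr0; last by move=> j _; rewrite mulr0.
  rewrite (tag_sum (fun i' _ => - (i' == i)%:R)) (bigD1 i) //=.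
  have -> : \sum_(i' | i' != i) \sum_(f <- F i') lpd_y p i' f * - (i' == i)%:R = 0.
    by apply: big1 => i' /negPf ->; rewrite big1 // => f _; rewrite oppr0 mulr0.
  by rewrite addr0 -sumrN; apply: eq_bigr => f _; rewrite eqxx mulrN1.
split=> [[[x0 xq xe] y0 sl y1]|[h0 hI hE]].
- split=> [[[i f]|j]|[l|k]|[i|k]].
  + exact/y0/valP.
  + by have := x0 j; rewrite mxE.
  + rewrite coll /=; have := sl (val l) (valP l); rewrite dotDl => ?; lra.
  + by rewrite colk lerN2; exact: xq.
  + by rewrite coli y1.
  + by rewrite colk' xe.
- split.
  + split.
    * by move=> j; rewrite mxE; exact: (h0 (inr j)).
    * by move=> k; have := hI (inr k); rewrite colk lerN2.
    * by apply/matrixP => k o; rewrite ord1; have := hE (inr k); rewrite colk'.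
  + by move=> i f fF; exact: (h0 (inl (fun_tag [` fF]%fset))).
  + by move=> l lV; have := hI (inl [` lV]%fset); rewrite coll /= dotDl => ?; lra.
  + by move=> i; have := hE (inl i); rewrite coli => /eqP; rewrite eqr_opp => /eqP.
Qed.

Lemma lpd_obj_fin p : lpd_obj F p = (dot (c1 D) (lpd_x p) - lpd_h0 p
  + \sum_i \sum_(f <- F i) lpd_y p i f * cf i f)%:E.
Proof.
rewrite /lpd_obj EFinD EFinB; congr (_ + _)%E; rewrite -sumEFin.
apply: eq_bigr => i _; rewrite -sumEFin big_seq [RHS]big_seq.
by apply: eq_bigr => f fF; rewrite EFinM (cfE fF).
Qed.

Lemma lpd_objE p : lpd_obj F p = (\sum_u lpd_of_point p u * lp_b u)%:E.
Proof.
have sum_unit (G : unit -> R) : \sum_u G u = G tt.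
  by rewrite (bigD1 tt) //= big1 ?addr0 //; case.
rewrite lpd_obj_fin !big_sumType /= sum_unit /=.
rewrite (sum_tagged (fun i f => lpd_y p i f * cf i f)) mulr1; congr EFin.
have -> : \sum_j lpd_x p j 0 * c1 D j 0 = dot (c1 D) (lpd_x p) by rewrite dotC.
lra.
Qed.

(** Both programs are feasible, so linear programming duality applies. *)
Lemma lp_strong : exists p pd, [/\ lp_feas V F p, lpd_feas V F pd &
  lpd_obj F pd = (lp_obj V p)%:E].
Proof.
have [VS [l0 [xin [xeq [l0V xi la]]]]] := gV.
have /choice[f0 f0F] := gF.1.
(* the unit mass at l0, with psi above all cuts *)
pose p0 : lp_point D := {| lp_nu := fun l => (l == l0)%:R;
  lp_psi := fun i => \sum_(f <- F i) `|cf i f + f (dot (vecp i) l0)|;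
  lp_xin := xin; lp_xeq := xeq |}.
have pick (E : nmodType) (G : vecl -> E) : \sum_(l <- V) G l *+ (l == l0) = G l0.
  rewrite (big_fsetD1 l0) //= eqxx big_seq big1 ?addr0 // => l /fsetD1P[/negPf -> _].
  by rewrite mulr0n.
have fp0 : lp_feas V F p0.
  split => //=.
  - move=> i f fF; rewrite (cfE fF) -EFinN -EFinB lee_fin.
    under eq_bigr do rewrite mulr_natr; rewrite pick (big_fsetD1 f) //=.
    apply: (@le_trans _ _ `|cf i f + f (dot (vecp i) l0)|).
      by rewrite -opprD -normrN; exact: ler_norm.
    by rewrite lerDl sumr_ge0.
  - under eq_bigr do rewrite scaler_nat; by rewrite pick.
  - exact: (pick R (fun=> 1)).
have [x0 Sx0] := S1_neq0 hD.
(* one function per coordinate, with h0 low enough for all points of V *)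
pose y0 i (f : R -> R) : R := (f == f0 i)%:R.
pose h0 := - \sum_(l <- V) `|dot (matQ D *m x0 + vecb D) l
  + \sum_i \sum_(f <- F i) y0 i f * f (dot (vecp i) l)|.
pose pd0 : lpd_point D := {| lpd_x := x0; lpd_h0 := h0; lpd_y := y0 |}.
have fd0 : lpd_feas V F pd0.
  split => //=.
  - move=> l lV; rewrite /h0 (big_fsetD1 l) //=.
    set A := dot _ _; set B := \sum_(i < d) _; set C := \sum_(_ <- _) _.
    have C0 : 0 <= C by apply: sumr_ge0.
    have := ler_norm (A + B) => ?; lra.
  - move=> i; rewrite (big_fsetD1 (f0 i)) //= /y0 eqxx big_seq big1 ?addr0 //.
    by move=> f /fsetD1P[/negPf ->].
have [z [y [pz dy e]]] := lp_duality ((lp_feas_primal p0).1 fp0) ((lpd_feas_dual pd0).1 fd0).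
have Ez : lp_of_point (point_of_lp z) = z by apply/funext; exact: lp_of_pointK.
have Ey : lpd_of_point (point_of_lpd y) = y by apply/funext; exact: lpd_of_pointK.
exists (point_of_lp z), (point_of_lpd y); split.
- by apply/lp_feas_primal; rewrite Ez.
- by apply/lpd_feas_dual; rewrite Ey.
- by rewrite lpd_objE lp_objE Ey Ez e.
Qed.

End LPInstance.

(** * Complementary slackness *)

Section OneIteration.
Context {R : realType} (D : problem R).
Hypothesis hD : standing_assumptions D.
Local Notation d := (ndim D).
Local Notation vecl := 'cV[R]_(m_in D + m_eq D).
Local Notation Rm := (measurableTypeR R).
Implicit Types (i : 'I_d) (l : vecl) (x : 'cV[R]_(k1 D)) (V : {fset vecl}).

Local Notation cf i f := (fine (conj_int i f)).

(** The conjugate is convex in the function, hence so is its integral. *)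
Lemma conj_int_convex i (I : Type) (r : seq I) (y : I -> R) (g : I -> R -> R) h :
  \sum_(u <- r) y u = 1 -> (forall u, 0 <= y u) -> (forall u, conj_ok i (g u)) ->
  conj_ok i (fun z => h + \sum_(u <- r) y u * g u z) ->
  cf i (fun z => h + \sum_(u <- r) y u * g u z) <= \sum_(u <- r) y u * cf i (g u) - h.
Proof.
move=> y1 y0 gok fok; have mO := @measurable_Omega1 R D i.
rewrite -lee_fin fineK; last exact: conj_int_fin.
have ic u : (marg i).-integrable (Omega1 i) (fun w => (y u)%:E * conjugate (g u) w)%E.
  by apply: integrableZl => //; exact: conj_integrable.
have is_ (s : seq I) : (marg i).-integrable (Omega1 i)
    (fun w => \sum_(u <- s) (y u)%:E * conjugate (g u) w)%E.
  exact: integrable_sum.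
have intE (s : seq I) : (\int[marg i]_(w in Omega1 i)
    (\sum_(u <- s) (y u)%:E * conjugate (g u) w)%E)%E = (\sum_(u <- s) y u * cf i (g u))%:E.
  elim: s => [|u s IH].
    by under eq_integral do rewrite big_nil; rewrite integral0 big_nil.
  under eq_integral do rewrite big_cons.
  rewrite integralD // IH big_cons EFinD EFinM fineK; last exact: conj_int_fin.
  by rewrite integralZl //; exact: conj_integrable.
have ih : (marg i).-integrable (Omega1 i) (EFin \o cst (- h)).
  by apply: (@integrable_bounded _ _ _ _ _ _ `|h|) => [//||w _ /=];
    [exact: measurable_cst | rewrite normrN].
rewrite EFinD -intE -(integral_cst1 (- h) mO (marg1 hD i)) -integralD //.
apply: le_integral => //.
- exact: conj_integrable.
- exact: integrableD.
- move=> w /set_mem wi; apply: ge_ereal_sup => _ [z _ <-].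
  have -> : (z * w - (h + \sum_(u <- r) y u * g u z))%:E =
      (\sum_(u <- r) (y u * (z * w - g u z))%R%:E + (- h)%R%:E)%E.
    rewrite sumEFin -EFinD; congr EFin.
    under [in RHS]eq_bigr do rewrite mulrBr.
    by rewrite sumrB -mulr_suml y1; ring.
  apply: leeD => //; apply: lee_sum => u _.
  by rewrite EFinM; apply: lee_wpmul2l; [rewrite lee_fin | exact: conjugate_lb].
Qed.

(** The functions of a run have their breakpoints at the values of the points of
    [V] and slopes between [lo] and [hi], so the integrals of their conjugates are
    finite. *)
Definition hinge_F V (F : 'I_d -> {fset (R -> R)}) : Prop :=
  (forall i, exists f, f \in F i) /\
  (forall i f, f \in F i -> hinge (lo i) (hi i) (kappas V i) f).

Lemma hinge_F_good V F : hinge_F V F -> good_F F.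
Proof. by move=> [F0 Fh]; split=> // i f /Fh /hinge_conj_bounded. Qed.

(** The function returned for a dual point; the constant is put on the first
    coordinate because only the sum of the constants matters. *)
Definition mixture (F : 'I_d -> {fset (R -> R)}) (pd : lpd_point D) i (z : R) : R :=
  (if i == 0%N :> nat then lpd_h0 pd else 0) + \sum_(f <- F i) lpd_y pd i f * f z.

Lemma sum_first (h : R) : \sum_(i < d) (if i == 0%N :> nat then h else 0) = h.
Proof.
have [[d2 _ _ _] _ _ _ _] := hD.
pose i0 : 'I_d := Ordinal (ltn_trans (ltn0Sn 0) d2).
by rewrite (bigD1 i0) //= big1 ?addr0 // => i; rewrite -val_eqE /= => /negPf ->.
Qed.

Lemma mixtureE F pd i : mixture F pd i =
  fun z => (if i == 0%N :> nat then lpd_h0 pd else 0)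
    + \sum_(u : F i) lpd_y pd i (val u) * val u z.
Proof. by apply/funext => z; rewrite /mixture big_seq_fsetE. Qed.

Lemma mixture_hinge V F pd i : hinge_F V F -> lpd_feas V F pd ->
  hinge (lo i) (hi i) (kappas V i) (mixture F pd i).
Proof.
move=> [_ Fh] [_ y0 _ y1].
rewrite mixtureE; apply: hinge_sum => [|u|u].
- by rewrite -[RHS](y1 i) [RHS]big_seq_fsetE.
- exact/y0/valP.
- exact/Fh/valP.
Qed.

Lemma mixture_slack F pd l : slack (lpd_x pd) (mixture F pd) l =
  dot (matQ D *m lpd_x pd + vecb D) l + lpd_h0 pd
  + \sum_(i < d) \sum_(f <- F i) lpd_y pd i f * f (dot (vecp i) l).
Proof. by rewrite /slack /mixture big_split /= sum_first addrA. Qed.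

Lemma mixture_conj V F pd : hinge_F V F -> lpd_feas V F pd ->
  \sum_i cf i (mixture F pd i) <=
  \sum_i \sum_(f <- F i) lpd_y pd i f * cf i f - lpd_h0 pd.
Proof.
move=> hF fd; have [_ Fh] := hF; have [_ y0 _ y1] := fd.
rewrite -[X in _ <= _ - X](sum_first (lpd_h0 pd)) -sumrB; apply: ler_sum => i _.
have := hinge_conj_bounded (mixture_hinge i hF fd); rewrite mixtureE big_seq_fsetE => ok.
apply: conj_int_convex => //.
- by rewrite -[RHS](y1 i) [RHS]big_seq_fsetE.
- by move=> u; exact/y0/valP.
- by move=> u; exact/hinge_conj_bounded/(Fh _ _ (valP u)).
Qed.

(** The difference of the two objectives is a sum of nonnegative terms, one for
    each group of constraints, so that all of them vanish at optimal points. *)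
Lemma lp_complementary V F p pd : good_F F -> lp_feas V F p -> lpd_feas V F pd ->
  ((lp_obj V p)%:E <= lpd_obj F pd)%E /\
  (lpd_obj F pd = (lp_obj V p)%:E ->
  \sum_(l <- V) lp_nu p l * slack (lpd_x pd) (mixture F pd) l = 0 /\
  dot (c1 D) (lpd_x pd) = \sum_(l <- V) lp_nu p l * dot (vecb D) l
    + \sum_i \sum_(l <- V) lp_nu p l * mixture F pd i (dot (vecp i) l)
    + dot (q_in D) (lp_xin p) + dot (q_eq D) (lp_xeq p)).
Proof.
move=> gF [nu0 xi ps la nu1] [Sx y0 sl y1].
set x := lpd_x pd in Sx sl *; set nu := lp_nu p in nu0 ps la nu1 *.
have fst_ := first_stage_weak (x := x) (xeq := lp_xeq p) Sx xi
  (a := fun j => (\sum_(l <- V) nu l *: ((matQ D)^T *m l)) j 0).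
have {fst_} : dot (q_in D) (lp_xin p) + dot (q_eq D) (lp_xeq p) <=
    dot (c1 D) x + \sum_(l <- V) nu l * dot (matQ D *m x) l.
  apply: le_trans (fst_ _) _; first by move=> j; have := la j; rewrite [X in _ <= X]mxE.
  rewrite lerD2l -/(dot x (\sum_(l <- V) nu l *: ((matQ D)^T *m l))) dot_sumr.
  by apply: ler_sum => l _; rewrite dotZr -dot_mulmxl.
set T1 := \sum_(l <- V) nu l * dot (matQ D *m x) l.
set qx := dot (q_in D) _; set qe := dot (q_eq D) _ => fst_.
set bE := \sum_(l <- V) nu l * dot (vecb D) l.
set M := \sum_i \sum_(l <- V) nu l * mixture F pd i (dot (vecp i) l).
have slE : \sum_(l <- V) nu l * slack x (mixture F pd) l = T1 + bE + M.
  rewrite /M exchange_big /= -!big_split /=; apply: eq_bigr => l _.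
  by rewrite /slack dotDl -mulr_sumr !mulrDr.
have sle0 : T1 + bE + M <= 0.
  rewrite -slE big_seq; apply: sumr_le0 => l lV.
  by rewrite mulr_ge0_le0 ?nu0 // mixture_slack sl.
pose Y := \sum_i \sum_(f <- F i) lpd_y pd i f * cf i f.
have ME : M = lpd_h0 pd + \sum_i \sum_(f <- F i) lpd_y pd i f *
    \sum_(l <- V) nu l * f (dot (vecp i) l).
  rewrite -[lpd_h0 pd in RHS]sum_first -big_split /=; apply: eq_bigr => i _.
  under [LHS]eq_bigr do rewrite /mixture mulrDr.
  rewrite big_split /= -mulr_suml nu1 mul1r; congr (_ + _).
  under [LHS]eq_bigr do rewrite mulr_sumr.
  rewrite exchange_big /=; apply: eq_bigr => f _.
  by rewrite mulr_sumr; apply: eq_bigr => l _; rewrite mulrCA.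
have third : 0 <= \sum_i lp_psi p i + Y + (M - lpd_h0 pd).
  rewrite ME [lpd_h0 pd + _]addrC addrK -!big_split /=; apply: sumr_ge0 => i _.
  rewrite -[lp_psi p i]mul1r -(y1 i) mulr_suml -!big_split big_seq /=.
  apply: sumr_ge0 => f fF; rewrite -!mulrDr mulr_ge0 ?y0 //.
  have := ps i f fF; rewrite (cfE gF fF) -EFinN -EFinB lee_fin.
  by under eq_bigr do rewrite mulrC; move=> ?; lra.
rewrite (lpd_obj_fin gF) -/x -/Y.
rewrite /lp_obj -/nu -/qx -/qe; have -> : \sum_(l <- V) dot (vecb D) l * nu l = bE.
  by apply: eq_bigr => l _; rewrite mulrC.
rewrite slE lee_fin; split=> [|[fourth]]; [lra | split; lra].
Qed.

End OneIteration.

(** * The inner algorithm *)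

(** Pigeonhole principle on a grid of mesh smaller than [e]. *)
Lemma pigeonhole_close (R : realType) (T : finType) (u : nat -> T -> R) (e : R) :
  (forall t x, 0 <= u t x <= 1) -> 0 < e ->
  exists s t, (s < t)%N /\ forall x, `|u s x - u t x| <= e.
Proof.
move=> u01 e0; pose N := (Num.truncn e^-1).+1.
have e1 : 0 <= e^-1 by rewrite invr_ge0 ltW.
have Ne : e^-1 < N%:R by have /andP[] := truncn_itv e1.
pose cell t x : 'I_N.+1 := inord (Num.truncn (N%:R * u t x)).
have cellE t x : (cell t x : nat)%:R <= N%:R * u t x < (cell t x).+1%:R.
  have /andP[a b] := u01 t x.
  have Nu0 : 0 <= N%:R * u t x by rewrite mulr_ge0.
  rewrite inordK; first exact: truncn_itv.
  rewrite ltnS -(ler_nat R); have /andP[h _] := truncn_itv Nu0; apply: le_trans h _.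
  by rewrite ler_piMr.
pose code (t : 'I_(#|{ffun T -> 'I_N.+1}|.+1)) := [ffun x => cell t x].
have /injectivePn[s [t st E]] : ~~ injectiveb code.
  by apply/injectiveP => /leq_card; rewrite card_ord ltnn.
have close a b x : cell a x = cell b x -> `|u a x - u b x| <= e.
  move=> ab; have := cellE a x; have := cellE b x; rewrite ab => /andP[p q] /andP[p' q'].
  have N0 : 0 < N%:R :> R by rewrite ltr0n.
  have : N%:R * `|u a x - u b x| <= 1.
    rewrite -{1}[N%:R]gtr0_norm // -normrM mulrBr ler_norml.
    by move: q q'; rewrite -natr1 => *; apply/andP; split; lra.
  move=> h; have : `|u a x - u b x| <= N%:R^-1 by rewrite -[leRHS]mulr1 ler_pdivlMl.
  by move=> /le_trans; apply; rewrite invf_ple ?posrE // ltW.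
have cells x : cell s x = cell t x by move/ffunP/(_ x): E; rewrite !ffunE.
have [lt|gt|eq] := ltngtP s t.
- by exists s, t; split=> // x; apply: close.
- by exists t, s; split=> // x; apply: close.
- by move: st; rewrite (val_inj eq) eqxx.
Qed.

Section InnerAlgorithm.
Context {R : realType} (D : problem R).
Hypothesis hD : standing_assumptions D.
Local Notation d := (ndim D).
Local Notation vecl := 'cV[R]_(m_in D + m_eq D).
Local Notation Rm := (measurableTypeR R).
Local Notation law := (probability (borel_cV R (m_in D + m_eq D)) R).
Implicit Types (i : 'I_d) (l : vecl) (x : 'cV[R]_(k1 D)) (tau : law).
Local Notation cf i f := (fine (conj_int i f)).

Variables (V : {fset vecl}) (e : R).
Hypothesis gV : good_V V.

Lemma good_V_neq0 : exists l, l \in V.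
Proof. by have [_ [l [xin [xeq [lV _ _]]]]] := gV; exists l. Qed.

Lemma fstarV_hinge tau i : hinge (lo i) (hi i) (kappas V i) (fstar V tau i).
Proof.
by have [l lV] := good_V_neq0; exact: (fstar_hinge (lohi hD) (marg1 hD) tau i lV).
Qed.

Lemma init1_exists : exists F, init1 V F.
Proof.
have K0 : (0 < #|` V|)%N.
  by have [l lV] := good_V_neq0; rewrite cardfs_gt0; apply/fset0Pn; exists l.
have [||tau dtau] := @exists_discrete_law _ _ V (fun=> (#|` V|)%:R^-1 : R).
- by move=> l _; rewrite invr_ge0.
- rewrite big_const_seq count_predT iter_addr_0 -[LHS]mulr_natr mulVf //.
  by rewrite pnatr_eq0 -lt0n.
by exists (fun i => [fset fstar V tau i]%fset), tau.
Qed.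

Lemma reaches1_hinge r t : (0 < t)%N -> reaches1 V e r t -> hinge_F V (i1_F (r t)).
Proof.
case: t => // t _; elim: t => [|t IH] [in1 steps].
  have [tau0 [_ F1]] := in1; split=> [i|i f]; rewrite F1; first by exists (fstar V tau0 i); rewrite inE.
  by rewrite inE => /eqP ->; exact: fstarV_hinge.
have [|F0 Fh] := IH.
  by split => //; move=> u /andP[u0 ut]; apply: steps; rewrite u0 ltnW.
have [_ _ FE] := steps t.+1 (leqnn _).
split=> [i|i f]; rewrite FE.
  by have [f fF] := F0 i; exists f; rewrite inE fF.
by rewrite !inE => /orP[/Fh //|/eqP ->]; exact: fstarV_hinge.
Qed.

Lemma reaches1_mem r s t i : (0 < s < t)%N -> reaches1 V e r t ->
  fstar V (i1_tau (r s)) i \in i1_F (r t) i.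
Proof.
move=> + [_ steps]; elim: t steps => [|t IH] steps /andP[s0]; first by rewrite ltn0.
have step u : (0 < u < t.+1)%N -> _ := fun h => let: And3 _ _ FE := steps u h in FE i.
rewrite ltnS leq_eqVlt => /orP[/eqP E|st].
  by rewrite (step t) ?E -?E ?s0 ?leqnn // !inE eqxx orbT.
rewrite (step t) ?(leq_ltn_trans _ st) ?leqnn // inE IH ?s0 // => u /andP[u0 ut].
by apply: steps; rewrite u0 ltnW.
Qed.

Lemma body1_exists F : hinge_F V F -> exists it, i1_F it = F /\ body1 V it.
Proof.
move=> /hinge_F_good gF; have [p [pd [fp fd E]]] := lp_strong hD gV gF.
have [nu0 _ _ _ nu1] := fp; have [tau dtau] := exists_discrete_law nu0 nu1.
exists (Iter1 F p pd tau); split => //; split => //=; split => //.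
- move=> p' fp'; rewrite -lee_fin -E.
  by case: (lp_complementary hD gF fp' fd).
- by move=> pd' fd'; rewrite E; case: (lp_complementary hD gF fp fd').
Qed.

Section Body.
Variable it : iter1 D.
Hypotheses (hF : hinge_F V (i1_F it)) (bd : body1 V it).
Let nu := lp_nu (i1_lp it).
Let tau := i1_tau it.

Lemma body1_nu0 l : l \in V -> 0 <= nu l. Proof. by case: bd => -[[+ _ _ _ _] _] _ _; apply. Qed.
Lemma body1_nu1 : \sum_(l <- V) nu l = 1. Proof. by case: bd => -[[_ _ _ _ +] _]. Qed.
Lemma body1_law : discrete_law V nu tau. Proof. by case: bd. Qed.

Lemma body1_strong : lpd_obj (i1_F it) (i1_lpd it) = (lp_obj V (i1_lp it))%:E.
Proof.
have gF := hinge_F_good hF; have [[fp op] [fd od] _] := bd.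
have [p [pd [fp' fd' E]]] := lp_strong hD gV gF.
apply/eqP; rewrite eq_le (lp_complementary hD gF fp fd).1 andbT.
by rewrite (le_trans (od _ fd')) // E lee_fin op.
Qed.

Lemma eps1E i : eps1 V it i = (fine (OT i (push tau i)) - lp_psi (i1_lp it) i)%:E.
Proof.
rewrite EFinB fineK ?(OT_push_fin hD body1_nu0 body1_nu1 body1_law) //.
by rewrite (OT_push_discrete hD body1_nu0 body1_nu1 body1_law).
Qed.

(** Weak transport duality, which is why adding [f] to the family gives a valid
    cut. *)
Lemma fine_OT_le i f : hinge (lo i) (hi i) (kappas V i) f ->
  - cf i f - \sum_(l <- V) nu l * f (dot (vecp i) l) <= fine (OT i (push tau i)).
Proof.
move=> hf; have [cont _] := hinge_C_cvx hf.
have mf : measurable_fun setT (f : Rm -> Rm) by exact: continuous_measurable_fun.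
have fin := conj_int_fin (hinge_conj_bounded hf).
have ti := integrable_discrete body1_nu0 body1_law (measurable_dot (vecp i)).
have mfd := measurableT_comp mf (measurable_dot (vecp i)).
have tfi := integrable_discrete body1_nu0 body1_law mfd.
have := OT_weak (marg1 hD) mf ti tfi.
rewrite (push_int_discrete body1_nu0 body1_law i cont) -{1}(fineK fin).
rewrite -(fineK (OT_push_fin hD body1_nu0 body1_nu1 body1_law i)).
by rewrite -EFinN -EFinB lee_fin.
Qed.

Lemma fine_OTE i : fine (OT i (push tau i)) = - cf i (fstar V tau i)
  - \sum_(l <- V) nu l * fstar V tau i (dot (vecp i) l).
Proof.
have hf := fstarV_hinge tau i.
rewrite (OT_push_discrete hD body1_nu0 body1_nu1 body1_law).
rewrite (push_int_discrete body1_nu0 body1_law i); last by case: (hinge_C_cvx hf).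
by rewrite -[conj_int i _]fineK ?(conj_int_fin (hinge_conj_bounded hf)).
Qed.

Lemma psi_ge i f : f \in i1_F it i ->
  - cf i f - \sum_(l <- V) nu l * f (dot (vecp i) l) <= lp_psi (i1_lp it) i.
Proof.
move=> fF; have [[[_ _ ps _ _] _] _ _] := bd; have := ps i f fF.
rewrite (cfE (hinge_F_good hF) fF) -EFinN -EFinB lee_fin.
by under eq_bigr do rewrite mulrC.
Qed.

End Body.

(** The function found in an earlier iteration is a cut in all later ones, so
    the error of iteration [itt] is at most its increase when the measure moves
    from the one of [itt] to the one of [its]. *)
Lemma eps1_gap (its itt : iter1 D) i :
  hinge_F V (i1_F its) -> body1 V its -> hinge_F V (i1_F itt) -> body1 V itt ->
  fstar V (i1_tau its) i \in i1_F itt i ->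
  (eps1 V itt i <= (\sum_(l <- V) (lp_nu (i1_lp its) l - lp_nu (i1_lp itt) l) *
    (fstar V (i1_tau itt) i (dot (vecp i) l) - fstar V (i1_tau its) i (dot (vecp i) l)))%:E)%E.
Proof.
move=> hs bs ht bt fF; rewrite (eps1E bt) lee_fin.
have := fine_OT_le bs (fstarV_hinge (i1_tau itt) i).
rewrite (fine_OTE bs) (fine_OTE bt); have := psi_ge ht bt fF.
have arith (p q f g : vecl -> R) (A B psi : R) :
    - B - \sum_(l <- V) q l * g l <= psi ->
    - A - \sum_(l <- V) p l * f l <= - B - \sum_(l <- V) p l * g l ->
    - A - \sum_(l <- V) q l * f l - psi <= \sum_(l <- V) (p l - q l) * (f l - g l).
  have -> : \sum_(l <- V) (p l - q l) * (f l - g l) =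
      \sum_(l <- V) p l * f l - \sum_(l <- V) p l * g l
      - (\sum_(l <- V) q l * f l - \sum_(l <- V) q l * g l).
    by rewrite -!sumrB; apply: eq_bigr => l _; ring.
  by move=> ? ?; lra.
exact: arith.
Qed.

(** [fstar] vanishes at the first breakpoint, so that this bounds it whatever the
    law is. *)
Definition fstar_bound i l : R :=
  (`|lo i| + `|hi i|) * `|dot (vecp i) l - (kappas V i)`_0|.

Lemma fstar_le_bound tau i l : l \in V ->
  `|fstar V tau i (dot (vecp i) l)| <= fstar_bound i l.
Proof.
move=> lV; have sl := hinge_slopes (fstarV_hinge tau i).
have k0 : fstar V tau i (kappas V i)`_0 = 0.
  rewrite /fstar; case: (kappas V i) => //= k ks.
  by rewrite lexx subrr mulr0.
have kl : (kappas V i)`_0 <= dot (vecp i) l.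
  have := mem_kappas i lV; have := kappas_sorted V i.
  case: (kappas V i) => // k ks /= /(order_path_min le_trans)/allP kmin.
  by rewrite inE => /orP[/eqP <-//|/kmin].
have := sl _ _ kl; rewrite k0 subr0 /fstar_bound => /andP[].
set y := fstar _ _ _ _; set z := dot _ _ - _ => a b.
have z0 : 0 <= z by rewrite subr_ge0.
rewrite (ger0_norm z0); have := ler_norm (- lo i); have := ler_norm (hi i).
rewrite normrN => h1 h2.
have := ler_wpM2r z0 h1; have := ler_wpM2r z0 h2.
have := mulr_ge0 (normr_ge0 (lo i)) z0; have := mulr_ge0 (normr_ge0 (hi i)) z0.
rewrite mulNr => ? ? ? ?; rewrite ler_norml mulrDl; apply/andP; split; lra.
Qed.

Hypothesis e0 : 0 < e.

(** Two of the discrete measures of an infinite run are as close as desired,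
    which makes the error of the later one small. *)
Lemma no_infinite_run1 r : ~ (forall t, reaches1 V e r t).
Proof.
move=> reach.
have hF t : (0 < t)%N -> hinge_F V (i1_F (r t)) by move=> t0; exact: reaches1_hinge.
have bd t : (0 < t)%N -> body1 V (r t).
  by move=> t0; have [_ /(_ t)[|//]] := reach t.+1; rewrite t0 leqnn.
have ns t : (0 < t)%N -> ~ stop1 V e (r t).
  by move=> t0; have [_ /(_ t)[|//]] := reach t.+1; rewrite t0 leqnn.
pose B := \sum_i \sum_(l <- V) (fstar_bound i l + fstar_bound i l).
have b0 i l : 0 <= fstar_bound i l + fstar_bound i l.
  by rewrite addr_ge0 // mulr_ge0 // addr_ge0.
have B0 : 0 <= B by apply: sumr_ge0 => i _; exact: sumr_ge0.
pose u t (l : V) := lp_nu (i1_lp (r t.+1)) (val l).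
have u01 t (l : V) : 0 <= u t l <= 1.
  have hf := hF t.+1 (ltn0Sn t); have bt := bd t.+1 (ltn0Sn t).
  rewrite (body1_nu0 bt (valP l)) /= -(body1_nu1 bt) (big_fsetD1 (val l)) ?valP //=.
  rewrite lerDl big_seq; apply: sumr_ge0 => l' /fsetD1P[_ l'V].
  exact: (body1_nu0 bt).
(* B bounds the variation of two functions [fstar] summed over V *)
have dlt0 : 0 < e / (B + 1) by rewrite divr_gt0 // ltr_wpDl.
have [s [t [st close]]] := pigeonhole_close u01 dlt0.
have s0 := ltn0Sn s; have t0 := ltn0Sn t.
apply: (ns t.+1 t0); rewrite /stop1; apply: bigmax_le => [|i _]; first exact: leNye.
have fF : fstar V (i1_tau (r s.+1)) i \in i1_F (r t.+1) i by apply: reaches1_mem (reach _).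
apply: le_trans (eps1_gap (hF _ s0) (bd _ s0) (hF _ t0) (bd _ t0) fF) _.
rewrite lee_fin; apply: (@le_trans _ _ (e / (B + 1) * B)); last first.
  rewrite -mulrA [_^-1 * _]mulrC ler_piMr ?(ltW e0) //.
  by rewrite ler_pdivrMr ?ltr_wpDl // mul1r lerDl.
apply: (@le_trans _ _ (e / (B + 1) * \sum_(l <- V) (fstar_bound i l + fstar_bound i l))); last first.
  apply: ler_wpM2l; first exact: ltW.
  by rewrite /B (bigD1 i) //= lerDl; apply: sumr_ge0 => j _; exact: sumr_ge0.
rewrite mulr_sumr big_seq [leRHS]big_seq; apply: ler_sum => l lV.
apply: le_trans (ler_norm _) _; rewrite normrM; apply: ler_pM => //.
  exact: (close [` lV]%fset).
by apply: le_trans (ler_normB _ _) _; apply: lerD; exact: fstar_le_bound.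
Qed.

Lemma terminates1P : terminates1 V e.
Proof.
split; [exact: init1_exists | move=> r t t0 rt | exact: no_infinite_run1].
exact/body1_exists/(reaches1_hinge t0 rt).
Qed.

(** What the outer algorithm uses of an output of the inner one. The last two
    facts are complementary slackness in the linear programs. *)
Record output_facts (o : out1 D) (w : vecl -> R) : Prop := {
  of_w0 : forall l, l \in V -> 0 <= w l;
  of_w1 : \sum_(l <- V) w l = 1;
  of_law : discrete_law V w (o_tau o);
  of_x : S1 D (o_x o);
  of_xin : vle (o_xin o) 0;
  of_dual : vle ((L_in D)^T *m o_xin o + (L_eq D)^T *m o_xeq o)
                (c1 D + \sum_(l <- V) w l *: ((matQ D)^T *m l));
  of_hinge : forall i, hinge (lo i) (hi i) (kappas V i) (o_f o i);
  of_LB : o_LB o = dual_obj D (o_tau o, o_xin o, o_xeq o);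
  of_gap : dot (c1 D) (o_x o) + \sum_i cf i (o_f o i) <=
    fine (o_LB o) + d%:R * e;
  of_slack_le0 : forall l, l \in V -> slack (o_x o) (o_f o) l <= 0;
  of_slack0 : \sum_(l <- V) w l * slack (o_x o) (o_f o) l = 0;
  of_c1 : dot (c1 D) (o_x o) = \sum_(l <- V) w l * dot (vecb D) l
    + \sum_i \sum_(l <- V) w l * o_f o i (dot (vecp i) l)
    + dot (q_in D) (o_xin o) + dot (q_eq D) (o_xeq o) }.

Lemma output1_facts o : output1 V e o -> exists w, output_facts o w.
Proof.
move=> [r [t [t0 rt bd sp ->]]]; have hF := reaches1_hinge t0 rt.
have gF := hinge_F_good hF; have st := body1_strong hF bd.
have [[fp op] [fd od] _] := bd; have [nu0 xi _ la nu1] := fp.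
have [_ /(_ st)[cs1 cs2]] := lp_complementary hD gF fp fd.
have VS := gV.1.
have LBE : o_LB (result1 V (r t)) = (lp_obj V (i1_lp (r t))
    - \sum_i (fine (OT i (push (i1_tau (r t)) i)) - lp_psi (i1_lp (r t)) i))%:E.
  rewrite /= EFinB; congr (_ - _)%E; rewrite -sumEFin.
  by apply: eq_bigr => i _; rewrite (eps1E bd).
exists (lp_nu (i1_lp (r t))); split => //.
- exact: (body1_law bd).
- by have [] := fd.
- by move=> i; exact: mixture_hinge hF fd.
- rewrite LBE; apply/esym/(etrans (dual_obj_discrete hD nu0 nu1 (body1_law bd) VS _ _)).
  congr EFin; rewrite /lp_obj /=.
  rewrite sumrB; under eq_bigr do rewrite mulrC.
  by ring.
- rewrite LBE [fine _]/=; have := mixture_conj hD hF fd => mc.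
  have eps i : fine (OT i (push (i1_tau (r t)) i)) - lp_psi (i1_lp (r t)) i <= e.
    by rewrite -lee_fin -(eps1E bd); apply: le_trans (le_bigmax _ _ i) sp.
  have : \sum_i (fine (OT i (push (i1_tau (r t)) i)) - lp_psi (i1_lp (r t)) i) <= d%:R * e.
    apply: (@le_trans _ _ (\sum_(i < d) e)); first by apply: ler_sum.
    by rewrite sumr_const card_ord mulr_natl.
  move: st; rewrite (lpd_obj_fin gF) => -[].
  rewrite /= -/(mixture (i1_F (r t)) (i1_lpd (r t))) => ? ?.
  lra.
- by move=> l lV; rewrite [slack _ _ _](mixture_slack hD); have [_ _ + _] := fd; apply.
Qed.

End InnerAlgorithm.

(** * Second-stage geometry *)

Section SecondStage.
Context {R : realType} (D : problem R).
Hypothesis hD : standing_assumptions D.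
Local Notation d := (ndim D).
Local Notation vecl := 'cV[R]_(m_in D + m_eq D).
Local Notation law_omega := (probability (borel_cV R d) R).
Implicit Types (i : 'I_d) (l u : vecl) (x : 'cV[R]_(k1 D)).

Lemma le0_of_bounded (a b M : R) : (forall s, 0 <= s -> a + s * b <= M) -> b <= 0.
Proof.
move=> ab; rewrite leNgt; apply/negP => b0.
have := ab (`|M - a| / b + 1); rewrite addr_ge0 ?divr_ge0 ?(ltW b0) // => /(_ isT).
rewrite mulrDl divfK ?gt_eqF // mul1r; have := ler_norm (M - a) => ? ?; lra.
Qed.

(** Otherwise the second-stage cost would be infinite. *)
Lemma cost_recc x v u : S1 D x -> Omega v -> recc (S2 (D := D)) u ->
  dot (matQ D *m x + matP D *m v + vecb D) u <= 0.
Proof.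
move=> Sx Ov ru; have [M CM] := C2_ub hD; have [l0 Sl0] := S2_neq0 hD.
apply: (@le0_of_bounded (dot (matQ D *m x + matP D *m v + vecb D) l0) _ M) => s s0.
rewrite -dotZr -dotDr -lee_fin; apply: le_trans (CM x v Sx Ov).
by apply: ereal_sup_ubound; exists (l0 + s *: u) => //; exact: ru.
Qed.

(** The increment of [fs i] over an increment [p] of its argument is at most
    [v i * p] for one of the endpoints [v i] of its interval of slopes; the
    resulting [v] is a scenario, to which [cost_recc] applies. *)
Lemma slack_recc x (fs : 'I_d -> R -> R) l u : S1 D x ->
  (forall i, slopes_in (lo i) (hi i) (fs i)) -> recc (S2 (D := D)) u ->
  slack x fs (l + u) <= slack x fs l.
Proof.
move=> Sx fsl ru.
pose v : 'cV[R]_d := \col_i (if 0 <= dot (vecp i) u then hi i else lo i).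
have Ov : Omega v.
  move=> i; rewrite /Omega1 /= in_itv /= mxE; have := lohi hD i.
  by case: ifP => _ h; rewrite h lexx.
have := cost_recc Sx Ov ru; rewrite dot_cost /slack dotDr.
have : \sum_i fs i (dot (vecp i) (l + u)) - \sum_i fs i (dot (vecp i) l) <=
    \sum_i v i 0 * dot (vecp i) u.
  rewrite -sumrB; apply: ler_sum => i _; rewrite mxE dotDr.
  set p := dot _ l; set q := dot _ u; case: ifP => [q0|/negbT].
    by have /andP[_] := fsl i p (p + q) ltac:(lra); rewrite [p + q - p]addrC addKr.
  rewrite -ltNge => q0; have /andP[+ _] := fsl i (p + q) p ltac:(lra).
  by rewrite opprD addNKr => ?; lra.
by move=> ? ?; lra.
Qed.

Lemma slack_convex x fs l u t : (forall i, C_cvx (fs i)) -> 0 <= t <= 1 ->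
  slack x fs (t *: l + (1 - t) *: u) <= Num.max (slack x fs l) (slack x fs u).
Proof.
move=> fc t01; have /andP[t0 t1] := t01.
apply: (@le_trans _ _ (t * slack x fs l + (1 - t) * slack x fs u)).
  rewrite /slack dotDr !dotZr !mulrDr addrACA lerD2l !mulr_sumr -big_split /=.
  apply: ler_sum => i _; rewrite dotDr !dotZr.
  by have [_ /convex_functionP] := fc i; apply.
set m := Num.max _ _; apply: (@le_trans _ _ (t * m + (1 - t) * m)); last by lra.
by apply: lerD; apply: ler_wpM2l; rewrite ?subr_ge0 // /m le_max lexx ?orbT.
Qed.

Lemma V_extr_finite : finite_set (V_extr D).
Proof.
rewrite /V_extr S2_polyhedron; apply: finite_extr.
by rewrite -S2_polyhedron; exact: S2_neq0.
Qed.

Lemma V_extr_S2 l : V_extr D l -> S2 l.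
Proof. by move=> [[]]. Qed.

(** The violation is a convex function that does not increase along the
    recession directions of the feasible set. *)
Lemma vio_attained x fs : S1 D x -> (forall i, C_cvx (fs i)) ->
  (forall i, slopes_in (lo i) (hi i) (fs i)) ->
  exists2 l, V_extr D l & vio x fs = (slack x fs l)%:E.
Proof.
move=> Sx fc fsl.
have dom l : S2 l -> exists2 e, V_extr D e & slack x fs l <= slack x fs e.
  rewrite /V_extr S2_polyhedron => Sl; apply: extreme_dominates => //.
  - by move=> y z t t01; exact: slack_convex.
  - by move=> l' u _ ru; apply: slack_recc => //; rewrite S2_polyhedron.
have [l0 Sl0] := S2_neq0 hD; have [e0 Ve0 _] := dom l0 Sl0.
pose VE := fset_set (V_extr D).
have inVE l : (l \in VE) = (l \in V_extr D) by rewrite in_fset_set //; exact: V_extr_finite.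
have e0V : e0 \in VE by rewrite inVE mem_set.
pose e1 : VE := [arg max_(l > [` e0V]%fset) slack x fs (val l)]%O.
have e1P (l : VE) : slack x fs (val l) <= slack x fs (val e1).
  by rewrite /e1; case: arg_maxP => // e _; apply.
have Ve1 : V_extr D (val e1) by apply/set_mem; rewrite -inVE; exact: valP.
exists (val e1) => //; apply/eqP; rewrite eq_le; apply/andP; split.
  apply: ge_ereal_sup => _ [l Sl <-]; rewrite lee_fin.
  have [e Ve le] := dom l Sl; apply: le_trans le _.
  have eV : e \in VE by rewrite inVE mem_set.
  exact: (e1P [` eV]%fset).
by apply: ereal_sup_ubound; exists (val e1) => //; exact: V_extr_S2.
Qed.

(** If no starting point existed, Farkas' lemma would give a direction in which
    the first-stage decision can move forever while the cost decreases
    linearly. *)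
Lemma init2_exists : (-oo < C_DRO D)%E -> exists V, init2 (D := D) V.
Proof.
move=> CD.
pose I := (('I_(m_in D) + 'I_(k2 D)) + ('I_(n_in D) + 'I_(k1 D)))%type.
pose J := ('I_(m_in D + m_eq D) + ('I_(n_in D) + 'I_(n_eq D)))%type.
pose a (r : I) (j : J) : R := match r, j with
  | inl k, inl j => S2_row k j 0
  | inl k, inr _ => 0
  | inr (inl k), inr (inl k') => (k == k')%:R
  | inr (inl k), _ => 0
  | inr (inr h), inl j => - matQ D j h
  | inr (inr h), inr (inl k) => L_in D k h
  | inr (inr h), inr (inr k) => L_eq D k h end.
pose b (r : I) : R := match r with
  | inl k => S2_rhs k | inr (inl _) => 0 | inr (inr h) => c1 D h 0 end.
have sum0 n (G : 'I_n -> R) : \sum_k 0 * G k = 0 by rewrite big1 // => k _; rewrite mul0r.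
have sum0' (T : finType) (G : T -> R) : \sum_k G k * 0 = 0 by rewrite big1 // => k _; rewrite mulr0.
(* the unknowns are l, xin and xeq *)
case: (farkas a b) => [[z zP]|[y [y0 yA yb]]].
  pose l0 : vecl := \col_j z (inl j); pose xin := \col_k z (inr (inl k)).
  pose xeq := \col_k z (inr (inr k)).
  exists [fset l0]%fset, l0, xin, xeq; split => //.
  - rewrite S2_polyhedron => k; have := zP (inl k).
    rewrite !big_sumType /= !sum0 !addr0; congr (_ <= _).
    by apply: eq_bigr => j _; rewrite mxE.
  - move=> k; have := zP (inr (inl k)); rewrite !big_sumType /= !sum0 addr0 add0r !mxE.
    by rewrite (bigD1 k) //= eqxx mul1r big1 ?addr0 // => k' /negPf; rewrite eq_sym => ->; rewrite mul0r.
  - move=> h; have := zP (inr (inr h)); rewrite !big_sumType /= !mxE.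
    under [X in _ -> X + _ <= _]eq_bigr do rewrite !mxE.
    under [X in _ -> _ + X <= _]eq_bigr do rewrite !mxE.
    under [X in _ -> _ <= _ + X]eq_bigr do rewrite !mxE.
    under [X in X + _ <= _ -> _]eq_bigr do rewrite mulNr.
    by rewrite sumrN => ?; lra.
pose x := \col_h y (inr (inr h)).
have colE j : \sum_r y r * a r j =
    \sum_k y (inl k) * a (inl k) j + (\sum_k y (inr (inl k)) * a (inr (inl k)) j
    + \sum_h y (inr (inr h)) * a (inr (inr h)) j).
  by rewrite big_sumType /= [X in _ + X = _]big_sumType.
have Qx l : dot (matQ D *m x) l = \sum_k y (inl k) * dot (S2_row k) l.
  under eq_bigr do rewrite mulr_sumr; rewrite exchange_big /=; apply: eq_bigr => j _.
  under eq_bigr do rewrite mulrA; rewrite -mulr_suml; congr (_ * _).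
  have := yA (inl j); rewrite colE /= sum0' add0r.
  under [X in _ + X = _]eq_bigr do rewrite mulrN; rewrite sumrN => /eqP.
  rewrite subr_eq0 => /eqP ->; rewrite mxE; apply: eq_bigr => h _.
  by rewrite mxE mulrC.
have Lx k : (L_in D *m x) k 0 <= 0.
  have := yA (inr (inl k)); rewrite colE /= sum0' add0r (bigD1 k) //= eqxx mulr1.
  have -> : \sum_(k' | k' != k) y (inr (inl k')) * (k' == k)%:R = 0.
    by apply: big1 => k' /negPf ->; rewrite mulr0.
  rewrite addr0; have -> : \sum_h y (inr (inr h)) * L_in D k h = (L_in D *m x) k 0.
    by rewrite mxE; apply: eq_bigr => h _; rewrite mxE mulrC.
  by have := y0 (inr (inl k)) => ? ?; lra.
have Lex : L_eq D *m x = 0.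
  apply/matrixP => k o; rewrite ord1 [RHS]mxE; have := yA (inr (inr k)).
  rewrite colE /= !sum0' !add0r => <-; rewrite mxE; apply: eq_bigr => h _.
  by rewrite mxE mulrC.
have x0 h : 0 <= x h 0 by rewrite mxE.
pose q := \sum_k y (inl k) * S2_rhs k.
have neg : q + dot (c1 D) x < 0.
  move: yb; rewrite !big_sumType /= !sum0' !add0r.
  have -> : \sum_h y (inr (inr h)) * c1 D h 0 = dot (c1 D) x.
    by apply: eq_bigr => h _; rewrite mxE mulrC.
  by rewrite /q big_sumType /= !sum0' !add0r.
have [xs Sxs] := S1_neq0 hD; have [M CM] := C2_ub hD.
have Sray s : 0 <= s -> S1 D (xs + s *: x).
  have [h1 h2 h3] := Sxs; move=> s0; split.
  - move=> h; rewrite mxE; have := h1 h; rewrite mxE => h1h.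
    by rewrite [X in _ <= X]mxE [X in _ <= _ + X]mxE addr_ge0 // mulr_ge0.
  - move=> k; rewrite mulmxDr -scalemxAr mxE [X in _ + X]mxE.
    have := h2 k; have := mulr_ge0_le0 s0 (Lx k) => ? ?; lra.
  - by rewrite mulmxDr -scalemxAr Lex scaler0 addr0.
have ray s : 0 <= s -> (C_DRO D <= (dot (c1 D) xs + M + s * (q + dot (c1 D) x))%:E)%E.
  move=> s0; apply: (@le_trans _ _ (DRO_obj D (xs + s *: x))).
    by apply: ereal_inf_lbound; exists (xs + s *: x) => //; exact: Sray.
  have -> : dot (c1 D) xs + M + s * (q + dot (c1 D) x) =
    dot (c1 D) (xs + s *: x) + (M + s * q) by rewrite dotDr dotZr; ring.
  rewrite EFinD; apply: leeD => //; apply: ge_ereal_sup => _ [mu [mu1 _] <-].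
  have mOm := @measurable_Omega R D.
  rewrite /inner_obj -(integral_cst1 (M + s * q) mOm mu1).
  apply: le_integral => //; first exact: (C2_integrable hD mu (Sray s s0)).
    by apply: (@integrable_bounded _ _ _ _ _ _ `|M + s * q|) => //; exact: measurable_cst.
  move=> v /set_mem Ov; apply: ge_ereal_sup => _ [l Sl <-]; rewrite lee_fin.
  have -> : dot (matQ D *m (xs + s *: x) + matP D *m v + vecb D) l =
      dot (matQ D *m xs + matP D *m v + vecb D) l + s * dot (matQ D *m x) l.
    by rewrite mulmxDr -scalemxAr !dotDl dotZl; ring.
  apply: lerD; first by rewrite -lee_fin; apply: le_trans (CM xs v Sxs Ov);
    apply: ereal_sup_ubound; exists l.
  apply: ler_wpM2l => //; rewrite Qx; apply: ler_sum => k _; apply: ler_wpM2l => //.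
  by move: Sl; rewrite S2_polyhedron; exact.
case: (C_DRO D) CD ray => [r _ ray||//].
- suff : 0 <= q + dot (c1 D) x by rewrite leNgt neg.
  rewrite -oppr_le0; apply: (@le0_of_bounded (- (dot (c1 D) xs + M)) _ (- r)) => s s0.
  by have := ray s s0; rewrite lee_fin => ?; lra.
- by move=> _ /(_ 0 (lexx 0)).
Qed.

End SecondStage.

(** * Slopes of convex functions *)

Lemma convex_slopes (R : realType) (f : R -> R) a b c : C_cvx f -> a < b -> b < c ->
  (f b - f a) * (c - b) <= (f c - f b) * (b - a).
Proof.
move=> [_ /convex_functionP fc] ab bc; have ca : 0 < c - a by lra.
pose t := (c - b) / (c - a); have tE : t * (c - a) = c - b by rewrite divfK // gt_eqF.
have t01 : 0 <= t <= 1 by rewrite divr_ge0 ?ler_pdivrMr ?mul1r //; lra.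
have := fc a c t t01; have -> : t * a + (1 - t) * c = b.
  have -> : t * a + (1 - t) * c = c - t * (c - a) by ring.
  by rewrite tE; ring.
rewrite -(ler_pM2l ca); have -> : (c - a) * (t * f a + (1 - t) * f c) =
  t * (c - a) * f a + ((c - a) - t * (c - a)) * f c by ring.
by rewrite tE => ?; lra.
Qed.

(** At a bounded distance from a function with slopes between [lo] and [hi], a
    convex function cannot have slopes outside this interval, because its
    increments would outgrow those of the other function. *)
Lemma convex_close_slopes (R : realType) (lo hi c : R) (f g : R -> R) : C_cvx f ->
  slopes_in lo hi g -> (forall z, 0 <= f z - g z <= c) -> slopes_in lo hi f.
Proof.
move=> fc gs fg y z; rewrite le_eqVlt => /orP[/eqP ->|yz].
  by rewrite !subrr !mulr0 lexx.
have yz0 : 0 < z - y by rewrite subr_gt0.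
have M0 : 0 <= c * (z - y).
  by apply: mulr_ge0 (ltW yz0); case/andP: (fg 0) => /le_trans h /h.
apply/andP; split; rewrite -subr_le0;
  apply: (@le0_of_bounded _ 0 _ (c * (z - y))) => r; rewrite le_eqVlt => /predU1P[<-|r0];
  rewrite ?mul0r ?add0r //.
- have py : y - r < y by rewrite ltrBlDr ltrDl.
  have := convex_slopes fc py yz; have -> : y - (y - r) = r by ring.
  have /andP[gp _] := gs _ _ (ltW py); move: gp; have -> : y - (y - r) = r by ring.
  have := fg y; have := fg (y - r) => /andP[a1 a2] /andP[b1 b2] gp.
  have : lo * r * (z - y) <= (f y - f (y - r) + c) * (z - y) by rewrite ler_pM2r //; lra.
  by move=> ? ?; lra.
- have zp : z < z + r by rewrite ltrDl.
  have := convex_slopes fc yz zp; have -> : z + r - z = r by ring.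
  have /andP[_ gp] := gs _ _ (ltW zp); move: gp; have -> : z + r - z = r by ring.
  have := fg z; have := fg (z + r) => /andP[a1 a2] /andP[b1 b2] gp.
  have : (f (z + r) - f z) * (z - y) <= (hi * r + c) * (z - y) by rewrite ler_pM2r //; lra.
  by move=> ? ?; lra.
Qed.

Lemma slopes_subdiff (R : realType) (lo hi : R) (f : R -> R) z g :
  slopes_in lo hi f -> subdiff f z g -> lo <= g <= hi.
Proof.
move=> fs fg; have := fg (z + 1); have := fg (z - 1).
have /andP[_ h1] := fs z (z + 1) ltac:(lra).
have /andP[h2 _] := fs (z - 1) z ltac:(lra) => ? ?; apply/andP; split; lra.
Qed.

Lemma slopes_growth (R : realType) (lo hi : R) (f : R -> R) :
  slopes_in lo hi f -> growth f.
Proof.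
move=> fs; exists `|f 0|, (`|lo| + `|hi|) => z.
have ineq (r y : R) : 0 <= y -> r * y <= `|r| * y /\ - (r * y) <= `|r| * y.
  move=> y0; split; rewrite ?(ler_wpM2r y0) ?ler_norm // -mulNr ler_wpM2r //.
  by rewrite -normrN ler_norm.
have := ler_norm (f 0); have := ler_norm (- f 0); rewrite normrN => n1 n2.
rewrite mulrDl; have [z0|/ltW z0] := leP 0 z.
  rewrite (ger0_norm z0); have := fs 0 z z0; rewrite subr0 => /andP[a b].
  have [p1 p2] := ineq lo z z0; have [q1 q2] := ineq hi z z0.
  have := mulr_ge0 (normr_ge0 lo) z0; have := mulr_ge0 (normr_ge0 hi) z0 => ? ?.
  by rewrite ler_norml; apply/andP; split; lra.
rewrite (ler0_norm z0); have z1 : 0 <= - z by rewrite oppr_ge0.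
have := fs z 0 z0; rewrite sub0r => /andP[a b].
have [p1 p2] := ineq lo _ z1; have [q1 q2] := ineq hi _ z1.
have := mulr_ge0 (normr_ge0 lo) z1; have := mulr_ge0 (normr_ge0 hi) z1 => ? ?.
by rewrite ler_norml; apply/andP; split; lra.
Qed.

(** * One iteration of the outer algorithm *)

Section OuterIteration.
Context {R : realType} (D : problem R).
Hypothesis hD : standing_assumptions D.
Local Notation d := (ndim D).
Local Notation vecl := 'cV[R]_(m_in D + m_eq D).
Local Notation law_omega := (probability (borel_cV R d) R).
Local Notation Rm := (measurableTypeR R).
Implicit Types (i : 'I_d) (l u : vecl) (x : 'cV[R]_(k1 D)).
Local Notation cf i f := (fine (conj_int i f)).

(** Both the objective at [z] and the optimal value lie between [a] and [b]. *)
Lemma eps_maximizer_bounds (T : Type) (A : set T) (obj : T -> \bar R) z (a b e : R) :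
  A z -> (a%:E <= obj z)%E -> (forall y, A y -> (obj y <= b%:E)%E) -> b - a <= e ->
  eps_maximizer A obj e%:E z.
Proof.
move=> Az az ub bae; split=> //; set s := ereal_sup _.
have zs : (obj z <= s)%E by apply: ereal_sup_ubound; exists z.
have sb : (s <= b%:E)%E by apply: ge_ereal_sup => _ [y Ay <-]; exact: ub.
have az' := le_trans az zs; have zb := le_trans zs sb; move: az' zb az zs sb.
case: (obj z) => // r; case: s => // s; rewrite ?lee_fin => _ _ ar rs sb.
by rewrite ler_norml; apply/andP; split; lra.
Qed.

Lemma eps_minimizer_bounds (T : Type) (A : set T) (obj : T -> \bar R) z (a b e : R) :
  A z -> (obj z <= b%:E)%E -> (forall y, A y -> (a%:E <= obj y)%E) -> b - a <= e ->
  eps_minimizer A obj e%:E z.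
Proof.
move=> Az zb lb bae; split=> //; set s := ereal_inf _.
have zs : (s <= obj z)%E by apply: ereal_inf_lbound; exists z.
have sb : (a%:E <= s)%E by apply: le_ereal_inf_tmp => _ [y Ay <-]; exact: lb.
have sz := le_trans sb zs; have sb' := le_trans zs zb; move: sz sb' zb zs sb.
case: (obj z) => // r; case: s => // s; rewrite ?lee_fin => _ _ rb sr as_.
by rewrite ler_norml; apply/andP; split; lra.
Qed.

Lemma step2b_self V e o w c : output_facts (D := D) V e o w -> 0 <= c -> step2b c o (o_f o).
Proof.
move=> of_ c0 i; have hf := of_hinge of_ i; split.
- exact: hinge_C_cvx hf.
- exact: hinge_piecewise_affine hf.
- move=> z g fg; rewrite /Omega1 /= in_itv /=.
  exact: slopes_subdiff (hinge_slopes hf) fg.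
- by move=> z; rewrite subrr lexx.
Qed.

Section Majorant.
Variables (V : {fset vecl}) (e : R) (o : out1 D) (w : vecl -> R).
Hypothesis of_ : output_facts V e o w.
Variables (fbar : 'I_d -> R -> R) (c : R).
Hypothesis sb : step2b c o fbar.

Lemma fbar_cvx i : C_cvx (fbar i). Proof. by case: (sb i). Qed.

Lemma fbar_slopes i : slopes_in (lo i) (hi i) (fbar i).
Proof.
have [fc _ _ close] := sb i.
exact: convex_close_slopes fc (hinge_slopes (of_hinge of_ i)) close.
Qed.

Lemma fhat_le i z : o_f o i z <= fbar i z.
Proof. by have [_ _ _ /(_ z)/andP[+ _]] := sb i; rewrite subr_ge0. Qed.

Lemma fbar_le i z : fbar i z <= o_f o i z + c.
Proof. by have [_ _ _ /(_ z)/andP[_ +]] := sb i; rewrite lerBlDl. Qed.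

Lemma fhat_ok i : conj_ok i (o_f o i).
Proof. exact: hinge_conj_bounded (of_hinge of_ i). Qed.

Lemma fbar_ok i : conj_ok i (fbar i).
Proof.
have [C fC] := fhat_ok i; exists C => v vi z; apply: le_trans (fC v vi z).
by rewrite lerD2l lerN2 fhat_le.
Qed.

Lemma cf_fbar i : cf i (fbar i) <= cf i (o_f o i) <= cf i (fbar i) + c.
Proof.
have f1 := conj_int_fin (fbar_ok i); have f2 := conj_int_fin (fhat_ok i).
rewrite -!lee_fin EFinD !fineK //; apply/andP; split.
  rewrite -[leRHS]adde0; apply: (conj_int_le (marg1 hD) (fbar_ok i) (fhat_ok i)).
  by move=> z; rewrite addr0 fhat_le.
exact: (conj_int_le (marg1 hD) (fhat_ok i) (fbar_ok i) (fbar_le i)).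
Qed.

Lemma slack_fhat_le x l : slack x (o_f o) l <= slack x fbar l <= slack x (o_f o) l + d%:R * c.
Proof.
rewrite /slack lerD2l -addrA lerD2l; apply/andP; split.
  by apply: ler_sum => i _; exact: fhat_le.
have -> : d%:R * c = \sum_(i < d) c by rewrite sumr_const card_ord mulr_natl.
by rewrite -big_split /=; apply: ler_sum => i _; exact: fbar_le.
Qed.

(** By complementary slackness the constraint is active at some point of [V]. *)
Lemma slack_ge0 : exists2 l, l \in V & 0 <= slack (o_x o) fbar l.
Proof.
suff [l lV l0] : exists2 l, l \in V & 0 <= slack (o_x o) (o_f o) l.
  by exists l => //; apply: le_trans l0 _; case/andP: (slack_fhat_le (o_x o) l).
apply: contrapT => no; have w0 := of_w0 of_.
have neg l : l \in V -> slack (o_x o) (o_f o) l < 0.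
  by move=> lV; rewrite ltNge; apply/negP => l0; apply: no; exists l.
have wz l : l \in V -> w l = 0.
  move=> lV; have := of_slack0 of_; rewrite (big_fsetD1 l) //= => E.
  have rest : \sum_(l' <- (V `\ l)%fset) w l' * slack (o_x o) (o_f o) l' <= 0.
    rewrite big_seq; apply: sumr_le0 => l' /fsetD1P[_ l'V].
    by rewrite mulr_ge0_le0 ?w0 // ltW // neg.
  have : 0 <= w l * slack (o_x o) (o_f o) l by lra.
  rewrite nmulr_lge0 ?neg // => wl; apply/le_anti; rewrite wl.
  exact: w0.
have := of_w1 of_; rewrite big_seq big1 // => /esym/eqP.
by rewrite oner_eq0.
Qed.

Lemma vio_fbar : exists2 l, V_extr D l & vio (o_x o) fbar = (slack (o_x o) fbar l)%:E.
Proof. exact: (vio_attained hD (of_x of_) fbar_cvx fbar_slopes). Qed.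

Lemma vio_fbar_ge l : S2 l -> ((slack (o_x o) fbar l)%:E <= vio (o_x o) fbar)%E.
Proof. by move=> Sl; apply: ereal_sup_ubound; exists l. Qed.

Lemma step2c_exists vt : (forall l, l \in V -> S2 l) -> 0 <= vt ->
  exists l evio, V_extr D l /\ step2c vt o fbar l evio.
Proof.
move=> VS vt0; have [l Vl E] := vio_fbar; have [l0 l0V s0] := slack_ge0.
(* the exact maximum is its own upper estimate *)
exists l, (slack (o_x o) fbar l); split=> //; split; rewrite ?E //.
  exact: V_extr_S2.
have p : 0 <= slack (o_x o) fbar l.
  by rewrite -lee_fin -E; apply: le_trans (vio_fbar_ge (VS _ l0V)); rewrite lee_fin.
by rewrite ler_pdivrMr ?ltr_wpDr // ler_peMr // lerDl.
Qed.

End Majorant.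

Section Bounds.
Variables (it : iter2 D) (e c vtt : R) (w : vecl -> R).
Local Notation V := (i2_V it).
Local Notation o := (i2_out it).
Local Notation fbar := (i2_fbar it).
Local Notation x := (o_x o).
Local Notation evio := (i2_evio it).
Hypothesis VS : forall l, l \in V -> S2 l.
Hypothesis of_ : output_facts V e o w.
Hypothesis sb : step2b c o fbar.
Hypothesis sc : step2c vtt o fbar (i2_lam it) evio.

Let w0 := of_w0 of_.
Let w1 := of_w1 of_.
Let dtau := of_law of_.

Definition LBr : R := \sum_(l <- V) w l * dot (vecb D) l
  - \sum_i fine (OT i (push (o_tau o) i)) + dot (q_in D) (o_xin o) + dot (q_eq D) (o_xeq o).
Definition UBr : R := dot (c1 D) x + \sum_i cf i (fbar i) + evio.

Lemma LBE : LB it = LBr%:E.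
Proof. by rewrite /LB (of_LB of_) (dual_obj_discrete hD w0 w1 dtau VS). Qed.

Lemma eps_subE : eps_sub it = (UBr - LBr)%:E.
Proof.
rewrite /eps_sub LBE; have -> : (\sum_i conj_int i (fbar i) = (\sum_i cf i (fbar i))%:E)%E.
  rewrite -sumEFin; apply: eq_bigr => i _; rewrite fineK //.
  exact: conj_int_fin (fbar_ok of_ sb i).
by rewrite -?EFinD -?EFinB -?EFinD; congr EFin; rewrite /UBr; ring.
Qed.

Lemma UBE : UB it = UBr%:E.
Proof. by rewrite /UB eps_subE LBE -EFinD; congr EFin; ring. Qed.

Lemma eps_probE : eps_prob it = (evio + \sum_i (fine (OT i (push (o_tau o) i))
  + cf i (o_f o i) + \sum_(l <- V) w l * o_f o i (dot (vecp i) l)))%:E.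
Proof.
rewrite /eps_prob EFinD -sumEFin; congr (_ + _)%E; apply: eq_bigr => i _.
rewrite /eps_OT !EFinD fineK ?(OT_push_fin hD w0 w1 dtau) //.
rewrite fineK; last exact: conj_int_fin (fhat_ok of_ i).
by rewrite (push_int_discrete w0 dtau) //; case: (hinge_C_cvx (of_hinge of_ i)).
Qed.

Lemma vio_le l : S2 l -> slack x fbar l <= evio.
Proof.
move=> Sl; have [_ _ _ h] := sc; rewrite -lee_fin; apply: le_trans h.
exact: vio_fbar_ge.
Qed.

(** At a point of [V] the mixtures satisfy the constraint, so their majorants
    violate it by at most [d * c], which bounds [evio] up to the factor
    [1 + vtt]. *)
Lemma eps_sub_stale : 0 <= vtt -> i2_lam it \in V ->
  (eps_sub it <= (d%:R * (e + (1 + vtt) * c))%:E)%E.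
Proof.
move=> vt0 lV; rewrite eps_subE lee_fin.
have [_ + _ _] := sc; rewrite ler_pdivrMr ?ltr_wpDr // => ev.
have /andP[_ s1] := slack_fhat_le sb x (i2_lam it).
have := of_slack_le0 of_ lV => s0.
have : evio <= d%:R * c * (1 + vtt).
  by apply: le_trans ev _; rewrite ler_pM2r ?ltr_wpDr //; lra.
have := of_gap of_; have -> : fine (o_LB o) = LBr by rewrite -/(LB it) LBE.
have : \sum_i cf i (fbar i) <= \sum_i cf i (o_f o i).
  by apply: ler_sum => i _; case/andP: (cf_fbar of_ sb i).
by rewrite /UBr => ? ? ?; lra.
Qed.

(** Both errors are [evio] plus the transport costs, the integrals of the optimal
    dual functions and integrals of conjugates; the latter are taken of the
    functions or of their majorants, which differ by at most [c]. *)
Lemma eps_prob_between :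
  (eps_sub it <= eps_prob it <= eps_sub it + (d%:R * c)%:E)%E.
Proof.
rewrite eps_probE eps_subE -EFinD !lee_fin /UBr /LBr (of_c1 of_) !big_split /=.
have : \sum_i cf i (fbar i) <= \sum_i cf i (o_f o i).
  by apply: ler_sum => i _; case/andP: (cf_fbar of_ sb i).
have : \sum_i cf i (o_f o i) <= \sum_i cf i (fbar i) + d%:R * c.
  have -> : d%:R * c = \sum_(i < d) c by rewrite sumr_const card_ord mulr_natl.
  by rewrite -big_split /=; apply: ler_sum => i _; case/andP: (cf_fbar of_ sb i).
by move=> ? ?; apply/andP; split; lra.
Qed.

Lemma ftilde_shift i z :
  ftilde it i z = fbar i z - (if i == 0%N :> nat then evio else 0).
Proof. by rewrite /ftilde; case: ifP; rewrite ?subr0. Qed.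

Lemma ftilde_slopes i : slopes_in (lo i) (hi i) (ftilde it i).
Proof.
move=> y z yz; rewrite !ftilde_shift; have := fbar_slopes of_ sb i yz.
by set k := if _ then _ else _ => /andP[? ?]; apply/andP; split; lra.
Qed.

Lemma ftilde_cvx i : C_cvx (ftilde it i).
Proof.
have [cont /convex_functionP cvx] := fbar_cvx sb i; split.
  have -> : ftilde it i = fun z => fbar i z - (if i == 0%N :> nat then evio else 0).
    by apply/funext => z; rewrite ftilde_shift.
  by move=> z; apply: cvgB; [exact: cont | exact: cvg_cst].
apply/convex_functionP => y z t t01; have := cvx y z t t01.
by rewrite !ftilde_shift => ?; lra.
Qed.

Lemma ftilde_ok i : conj_ok i (ftilde it i).
Proof.
have [C fC] := fbar_ok of_ sb i.
exists (C + (if i == 0%N :> nat then evio else 0)) => v vi z.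
by rewrite ftilde_shift; have := fC v vi z => ?; lra.
Qed.

Lemma cf_ftilde i : cf i (ftilde it i) = cf i (fbar i) + (if i == 0%N :> nat then evio else 0).
Proof.
have f1 := conj_int_fin (fbar_ok of_ sb i); have f2 := conj_int_fin (ftilde_ok i).
set k := if _ then _ else _; apply/le_anti; apply/andP; split.
  rewrite -lee_fin EFinD !fineK //.
  apply: (conj_int_le (marg1 hD) (ftilde_ok i) (fbar_ok of_ sb i)) => z.
  by rewrite ftilde_shift subrK.
rewrite -lerBrDr -lee_fin EFinB -EFinN fineK // fineK //.
rewrite EFinN; rewrite -(fineK f2).
have := conj_int_le (marg1 hD) (fbar_ok of_ sb i) (ftilde_ok i) (c := - k).
by rewrite -(fineK f1) -(fineK f2) -EFinD; apply => z; rewrite ftilde_shift.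
Qed.

Lemma slack_ftilde l : slack x (ftilde it) l = slack x fbar l - evio.
Proof.
rewrite /slack; under eq_bigr do rewrite ftilde_shift.
by rewrite sumrB (sum_first hD) addrA.
Qed.

Lemma ftilde_feas : primal_feas D (x, ftilde it).
Proof.
split=> /=; [exact: of_x of_ | exact: ftilde_cvx | move=> l Sl].
by rewrite slack_ftilde subr_le0 vio_le.
Qed.

Lemma primal_obj_ftilde : primal_obj D (x, ftilde it) = UBr%:E.
Proof.
rewrite /primal_obj /=.
have -> : (\sum_i conj_int i (ftilde it i) = (\sum_i cf i (ftilde it i))%:E)%E.
  rewrite -sumEFin; apply: eq_bigr => i _; rewrite fineK //.
  exact: conj_int_fin (ftilde_ok i).
rewrite -EFinD; congr EFin; under eq_bigr do rewrite cf_ftilde.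
by rewrite big_split /= (sum_first hD) addrA.
Qed.

Lemma DRO_le_UB : (DRO_obj D x <= UBr%:E)%E.
Proof. by rewrite -primal_obj_ftilde; exact: (DRO_le_primal hD ftilde_feas ftilde_ok). Qed.

Lemma LB_le_DRO x' : S1 D x' -> (LBr%:E <= DRO_obj D x')%E.
Proof.
move=> Sx'; rewrite -LBE /LB (of_LB of_).
exact: (dual_le_DRO hD w0 w1 dtau VS Sx' (of_xin of_) (of_dual of_)).
Qed.

Lemma C_DRO_between : (LB it <= C_DRO D <= UB it)%E.
Proof.
rewrite LBE UBE; apply/andP; split.
  by apply: le_ereal_inf_tmp => _ [x' Sx' <-]; exact: LB_le_DRO.
apply: le_trans DRO_le_UB; apply: ereal_inf_lbound; exists x => //.
exact: of_x of_.
Qed.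

Local Notation sol := (o_tau o, o_xin o, o_xeq o).

Lemma sol_feas : dual_feas D sol.
Proof. exact: (dual_feas_discrete w0 w1 dtau VS (of_xin of_) (of_dual of_)). Qed.

Lemma sol_obj : dual_obj D sol = LBr%:E.
Proof. by rewrite -(of_LB of_) -/(LB it) LBE. Qed.

(** Weak duality against [ftilde], whose objective exceeds the one of [sol] by
    [eps_sub]. *)
Lemma sol_optimal : eps_maximizer (dual_feas D) (dual_obj D) (eps_sub it) sol.
Proof.
rewrite eps_subE; apply: eps_maximizer_bounds (lexx _).
- exact: sol_feas.
- by rewrite sol_obj.
move=> [[tau xin] xeq] fd; rewrite -primal_obj_ftilde.
apply: (weak_duality hD ftilde_feas fd) => i; have [ht _ _] := fd.
have [cont _] := ftilde_cvx i.
apply: (growth_integrable i ht _ (slopes_growth (ftilde_slopes i))).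
exact: continuous_measurable_fun.
Qed.

Lemma ftilde_optimal :
  eps_minimizer (primal_feas D) (primal_obj D) (eps_sub it) (x, ftilde it).
Proof.
rewrite eps_subE; apply: eps_minimizer_bounds (lexx _).
- exact: ftilde_feas.
- by rewrite primal_obj_ftilde.
move=> [x' fs] fp; rewrite -sol_obj; apply: (weak_duality hD fp sol_feas) => i.
have [_ /(_ i)[cont _] _] := fp.
have mf : measurable_fun setT (fs i : Rm -> Rm) by exact: continuous_measurable_fun.
exact: integrable_discrete w0 dtau (measurableT_comp mf (measurable_dot (vecp i))).
Qed.

Lemma x_optimal : eps_minimizer (S1 D) (DRO_obj D) (eps_sub it) x.
Proof.
rewrite eps_subE; apply: eps_minimizer_bounds (lexx _).
- exact: of_x of_.
- exact: DRO_le_UB.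
- exact: LB_le_DRO.
Qed.

(** The reconstruction attains at least the transport bound [a], and the primal
    constraint bounds all other scenarios by [b]; complementary slackness bounds
    [b - a] by [eps_prob]. *)
Lemma muhat_optimal (muhat : law_omega) : reconstruction V (o_tau o) muhat ->
  eps_maximizer (Gamma D) (inner_obj x) (eps_prob it) muhat.
Proof.
move=> /(reconstruction_coupling dtau)[dT [T [Pr [lam [sg [J [U [cp muE]]]]]]]].
pose a := \sum_(l <- V) w l * dot (matQ D *m x + vecb D) l
  - \sum_i fine (OT i (push (o_tau o) i)).
pose b := \sum_i cf i (fbar i) + evio.
rewrite eps_probE; apply: (@eps_maximizer_bounds _ _ _ _ a b).
- exact: (coupling_Gamma (lohi hD) (marg1 hD) w0 w1 dtau cp muE).
- have [M CM] := C2_ub hD.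
  have := coupling_inner_obj (lohi hD) (marg1 hD) w0 w1 dtau cp muE VS
    (fun v Ov => CM x v (of_x of_) Ov).
  apply: le_trans; rewrite /a EFinB; apply: leeD => //.
  have -> : (\sum_i OT i (push (o_tau o) i) =
      (\sum_i fine (OT i (push (o_tau o) i)))%:E)%E => //.
  rewrite -sumEFin; apply: eq_bigr => i _; rewrite fineK //.
  exact: (OT_push_fin hD w0 w1 dtau).
- move=> mu Gmu; have [Sx _ sl] := ftilde_feas.
  apply: le_trans (inner_le_conj hD Sx sl ftilde_ok Gmu) _.
  have -> : (\sum_i conj_int i (ftilde it i) = (\sum_i cf i (ftilde it i))%:E)%E.
    rewrite -sumEFin; apply: eq_bigr => i _; rewrite fineK //.
    exact: conj_int_fin (ftilde_ok i).
  rewrite lee_fin; under eq_bigr do rewrite cf_ftilde.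
  by rewrite big_split /= (sum_first hD).
rewrite /a /b !big_split /=.
have : \sum_i cf i (fbar i) <= \sum_i cf i (o_f o i).
  by apply: ler_sum => i _; case/andP: (cf_fbar of_ sb i).
have : \sum_(l <- V) w l * dot (matQ D *m x + vecb D) l
    + \sum_i \sum_(l <- V) w l * o_f o i (dot (vecp i) l) = 0.
  rewrite -[RHS](of_slack0 of_) exchange_big /= -big_split /=; apply: eq_bigr => l _.
  by rewrite /slack mulrDr -mulr_sumr.
by move=> ? ?; lra.
Qed.

End Bounds.
End OuterIteration.

(** * Runs of the outer algorithm *)

(** Otherwise a tail of the sequence, hence its limit inferior, would be at least
    [a]. *)
Lemma limn_einf_frequently (R : realType) (u : nat -> R) (a : R) :
  (limn_einf (fun t => (u t)%:E) < a%:E)%E -> forall N, exists2 t, (N <= t)%N & u t <= a.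
Proof.
move=> lim N; apply: contrapT => no; move: lim; rewrite ltNge => /negP; apply.
rewrite limn_einf_lim; apply: lime_ge; first exact: is_cvg_einfs.
exists N => // n /= Nn; apply: le_ereal_inf_tmp => _ [k /= nk <-].
rewrite lee_fin leNgt; apply/negP => ua; apply: no; exists k; last exact: ltW.
exact: leq_trans nk.
Qed.

Lemma count_frequently (P : pred nat) : (forall N, exists2 t, (N <= t)%N & P t) ->
  forall n, exists t, (n <= count P (iota 1 t))%N.
Proof.
move=> freq; elim=> [|n [t nt]]; first by exists 0%N.
have [s ts Ps] := freq t.+1; exists s.
have -> : iota 1 s = iota 1 t ++ iota t.+1 (s - t.+1) ++ [:: s].
  have -> : [:: s] = iota (t.+1 + (s - t.+1)) 1 by rewrite subnKC.
  by rewrite -iotaD -[t.+1]add1n -iotaD; congr iota; rewrite addn1 addnS -addSn subnKC.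
by rewrite !count_cat /= Ps addn0 addnA addn1 ltnS (leq_trans nt) ?leq_addr.
Qed.

Section OuterAlgorithm.
Context {R : realType} (D : problem R).
Hypothesis hD : standing_assumptions D.
Local Notation d := (ndim D).
Local Notation vecl := 'cV[R]_(m_in D + m_eq D).
Variable inp : inputs2 R.
Hypothesis adm : admissible D inp.
Implicit Types (s : nat -> iter2 D) (t u : nat).

Definition cost t : R := d%:R * (eOT inp t + (1 + vt inp t) * vs inp t).

Lemma reaches2_good s t : (0 < t)%N -> reaches2 inp s t -> good_V (i2_V (s t)).
Proof.
case: t => // t _; elim: t => [|t IH] [in2 steps].
  have [l0 [xin [xeq [Sl0 xi la ->]]]] := in2; split.
    by move=> l; rewrite inE => /eqP ->.
  by exists l0, xin, xeq; split => //; rewrite inE.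
have [|VS [l0 [xin [xeq [l0V xi la]]]]] := IH.
  by split=> // u /andP[u0 ut]; apply: steps; rewrite u0 ltnW.
have [[_ _ _ [hS _]] _ ->] := steps t.+1 (leqnn _); split.
  by move=> l; rewrite inE => /orP[/VS|/hS].
by exists l0, xin, xeq; split => //; rewrite inE l0V.
Qed.

Lemma reaches2_mem s u t : (0 < u < t)%N -> reaches2 inp s t -> i2_lam (s u) \in i2_V (s t).
Proof.
move=> + [_ steps]; elim: t steps => [|t IH] steps /andP[u0]; first by rewrite ltn0.
rewrite ltnS leq_eqVlt => /orP[/eqP E|ut].
  have [|[_ _ _ [_ lV]] _] := steps u; first by rewrite u0 E leqnn.
  by rewrite E => ->; rewrite inE -E lV orbT.
have [|_ _ ->] := steps t; first by rewrite (leq_ltn_trans _ ut) ?leqnn.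
by rewrite inE IH ?u0 // => v /andP[v0 vt]; apply: steps; rewrite v0 ltnW.
Qed.

Lemma reaches2_prefix s u t : (u <= t)%N -> reaches2 inp s t -> reaches2 inp s u.
Proof.
move=> ut [in2 steps]; split=> // v /andP[v0 vu]; apply: steps.
by rewrite v0 (leq_trans vu).
Qed.

(** Were the point already present, [eps_sub_stale] would bound the error by the
    tolerance and the loop would have stopped. *)
Lemma fresh_point s u t : (0 < u < t)%N -> reaches2 inp s t -> cost u <= etol inp ->
  i2_lam (s u) \notin i2_V (s u).
Proof.
move=> ut rt cu; have /andP[u0 _] := ut; have [_ /(_ u ut)[bd ns _]] := rt.
have gV := reaches2_good u0 (reaches2_prefix (ltnW (andP ut).2) rt).
have [ou sb sc _] := bd; have [w of_] := output1_facts hD gV ou.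
have [_ _ vt0] := adm.1 u u0; apply/negP => lV; apply: ns.
apply: le_trans (eps_sub_stale hD gV.1 of_ sb sc vt0 lV) _.
by rewrite lee_fin.
Qed.

(** By [fresh_point], iterations of small cost add pairwise distinct extreme
    points. *)
Lemma count_small_cost s t : (0 < t)%N -> reaches2 inp s t -> lam_extr_before s t ->
  (count (fun u => (cost u <= etol inp)%R) (iota 1 t.-1) <= #|` fset_set (V_extr D)|)%N.
Proof.
case: t => // t _ rt ex; rewrite -size_filter; set L := [seq u <- iota _ _ | _].
have LP u : u \in L -> (0 < u < t.+1)%N /\ cost u <= etol inp.
  by rewrite mem_filter mem_iota add1n => /andP[].
rewrite -(size_map (fun u => i2_lam (s u)) L); apply: uniq_leq_size.
  rewrite map_inj_in_uniq ?filter_uniq ?iota_uniq //.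
  have key u v : u \in L -> v \in L -> (u < v)%N -> i2_lam (s u) <> i2_lam (s v).
    move=> /LP[/andP[u0 _] _] /LP[vt cv] uv E.
    have := fresh_point vt rt cv; rewrite -E (@reaches2_mem s u v) ?u0 //.
    by apply: reaches2_prefix rt; case/andP: vt => _ /ltnW.
  move=> u v uL vL E; case: (ltngtP u v) => // uv.
    by case: (key _ _ uL vL uv).
  by case: (key _ _ vL uL uv).
move=> _ /mapP[u /LP[ut _] ->]; rewrite in_fset_set ?mem_set //.
  exact: ex.
exact: V_extr_finite.
Qed.

Lemma terminates2P : (-oo < C_DRO D)%E -> terminates2 D inp.
Proof.
move=> CD; split.
- exact: init2_exists.
- move=> s t t0 rt _; have gV := reaches2_good t0 rt.
  have [e0 vs0 vt0] := adm.1 t t0; split.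
  + exact: terminates1P.
  + by move=> o /(output1_facts hD gV)[w of_]; exists (o_f o); exact: step2b_self of_ vs0.
  + move=> o fbar /(output1_facts hD gV)[w of_] sb.
    exact: (step2c_exists hD of_ sb gV.1 vt0).
- move=> s run.
  have [t] := count_frequently (limn_einf_frequently adm.2) (#|` fset_set (V_extr D)|).+1.
  have [rt ex] := run t.+1; have := count_small_cost (ltn0Sn t) rt ex.
  by move=> /leq_ltn_trans h /h; rewrite ltnn.
Qed.

Lemma iteration_bound s t : (forall t, (0 < t)%N ->
    [/\ eOT inp t = eOT inp 1%N, vs inp t = vs inp 1%N & vt inp t = vt inp 1%N]) ->
  (0 < t)%N -> reaches2 inp s t -> lam_extr_before s t ->
  (t <= #|` fset_set (V_extr D)| + 1)%N.
Proof.
move=> cst t0 rt ex; have := count_small_cost t0 rt ex.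
have [N N1 cN] := limn_einf_frequently adm.2 1%N.
have costE u : (0 < u)%N -> cost u <= etol inp.
  move=> u0; have [a b c] := cst u u0; have [a' b' c'] := cst N N1.
  by rewrite /cost a b c -a' -b' -c'.
have -> : count (fun u => cost u <= etol inp) (iota 1 t.-1) = t.-1.
  rewrite -[RHS](size_iota 1); apply/eqP; rewrite -all_count; apply/allP => u.
  by rewrite mem_iota => /andP[/costE].
by rewrite -ltnS prednK // addn1.
Qed.

End OuterAlgorithm.

Theorem theorem4p6 (R : realType) (D : problem R)
    (hD : standing_assumptions D) (hDRO : (-oo < C_DRO D)%E)
    (inp : inputs2 R) (hinp : admissible D inp) :
  [/\ (* (i) *)
      forall (s : nat -> iter2 D) (t : nat), (0 < t)%N -> reaches2 inp s t ->
        output1 (i2_V (s t)) (eOT inp t) (i2_out (s t)) ->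
        step2b (vs inp t) (i2_out (s t)) (i2_fbar (s t)) ->
        (vio (o_x (i2_out (s t))) (i2_fbar (s t)) < +oo)%E /\
        exists2 l, V_extr D l &
          (slack (o_x (i2_out (s t))) (i2_fbar (s t)) l)%:E =
          vio (o_x (i2_out (s t))) (i2_fbar (s t)),
      (* (ii) *)
      terminates2 D inp /\
      ((forall t, (0 < t)%N ->
          [/\ eOT inp t = eOT inp 1%N, vs inp t = vs inp 1%N &
              vt inp t = vt inp 1%N]) ->
       finite_set (V_extr D) /\
       forall (s : nat -> iter2 D) (t : nat), (0 < t)%N ->
         reaches2 inp s t -> lam_extr_before s t ->
         (t <= #|` fset_set (V_extr D)| + 1)%N),
      (* (iii)-(vi) *)
      forall (s : nat -> iter2 D) (t : nat),
        ended2 inp s t -> lam_extr_before s t.+1 ->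
        [/\ (* (iii) *)
            [/\ (LB (s t) <= C_DRO D <= UB (s t))%E,
                eps_sub (s t) = (UB (s t) - LB (s t))%E,
                (eps_sub (s t) <= (etol inp)%:E)%E,
                (eps_sub (s t) <= eps_prob (s t)
                   <= eps_sub (s t) + ((ndim D)%:R * vs inp t)%:E)%E &
                (eps_sub (s t) + ((ndim D)%:R * vs inp t)%:E
                   <= (etol inp)%:E + ((ndim D)%:R)%:E
                      * ereal_sup [set (vs inp u)%:E | u in [set u | (0 < u)%N]])%E],
            (* (iv) *)
            (let sol := (o_tau (i2_out (s t)), o_xin (i2_out (s t)),
                         o_xeq (i2_out (s t))) in
             eps_maximizer (dual_feas D) (dual_obj D) (eps_sub (s t)) sol /\
             dual_obj D sol = LB (s t)),
            (* (v) *)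
            (let sol := (o_x (i2_out (s t)), ftilde (s t)) in
             eps_minimizer (primal_feas D) (primal_obj D) (eps_sub (s t)) sol /\
             primal_obj D sol = UB (s t)) &
            (* (vi) *)
            eps_minimizer (S1 D) (DRO_obj D) (eps_sub (s t)) (o_x (i2_out (s t))) /\
            forall muhat : probability (borel_cV R (ndim D)) R,
              reconstruction (i2_V (s t)) (o_tau (i2_out (s t))) muhat ->
              eps_maximizer (Gamma D) (inner_obj (o_x (i2_out (s t))))
                (eps_prob (s t)) muhat] &
      (* last sentence of (iii) *)
      forall delta : R, 0 < delta -> exists2 eta : R, 0 < eta &
        forall inp' : inputs2 R, admissible D inp' -> etol inp' <= eta ->
        (forall t, (0 < t)%N -> vs inp' t <= eta) ->
        forall (s : nat -> iter2 D) (t : nat),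
          ended2 inp' s t -> lam_extr_before s t.+1 ->
          (`|eps_sub (s t)| <= delta%:E)%E /\ (`|eps_prob (s t)| <= delta%:E)%E].

Proof.
have main inp' (adm : admissible D inp') (s : nat -> iter2 D) t : ended2 inp' s t ->
    exists w, [/\ forall l, l \in i2_V (s t) -> S2 l,
      output_facts (i2_V (s t)) (eOT inp' t) (i2_out (s t)) w,
      step2b (vs inp' t) (i2_out (s t)) (i2_fbar (s t)) &
      step2c (vt inp' t) (i2_out (s t)) (i2_fbar (s t)) (i2_lam (s t)) (i2_evio (s t))].
  move=> [t0 rt [ou sb sc _] _]; have gV := reaches2_good t0 rt.
  by have [w of_] := output1_facts hD gV ou; exists w; split => //; exact: gV.1.
split.
- move=> s t t0 rt ou sb; have gV := reaches2_good t0 rt.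
  have [w of_] := output1_facts hD gV ou.
  have [l Vl E] := vio_fbar hD of_ sb.
  by rewrite E ltry; split=> //; exists l.
- split; first exact: terminates2P.
  move=> cst; split; first exact: V_extr_finite.
  by move=> s t; exact: iteration_bound.
- move=> s t en _; have [w [VS of_ sb sc]] := main inp hinp s t en.
  have [t0 rt _ st] := en; split.
  + split.
    * exact: C_DRO_between VS of_ sb sc.
    * rewrite (UBE hD VS of_ sb) (LBE hD VS of_) -EFinB.
      exact: (eps_subE hD VS of_ sb).
    * exact: st.
    * exact: (eps_prob_between hD VS of_ sb).
    * apply: leeD; first exact: st.
      rewrite EFinM; apply: lee_wpmul2l; first by rewrite lee_fin.
      by apply: ereal_sup_ubound; exists t.
  + split; first exact: (sol_optimal hD VS of_ sb sc).
    by rewrite (sol_obj hD VS of_) (LBE hD VS of_).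
  + split; first exact: (ftilde_optimal hD VS of_ sb sc).
    by rewrite (primal_obj_ftilde hD of_ sb) (UBE hD VS of_ sb).
  + split; first exact: (x_optimal hD VS of_ sb sc).
    by move=> muhat; exact: (muhat_optimal hD VS of_ sb sc).
- move=> delta d0; have n0 : 0 < 1 + (ndim D)%:R :> R by rewrite ltr_pwDl.
  (* eps_sub <= eta and eps_prob <= eta + d eta *)
  exists (delta / (1 + (ndim D)%:R)); first by rewrite divr_gt0.
  set eta := delta / _; have etaE : eta * (1 + (ndim D)%:R) = delta by rewrite divfK ?gt_eqF.
  move=> inp' adm et vse s t en _; have [w [VS of_ sb sc]] := main inp' adm s t en.
  have [t0 _ _ st] := en.
  have := eps_prob_between hD VS of_ sb; have := C_DRO_between hD VS of_ sb sc.
  move: st; rewrite /stop2 (eps_probE hD of_) (eps_subE hD VS of_ sb).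
  rewrite (UBE hD VS of_ sb) (LBE hD VS of_) -EFinD !lee_fin.
  set ep := i2_evio _ + _ => st /andP[/le_trans h /h]; rewrite lee_fin => es /andP[p1 p2].
  have : (ndim D)%:R * vs inp' t <= (ndim D)%:R * eta by rewrite ler_wpM2l // vse.
  have nn : 0 <= (ndim D)%:R * eta by rewrite mulr_ge0 // divr_ge0 // ltW.
  by move=> ?; split; rewrite ?lee_fin ler_norml; apply/andP; split; lra.
Qed.
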